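(* Let $(X\mid Y)$ be a contractible presentation and let $(X_1\mid Y_1)$ be a finite subpresentation of it. Let $Z$ be a set of cardinality $|X_1|-|Y_1|$, and let $P_\bullet$ be the free simplicial group of the presentation $(X_1\mid Y_1)$. For $R=\mathbb Q$, or $R=\mathbb F_p$ with $p$ a prime, there is a homotopy equivalence \[ R_\infty\,\overline W P_\bullet\ \simeq\ K(F_R(Z),1), \] where $F_{\mathbb Q}(Z)$ denotes the group of rational points of the free prounipotent group over $\mathbb Q$ on $Z$ and $F_{\mathbb F_p}(Z)$ denotes the free pro-$p$ group on $Z$ (both regarded as abstract groups in $K(-,1)$). In particular, the fundamental group of $R_\infty\overline W P_\bullet$ is isomorphic to $F_R(Z)$ and all its higher homotopy groups vanish.
   Context: A presentation $(X\mid Y)$ consists of a set $X$ of generators and a set $Y$ of relators; the relator indexed by $y\in Y$ is a word $r_y\in\Phi(X)$, where $\Phi(X)$ is the free discrete group on $X$. Its standard presentation complex $K(X\mid Y)$ is the 2-dimensional CW-complex with one $0$-cell, one $1$-cell for each $x\in X$, and one $2$-cell for each $y\in Y$ attached along a loop representing $r_y$. The presentation is contractible if $K(X\mid Y)$ is contractible. A subpresentation $(X_1\mid Y_1)$ is a choice of subsets $X_1\subseteq X$, $Y_1\subseteq Y$ such that $r_y\in\Phi(X_1)$ for all $y\in Y_1$; it is finite if $X_1$ and $Y_1$ are finite. The free simplicial group $P_\bullet$ of $(X_1\mid Y_1)$ (its simplicial presentation) has free bases closed under degeneracies, with nondegenerate free generators $X_1$ in degree $0$, $Y_1$ in degree $1$,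 and none in degrees $\ge 2$; in degree one $d_0(y)=1$ and $d_1(y)=r_y$. Thus $P_0=\Phi(X_1)$, $P_1=\Phi(s_0X_1\sqcup Y_1)$, etc. Its classifying space $\overline W P_\bullet$ (the paper also writes $\overline W(X_1\mid Y_1)$) is a simplicial set whose realization is homotopy equivalent to $K(X_1\mid Y_1)$. $R_\infty$ is the Bousfield--Kan $R$-completion. For the finite-type free simplicial group $P_\bullet$ it is modelled by $R_\infty\overline WP_\bullet\simeq\overline W((P_\bullet)^\wedge_R)$, where $(P_\bullet)^\wedge_R$ is the degreewise completion: the rational points of the rational prounipotent completion for $R=\mathbb Q$, the pro-$p$ completion for $R=\mathbb F_p$ (Bousfield--Kan). With $\gamma_1G=G$, $\gamma_{s+1}G=[G,\gamma_sG]$, and $(-)_0$ the Malcev completion (rationalization) of a nilpotent group, $F_{\mathbb Q}(Z)=\varprojlim_s(\Phi(Z)/\gamma_s\Phi(Z))_0$; equivalently it is the exponential of the degree-completed free Lie algebra over $\mathbb Q$ on $Z$ (with Baker--Campbell--Hausdorff multiplication). *)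

(* Defs.v *)
From HB Require Import structures.
From mathcomp Require Import all_boot all_order all_algebra finmap zify.
From mathcomp Require Import all_classical all_reals all_analysis.

Set Implicit Arguments.
Unset Strict Implicit.
Unset Printing Implicit Defensive.

Import Order.TTheory GRing.Theory Num.Theory numFieldNormedType.Exports.

Local Open Scope classical_set_scope.
Local Open Scope group_scope.
Local Open Scope quotient_scope.

Notation ghom G H := (UMagmaMorphism.type G H).

(* A letter (x, true) stands for x and (x, false) for x^-1. *)
Definition flip (T : Type) (l : T * bool) : T * bool := (l.1, ~~ l.2).

Section FreeGroup.
Variable T : choiceType.
Implicit Types (l : T * bool) (u v w : seq (T * bool)).

Definition reduced w : bool := sorted (fun l l' => l' != flip l) w.

Definition fcons l w :=
  if w is l' :: w' then if l' == flip l then w' else l :: w else [:: l].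

Lemma flipK : involutive (@flip T).
Proof. by case=> x b; rewrite /flip /= negbK. Qed.

Lemma reduced_fcons l w : reduced w -> reduced (fcons l w).
Proof.
case: w => //= l' w rw; case: ifPn => [_|ll'] /=; last by rewrite ll'.
exact: path_sorted rw.
Qed.

Lemma fconsK l w : reduced w -> fcons l (fcons (flip l) w) = w.
Proof.
case: w => [|l' w] rw /=; first by rewrite eqxx.
rewrite flipK; case: (eqVneq l' l) rw => [-> rw|ll' rw] /=; last by rewrite eqxx.
by case: w rw => //= l'' w /andP[/negPf-> _].
Qed.

Lemma fcons_reduced l w : reduced (l :: w) -> fcons l w = l :: w.
Proof. by case: w => //= l' w /andP[/negPf->]. Qed.

Definition fmul u v := foldr fcons v u.
Definition finv u := rev (map (@flip T) u).

Lemma reduced_fmul u v : reduced v -> reduced (fmul u v).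
Proof. by move=> rv; elim: u => //= l u; exact: reduced_fcons. Qed.

Lemma fmul_fcons l v w : reduced v -> reduced w ->
  fmul (fcons l v) w = fcons l (fmul v w).
Proof.
case: v => //= l' v rv rw; case: eqP => [->|] //=.
by rewrite fconsK //; apply: reduced_fmul.
Qed.

Lemma fmulA u v w : reduced v -> reduced w ->
  fmul u (fmul v w) = fmul (fmul u v) w.
Proof.
move=> rv rw; elim: u => //= l u ->.
by rewrite fmul_fcons //; apply: reduced_fmul.
Qed.

Lemma fmul1 u : reduced u -> fmul u [::] = u.
Proof.
elim: u => //= l u IH ru; rewrite IH; first exact: fcons_reduced.
exact: path_sorted ru.
Qed.

Lemma fmulV u : reduced u -> fmul (finv u) u = [::].
Proof.
elim: u => //= l u IH ru.
rewrite /finv /= rev_cons /fmul foldr_rcons /= flipK eqxx.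
exact: IH (path_sorted ru).
Qed.

Lemma finvK : involutive finv.
Proof. by move=> u; rewrite /finv map_rev revK mapK //; exact: flipK. Qed.

Lemma reduced_finv u : reduced u -> reduced (finv u).
Proof.
rewrite /reduced /finv rev_sorted sorted_map; apply: sub_sorted => l l' /=.
by apply: contra => /eqP ->; rewrite flipK.
Qed.

Definition freegroup := {w : seq (T * bool) | reduced w}.
HB.instance Definition _ := Choice.on freegroup.

Implicit Types a b c : freegroup.

Definition free_one : freegroup := Sub [::] isT.
Definition free_mul a b : freegroup :=
  Sub (fmul (val a) (val b)) (reduced_fmul (val a) (valP b)).
Definition free_inv a : freegroup := Sub (finv (val a)) (reduced_finv (valP a)).

Lemma free_mulA : associative free_mul.
Proof. by move=> a b c; apply: val_inj; apply: fmulA; exact: valP. Qed.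
Lemma free_mul1 : left_id free_one free_mul.
Proof. by move=> a; apply: val_inj. Qed.
Lemma free_1mul : right_id free_one free_mul.
Proof. by move=> a; apply: val_inj; apply: fmul1; exact: valP. Qed.
Lemma free_mulV : left_inverse free_one free_inv free_mul.
Proof. by move=> a; apply: val_inj; apply: fmulV; exact: valP. Qed.
Lemma free_Vmul : right_inverse free_one free_inv free_mul.
Proof.
move=> a; apply: val_inj; rewrite /= -{1}(finvK (val a)).
by apply: fmulV; apply: reduced_finv; exact: valP.
Qed.

HB.instance Definition _ := isGroup.Build freegroup
  free_mulA free_mul1 free_1mul free_mulV free_Vmul.

Definition free_gen (x : T) : freegroup := Sub [:: (x, true)] isT.

End FreeGroup.

Section FreeLift.
Variables (T : choiceType) (G : groupType) (f : T -> G).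

Definition eval_letter (l : T * bool) : G := if l.2 then f l.1 else (f l.1)^-1.
Definition eval_word (w : seq (T * bool)) : G :=
  foldr (fun l g => eval_letter l * g) 1 w.
Definition free_lift_fun (a : freegroup T) : G := eval_word (val a).

Lemma eval_flip l : eval_letter (flip l) = (eval_letter l)^-1.
Proof. by case: l => x [] //=; rewrite /eval_letter /= invgK. Qed.

Lemma eval_fcons l w : eval_word (fcons l w) = eval_letter l * eval_word w.
Proof.
case: w => //= l' w; case: eqP => [->|//].
by rewrite eval_flip mulgA mulgV mul1g.
Qed.

Lemma free_lift1 : free_lift_fun 1 = 1.
Proof. by []. Qed.

Lemma free_liftM : {morph free_lift_fun : a b / a * b}.
Proof.
move=> [u ru] [v rv]; rewrite /free_lift_fun /= /fmul.
by elim: u {ru} => /= [|l u IH]; rewrite ?mul1g // eval_fcons IH mulgA.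
Qed.

HB.instance Definition _ := isUMagmaMorphism.Build (freegroup T) G
  free_lift_fun (free_lift1, free_liftM).

Definition free_lift : ghom (freegroup T) G := free_lift_fun.

Lemma free_liftE x : free_lift (free_gen x) = f x.
Proof. by rewrite /free_lift /= /free_lift_fun /= mulg1. Qed.

End FreeLift.

Lemma free_ext (T : choiceType) (G : groupType) (f g : ghom (freegroup T) G) :
  (forall x, f (free_gen x) = g (free_gen x)) -> f =1 g.
Proof.
move=> fg a.
pose F w (rw : reduced w) : freegroup T := Sub w rw.
have -> : a = F (val a) (valP a) by apply: val_inj.
elim: (val a) (valP a) => {a} [|l w IH] rw.
  by have -> : F [::] rw = 1 by [apply: val_inj]; rewrite !gmulf1.
have rw' : reduced w by exact: path_sorted rw.
pose b : freegroup T := if l.2 then free_gen l.1 else (free_gen l.1)^-1.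
have -> : F (l :: w) rw = b * F w rw'.
  apply: val_inj => /=; rewrite -[LHS]fcons_reduced //.
  by rewrite /b; case: (l) => x [].
by rewrite !gmulfM IH /b; congr (_ * _); case: l.2; rewrite ?gmulfV fg.
Qed.

Definition free_map (S T : choiceType) (f : S -> T) :
    ghom (freegroup S) (freegroup T) :=
  free_lift (fun x => free_gen (f x)).

Record normal_subgroup (G : groupType) := NormalSubgroup {
  nsub :> set G;
  nsub1 : nsub 1;
  nsubM : forall x y, nsub x -> nsub y -> nsub (x * y);
  nsubV : forall x, nsub x -> nsub x^-1;
  nsubJ : forall x y, nsub x -> nsub (x ^ y)
}.

Section Quotient.
Variables (G : groupType) (N : normal_subgroup G).

Definition coset_rel : rel G := fun x y => `[< nsub N (x^-1 * y) >].

Lemma coset_refl : reflexive coset_rel.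
Proof. by move=> x; apply/asboolP; rewrite mulVg; exact: nsub1. Qed.

Lemma coset_sym : symmetric coset_rel.
Proof.
move=> x y; apply/asboolP/asboolP => /nsubV; by rewrite invgM invgK.
Qed.

Lemma coset_trans : transitive coset_rel.
Proof.
move=> y x z /asboolP xy /asboolP yz; apply/asboolP.
by have := nsubM xy yz; rewrite mulgA mulgK.
Qed.

Canonical coset_equiv := EquivRel coset_rel coset_refl coset_sym coset_trans.

Definition quotient := {eq_quot coset_equiv}.
HB.instance Definition _ := Choice.on quotient.
HB.instance Definition _ := EqQuotient.on quotient.

Definition qproj_fun (x : G) : quotient := \pi_quotient x.

Lemma qprojP x y : qproj_fun x = qproj_fun y <-> nsub N (x^-1 * y).
Proof.
split=> [|Nxy]; first by move/eqmodP/asboolP.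
by apply/eqmodP/asboolP.
Qed.

Definition qone := qproj_fun 1.
Definition qmul (a b : quotient) := qproj_fun (repr a * repr b).
Definition qinv (a : quotient) := qproj_fun (repr a)^-1.

Lemma qreprK a : qproj_fun (repr a) = a. Proof. exact: reprK. Qed.

Lemma qproj_ind (P : quotient -> Prop) :
  (forall x, P (qproj_fun x)) -> forall a, P a.
Proof. by move=> Px a; rewrite -(qreprK a). Qed.

Lemma qmulE x y : qmul (qproj_fun x) (qproj_fun y) = qproj_fun (x * y).
Proof.
have /qprojP Nx := qreprK (qproj_fun x).
have /qprojP Ny := qreprK (qproj_fun y).
apply/qprojP; rewrite invgM -mulgA.
have := nsubM (nsubJ (repr (qproj_fun y)) Nx) Ny.
by rewrite /conjg !mulgA mulgK.
Qed.

Lemma qinvE x : qinv (qproj_fun x) = qproj_fun x^-1.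
Proof.
have /qprojP Nx := qreprK (qproj_fun x).
apply/qprojP; rewrite invgK.
have := nsubJ x^-1 (nsubV Nx).
by rewrite /conjg invgM !invgK !mulgA mulgV mul1g.
Qed.

Lemma qmulA : associative qmul.
Proof.
by elim/qproj_ind=> x; elim/qproj_ind=> y; elim/qproj_ind=> z;
  rewrite !qmulE mulgA.
Qed.
Lemma qmul1 : left_id qone qmul.
Proof. by elim/qproj_ind=> x; rewrite qmulE mul1g. Qed.
Lemma q1mul : right_id qone qmul.
Proof. by elim/qproj_ind=> x; rewrite qmulE mulg1. Qed.
Lemma qmulV : left_inverse qone qinv qmul.
Proof. by elim/qproj_ind=> x; rewrite qinvE qmulE mulVg. Qed.
Lemma qVmul : right_inverse qone qinv qmul.
Proof. by elim/qproj_ind=> x; rewrite qinvE qmulE mulgV. Qed.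

HB.instance Definition _ := isGroup.Build quotient qmulA qmul1 q1mul qmulV qVmul.

Lemma qprojM : {morph qproj_fun : x y / x * y}.
Proof. by move=> x y; rewrite -qmulE. Qed.

HB.instance Definition _ := isUMagmaMorphism.Build G quotient qproj_fun
  (erefl, qprojM).

Definition qproj : ghom G quotient := qproj_fun.

End Quotient.

Section QuotientMap.
Variables (G H : groupType) (M : normal_subgroup G) (N : normal_subgroup H).
Variables (f : ghom G H) (MN : M `<=` f @^-1` N).

Definition qmap_fun (a : quotient M) : quotient N := qproj N (f (repr a)).

Lemma qmap_funE x : qmap_fun (qproj M x) = qproj N (f x).
Proof.
apply/qprojP; rewrite -gmulfV -gmulfM; apply: MN; apply/qprojP.
exact: qreprK.
Qed.

Lemma qmap1 : qmap_fun 1 = 1.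
Proof. by rewrite -(gmulf1 (s := qproj M)) qmap_funE gmulf1 gmulf1. Qed.

Lemma qmapM : {morph qmap_fun : a b / a * b}.
Proof.
elim/qproj_ind=> x; elim/qproj_ind=> y.
by rewrite -[qproj_fun M x]/(qproj M x) -[qproj_fun M y]/(qproj M y)
  -gmulfM !qmap_funE !gmulfM.
Qed.

HB.instance Definition _ := isUMagmaMorphism.Build (quotient M) (quotient N)
  qmap_fun (qmap1, qmapM).

Definition qmap : ghom (quotient M) (quotient N) := qmap_fun.

Lemma qmapE x : qmap (qproj M x) = qproj N (f x).
Proof. exact: qmap_funE. Qed.

End QuotientMap.
Arguments qmap {G H M N} f MN.

Lemma qmap_comp (G H K : groupType) (M : normal_subgroup G)
    (N : normal_subgroup H) (P : normal_subgroup K)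
    (f : ghom G H) (g : ghom H K) (h : ghom G K) fMN gNP hMP :
  (forall x, h x = g (f x)) -> forall a : quotient M,
  @qmap G K M P h hMP a = @qmap H K N P g gNP (@qmap G H M N f fMN a).
Proof.
move=> hE; elim/qproj_ind=> x; rewrite -[qproj_fun _ x]/(qproj _ x).
by rewrite (qmapE fMN) (qmapE gNP) (qmapE hMP) hE.
Qed.

Lemma qmap_square (G H H' K : groupType) (M : normal_subgroup G)
    (N : normal_subgroup H) (N' : normal_subgroup H') (P : normal_subgroup K)
    (f : ghom G H) (g : ghom H K) (f' : ghom G H') (g' : ghom H' K)
    fMN gNP fMN' gNP' :
  (forall x, g (f x) = g' (f' x)) -> forall a : quotient M,
  @qmap H K N P g gNP (@qmap G H M N f fMN a) =
  @qmap H' K N' P g' gNP' (@qmap G H' M N' f' fMN' a).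
Proof.
move=> hE; elim/qproj_ind=> x; rewrite -[qproj_fun _ x]/(qproj _ x).
by rewrite (qmapE fMN) (qmapE gNP) (qmapE fMN') (qmapE gNP') hE.
Qed.

Lemma qmap_id (G : groupType) (N : normal_subgroup G) (f : ghom G G) fNN :
  (forall x, f x = x) -> forall a : quotient N, @qmap G G N N f fNN a = a.
Proof.
move=> fE; elim/qproj_ind=> x; rewrite -[qproj_fun _ x]/(qproj _ x).
by rewrite (qmapE fNN) fE.
Qed.

Inductive generated (G : groupType) (S : set G) : set G :=
| gen_in x of S x : generated S x
| gen_one : generated S 1
| gen_mul x y of generated S x & generated S y : generated S (x * y)
| gen_inv x of generated S x : generated S x^-1.

(* [lower_central G s] is gamma_(s+1) G. *)
Fixpoint lower_central (G : groupType) (s : nat) : set G :=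
  if s is s'.+1 then
    generated [set z | exists x y, lower_central s' y /\ z = [~ x, y]]
  else setT.
Arguments lower_central : clear implicits.

Lemma lower_central1 G s : lower_central G s 1.
Proof. by case: s => //= s; exact: gen_one. Qed.
Lemma lower_centralM G s x y :
  lower_central G s x -> lower_central G s y -> lower_central G s (x * y).
Proof. by case: s => //= s; exact: gen_mul. Qed.
Lemma lower_centralV G s x : lower_central G s x -> lower_central G s x^-1.
Proof. by case: s => //= s; exact: gen_inv. Qed.

Lemma lower_central_hom (G H : groupType) (f : ghom G H) s :
  lower_central G s `<=` f @^-1` lower_central H s.
Proof.
elim: s => //= s IH x; elim=> {x} [_ [x [y [ys ->]]]| |x y _ fx _ fy|x _ fx] /=.
- by rewrite gmulfR; apply: gen_in; exists (f x), (f y); split=> //; exact: IH.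
- by rewrite gmulf1; exact: gen_one.
- by rewrite gmulfM; exact: gen_mul.
- by rewrite gmulfV; exact: gen_inv.
Qed.

Section Conj.
Variables (G : groupType) (y : G).
Definition conj_fun (x : G) := x ^ y.
Lemma conj_fun1 : conj_fun 1 = 1. Proof. exact: conj1g. Qed.
Lemma conj_funM : {morph conj_fun : a b / a * b}.
Proof. by move=> a b; exact: conjMg. Qed.
HB.instance Definition _ := isUMagmaMorphism.Build G G conj_fun
  (conj_fun1, conj_funM).
End Conj.

Lemma lower_centralJ G s x y :
  lower_central G s x -> lower_central G s (x ^ y).
Proof. exact: (@lower_central_hom G G (@conj_fun G y) s x). Qed.

Definition lcs (G : groupType) (s : nat) : normal_subgroup G :=
  NormalSubgroup (@lower_central1 G s) (@lower_centralM G s)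
    (@lower_centralV G s) (@lower_centralJ G s).

Lemma lcs_le (G : groupType) s : lcs G s.+1 `<=` lcs G s.
Proof.
elim: s => //= s IH x; elim=> {x} [_ [x [y [ys ->]]]| |x y _ fx _ fy|x _ fx].
- apply: gen_in; exists x, y; split=> //; exact: IH.
- exact: gen_one.
- exact: gen_mul.
- exact: gen_inv.
Qed.

Definition nilpotent (G : groupType) : Prop :=
  exists s, forall x, lower_central G s x -> x = 1.

Record gdiagram := GDiagram {
  dob : Type;
  dgrp : dob -> groupType;
  darr : Type;
  dsrc : darr -> dob;
  dtgt : darr -> dob;
  dmap : forall a, ghom (dgrp (dsrc a)) (dgrp (dtgt a))
}.

Arguments dgrp : clear implicits.

Section Limit.
Variable D : gdiagram.

Definition limit := {x : forall i, dgrp D i |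
  forall a : darr D, dmap a (x (dsrc a)) = x (dtgt a)}.

HB.instance Definition _ := gen_eqMixin limit.
HB.instance Definition _ := gen_choiceMixin limit.

Definition lcomp (x : limit) (i : dob D) : dgrp D i := proj1_sig x i.

Lemma lcompP (x : limit) a : dmap a (lcomp x (dsrc a)) = lcomp x (dtgt a).
Proof. exact: (proj2_sig x). Qed.

Lemma limit_ext (x y : limit) : (forall i, lcomp x i = lcomp y i) -> x = y.
Proof.
by case: x y => [x xP] [y yP] xy; apply/eq_exist/functional_extensionality_dep.
Qed.

Program Definition lone : limit := exist _ (fun i => 1) _.
Next Obligation. by move=> a; rewrite gmulf1. Qed.
Program Definition lmul (x y : limit) : limit :=
  exist _ (fun i => lcomp x i * lcomp y i) _.
Next Obligation. by move=> x y a; rewrite gmulfM !lcompP. Qed.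
Program Definition linv (x : limit) : limit := exist _ (fun i => (lcomp x i)^-1) _.
Next Obligation. by move=> x a; rewrite gmulfV lcompP. Qed.

Lemma lmulA : associative lmul.
Proof. by move=> x y z; apply: limit_ext => i; exact: mulgA. Qed.
Lemma lmul1 : left_id lone lmul.
Proof. by move=> x; apply: limit_ext => i; exact: mul1g. Qed.
Lemma l1mul : right_id lone lmul.
Proof. by move=> x; apply: limit_ext => i; exact: mulg1. Qed.
Lemma lmulV : left_inverse lone linv lmul.
Proof. by move=> x; apply: limit_ext => i; exact: mulVg. Qed.
Lemma lVmul : right_inverse lone linv lmul.
Proof. by move=> x; apply: limit_ext => i; exact: mulgV. Qed.

HB.instance Definition _ := isGroup.Build limit lmulA lmul1 l1mul lmulV lVmul.

End Limit.

Definition uniquely_divisible (G : groupType) : Prop :=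
  forall (n : nat) (x : G), (0 < n)%N -> exists! y : G, y ^+ n = x.

(* [malcev N] is the initial object among the homomorphisms from N to uniquely
   divisible nilpotent groups ([malcev_div], [malcev_universal]), and it is
   nilpotent when N is ([malcev_nilpotent]): it is then the Malcev completion
   (rationalization) of N.  Its elements
   are expressions built from N with products, inverses and formal roots, two
   of them being equal when they take the same value in every uniquely
   divisible nilpotent group under N. *)
Inductive root_term (N : Type) : Type :=
| RIn of N
| RMul of root_term N & root_term N
| RInv of root_term N
| RRoot of nat & root_term N. (* RRoot n t is the (n+1)-st root of t *)

HB.instance Definition _ N := gen_eqMixin (root_term N).
HB.instance Definition _ N := gen_choiceMixin (root_term N).

Record valuation (N H : groupType) (v : root_term N -> H) : Prop := Valuation {
  val_in : {morph v \o @RIn N : x y / x * y};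
  val_mul : forall t u, v (RMul t u) = v t * v u;
  val_inv : forall t, v (RInv t) = (v t)^-1;
  val_root : forall n t, v (RRoot n t) ^+ n.+1 = v t
}.

Section Malcev.
Variable N : groupType.

Definition malcev_rel : rel (root_term N) := fun t u =>
  `[< forall H : groupType, uniquely_divisible H -> nilpotent H ->
      forall v : root_term N -> H, valuation v -> v t = v u >].

Lemma malcev_refl : reflexive malcev_rel.
Proof. by move=> t; apply/asboolP. Qed.
Lemma malcev_sym : symmetric malcev_rel.
Proof.
by move=> t u; apply/asboolP/asboolP => tu H dH nH v vP; rewrite (tu H).
Qed.
Lemma malcev_trans : transitive malcev_rel.
Proof.
move=> u t w /asboolP tu /asboolP uw; apply/asboolP => H dH nH v vP.
by rewrite (tu H) // (uw H).
Qed.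

Canonical malcev_equiv :=
  EquivRel malcev_rel malcev_refl malcev_sym malcev_trans.

Definition malcev := {eq_quot malcev_equiv}.
HB.instance Definition _ := Choice.on malcev.
HB.instance Definition _ := EqQuotient.on malcev.

Definition mclass (t : root_term N) : malcev := \pi_malcev t.

Lemma mclassP t u : mclass t = mclass u <->
  forall H : groupType, uniquely_divisible H -> nilpotent H ->
    forall v : root_term N -> H, valuation v -> v t = v u.
Proof.
split=> [|tu]; first by move/eqmodP/asboolP.
by apply/eqmodP/asboolP.
Qed.

Lemma mreprK a : mclass (repr a) = a. Proof. exact: reprK. Qed.

Lemma mclass_ind (P : malcev -> Prop) :
  (forall t, P (mclass t)) -> forall a, P a.
Proof. by move=> Pt a; rewrite -(mreprK a). Qed.

Definition mone := mclass (RIn 1).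
Definition mmul (a b : malcev) := mclass (RMul (repr a) (repr b)).
Definition minv (a : malcev) := mclass (RInv (repr a)).

Lemma mmulE t u : mmul (mclass t) (mclass u) = mclass (RMul t u).
Proof.
apply/mclassP => H dH nH v vP; rewrite !(val_mul vP).
have /mclassP -> // := mreprK (mclass t).
by have /mclassP -> := mreprK (mclass u).
Qed.

Lemma minvE t : minv (mclass t) = mclass (RInv t).
Proof.
apply/mclassP => H dH nH v vP; rewrite !(val_inv vP).
by have /mclassP -> := mreprK (mclass t).
Qed.

Lemma val_one (H : groupType) (v : root_term N -> H) :
  valuation v -> v (RIn 1) = 1.
Proof.
move=> vP; apply: (mulgI (v (RIn 1))).
by rewrite mulg1; have /= <- := val_in vP 1 1; rewrite mulg1.
Qed.

Lemma mmulA : associative mmul.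
Proof.
elim/mclass_ind=> t; elim/mclass_ind=> u; elim/mclass_ind=> w; rewrite !mmulE.
by apply/mclassP => H dH nH v vP; rewrite !(val_mul vP) mulgA.
Qed.
Lemma mmul1 : left_id mone mmul.
Proof.
elim/mclass_ind=> t; rewrite mmulE; apply/mclassP => H dH nH v vP.
by rewrite (val_mul vP) (val_one vP) mul1g.
Qed.
Lemma m1mul : right_id mone mmul.
Proof.
elim/mclass_ind=> t; rewrite mmulE; apply/mclassP => H dH nH v vP.
by rewrite (val_mul vP) (val_one vP) mulg1.
Qed.
Lemma mmulV : left_inverse mone minv mmul.
Proof.
elim/mclass_ind=> t; rewrite minvE mmulE; apply/mclassP => H dH nH v vP.
by rewrite (val_mul vP) (val_inv vP) (val_one vP) mulVg.
Qed.
Lemma mVmul : right_inverse mone minv mmul.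
Proof.
elim/mclass_ind=> t; rewrite minvE mmulE; apply/mclassP => H dH nH v vP.
by rewrite (val_mul vP) (val_inv vP) (val_one vP) mulgV.
Qed.

HB.instance Definition _ := isGroup.Build malcev mmulA mmul1 m1mul mmulV mVmul.

Definition malcev_in_fun (x : N) : malcev := mclass (RIn x).

Lemma malcev_inM : {morph malcev_in_fun : x y / x * y}.
Proof.
move=> x y; rewrite -[RHS]/(mmul _ _) mmulE; apply/mclassP => H dH nH v vP.
by rewrite (val_mul vP); exact: (val_in vP).
Qed.

HB.instance Definition _ := isUMagmaMorphism.Build N malcev malcev_in_fun
  (erefl, malcev_inM).

Definition malcev_in : ghom N malcev := malcev_in_fun.

Lemma mclassX t n (H : groupType) (v : root_term N -> H) :
  uniquely_divisible H -> nilpotent H -> valuation v ->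
  v (repr (mclass t ^+ n)) = v t ^+ n.
Proof.
move=> dH nH vP; elim: n => [|n IH].
  have /mclassP E := mreprK (mclass t ^+ 0).
  by rewrite !expg0 -(val_one vP); exact: (E H dH nH v vP).
have tE : mclass t ^+ n.+1 = mclass (RMul t (repr (mclass t ^+ n))).
  by rewrite expgS -[LHS]/(mmul _ _) -mmulE mreprK.
have /mclassP E : mclass (repr (mclass t ^+ n.+1)) =
    mclass (RMul t (repr (mclass t ^+ n))) by rewrite mreprK.
by rewrite (E H dH nH v vP) (val_mul vP) IH -expgS.
Qed.

Lemma malcev_div : uniquely_divisible malcev.
Proof.
move=> n; elim/mclass_ind=> t; case: n => // n _.
exists (mclass (RRoot n t)); split.
  rewrite -[LHS]mreprK; apply/mclassP => H dH nH v vP.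
  by rewrite mclassX // (val_root vP).
elim/mclass_ind=> u ut; apply/mclassP => H dH nH v vP.
have [y [_ yu]] := dH n.+1 (v t) (ltn0Sn n).
rewrite -(yu (v (RRoot n t))) ?(val_root vP) //; apply: yu.
have /mclassP E : mclass (repr (mclass u ^+ n.+1)) = mclass t.
  by rewrite mreprK.
by rewrite -mclassX // (E H dH nH v vP).
Qed.

Lemma malcev_universal (H : groupType) (f : ghom N H) :
  uniquely_divisible H -> nilpotent H ->
  exists g : ghom malcev H,
    (forall x, g (malcev_in x) = f x) /\
    forall g' : ghom malcev H, (forall x, g' (malcev_in x) = f x) -> g' =1 g.
Proof.
move=> dH nH.
have rootP n x : exists y : H, y ^+ n.+1 = x.
  by have [y [yx _]] := dH n.+1 x (ltn0Sn n); exists y.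
pose root n x := proj1_sig (cid (rootP n x)).
have rootE n x : root n x ^+ n.+1 = x by exact: proj2_sig (cid (rootP n x)).
pose fix v (t : root_term N) : H := match t with
  | RIn x => f x | RMul t u => v t * v u | RInv t => (v t)^-1
  | RRoot n t => root n (v t) end.
have vP : valuation v by split=> //= x y /=; rewrite gmulfM.
pose g0 (a : malcev) : H := v (repr a).
have g0E t : g0 (mclass t) = v t.
  by have /mclassP E := mreprK (mclass t); exact: (E H dH nH v vP).
have g01 : g0 1 = 1 by rewrite g0E /= gmulf1.
have g0M : {morph g0 : a b / a * b}.
  elim/mclass_ind=> t; elim/mclass_ind=> u.
  by rewrite -[_ * _ in LHS]/(mmul _ _) mmulE !g0E.
pose gm := isUMagmaMorphism.Build malcev H g0 (g01, g0M).
pose g : ghom malcev H := HB.pack g0 gm.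
exists g; split=> [x|g' g'E]; first by rewrite /= g0E.
elim/mclass_ind=> t; rewrite [RHS]/= g0E.
elim: t => [x|t IHt u IHu|t IH|n t IH] /=.
- exact: g'E.
- by rewrite -mmulE gmulfM IHt IHu.
- by rewrite -minvE gmulfV IH.
have [y [_ yu]] := dH n.+1 (v t) (ltn0Sn n).
rewrite -(yu (root n (v t))) ?rootE //; symmetry; apply: yu.
rewrite -IH -gmulfXn; congr (g' _).
have [z [zt zu]] := malcev_div (mclass t) (ltn0Sn n).
rewrite -[LHS]mreprK; apply/mclassP => K dK nK w wP.
by rewrite mclassX // (val_root wP).
Qed.

End Malcev.

Section Nilpotency.

Definition root_generated (K : groupType) (A : set K) : Prop :=
  forall S : set K, A `<=` S -> (forall x y, S x -> S y -> S (x * y)) ->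
    (forall x, S x -> S x^-1) -> (forall n x, S (x ^+ n.+1) -> S x) ->
  forall x, S x.

Fixpoint iterated_commutators (K : groupType) (A : set K) (s : nat) : set K :=
  if s is s'.+1 then
    [set z | exists x y, [/\ A x, iterated_commutators A s' y & z = [~ x, y]]]
  else A.

Lemma ud_inj (K : groupType) n : uniquely_divisible K ->
  injective (fun x : K => x ^+ n.+1).
Proof.
move=> dK x y xy; have [z [_ zu]] := dK n.+1 (x ^+ n.+1) (ltn0Sn n).
by rewrite -(zu x) // -(zu y).
Qed.

Lemma root_commute (K : groupType) n (x y : K) : uniquely_divisible K ->
  commute (x ^+ n.+1) y -> commute x y.
Proof.
move=> dK /commgP xy; apply/commgP/conjg_fixP; apply: (ud_inj (n := n) dK).
by rewrite -conjXg; exact/conjg_fixP.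
Qed.

Program Definition center (K : groupType) : normal_subgroup K :=
  @NormalSubgroup K [set x | forall y, commute x y] _ _ _ _.
Next Obligation. by move=> K y; exact/commute_sym/commute1. Qed.
Next Obligation.
by move=> K x y xz yz z; apply/commute_sym/commuteM; exact/commute_sym.
Qed.
Next Obligation. by move=> K x xz z; exact/commute_sym/commuteV/commute_sym. Qed.
Next Obligation.
by move=> K x y xz z; have /commgP/conjg_fixP -> := xz y.
Qed.

Lemma ud_quotient_center (K : groupType) :
  uniquely_divisible K -> uniquely_divisible (quotient (center K)).
Proof.
move=> dK n; elim/qproj_ind=> x; case: n => // n _.
have [y [yx _]] := dK n.+1 x (ltn0Sn n).
exists (qproj (center K) y); split; first by rewrite -gmulfXn yx.
elim/qproj_ind=> z; rewrite -[qproj_fun _ z]/(qproj (center K) z) -gmulfXn.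
move=> /qprojP /= zx.
have [w [wn _]] := dK n.+1 ((z ^+ n.+1)^-1 * x) (ltn0Sn n).
have wc u : commute w u by apply: (root_commute (n := n)) => //; rewrite wn.
have -> : y = z * w.
  apply: (ud_inj (n := n) dK); rewrite /= yx expgMn; last exact/commute_sym.
  by rewrite wn mulgA mulgV mul1g.
apply/qprojP => u; rewrite invgM -mulgA mulVg mulg1.
exact/commute_sym/commuteV/commute_sym/wc.
Qed.

Lemma nilpotent_root_generated s (K : groupType) (A : set K) :
  uniquely_divisible K -> root_generated A ->
  iterated_commutators A s `<=` [set 1] ->
  forall x, lower_central K s x -> x = 1.
Proof.
elim: s K A => [|s IH] K A dK KA A1 x /=.
  move=> _; apply: (KA [set 1]) => //= [y z -> ->|y ->|n y yn].
  - by rewrite mulg1.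
  - by rewrite invg1.
  - by apply: (ud_inj (n := n) dK); rewrite /= yn expg1n.
have Ac c : iterated_commutators A s c -> nsub (center K) c.
  move=> sc y; apply/commute_sym; move: y.
  apply: KA => /= [a Aa|y z yc zc|y yc|n y]; last exact: root_commute.
  - by apply/commgP/eqP; apply: A1; exists a, c.
  - by apply/commute_sym/commuteM; exact/commute_sym.
  - exact/commute_sym/commuteV/commute_sym.
have scK y : lower_central K s y -> nsub (center K) y.
  move=> sy; have /qprojP : qproj (center K) 1 = qproj (center K) y.
    rewrite gmulf1; symmetry.
    apply: (IH _ (qproj (center K) @` A)).
    - exact: ud_quotient_center.
    - move=> S AS SM SV SX; elim/qproj_ind; apply: KA => /=.
      + by move=> a Aa; apply: AS; exists a.
      + by move=> u w Su Sw; rewrite (gmulfM (s := qproj (center K))); exact: SM.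
      + by move=> u Su; rewrite (gmulfV (qproj (center K))); exact: SV.
      + by move=> n u; rewrite (gmulfXn (qproj (center K))); exact: SX.
    - move=> a /= aA.
      suff [c sc ->] : exists2 c, iterated_commutators A s c &
          a = qproj (center K) c.
        rewrite -[RHS](gmulf1 (s := qproj (center K))).
        apply/qprojP => u; rewrite mulg1.
        exact/commute_sym/commuteV/commute_sym/Ac.
      elim: s a {IH A1 Ac sy} aA => [|s IHs] a /=; first by case=> c; exists c.
      case=> _ [b [[u Au <-] /IHs[c sc ->] ->]].
      by exists [~ u, c]; [exists u, c | rewrite gmulfR].
    - exact: (@lower_central_hom _ _ (qproj (center K)) s y).
  by rewrite invg1 mul1g.
elim=> {x} [_ [x [y [/scK yc ->]]]| |x y _ -> _ ->|x _ ->].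
- by apply/eqP/commgP/commute_sym.
- by [].
- by rewrite mulg1.
- by rewrite invg1.
Qed.

End Nilpotency.

Lemma malcev_nilpotent (N : groupType) : nilpotent N -> nilpotent (malcev N).
Proof.
case=> s sN; exists s.
apply: (nilpotent_root_generated (A := range (malcev_in N))).
- exact: malcev_div.
- move=> S NS SM SV SX; elim/mclass_ind; elim=> [x|t St u Su|t St|n t St].
  + by apply: NS; exists x.
  + by rewrite -mmulE; exact: SM.
  + by rewrite -minvE; exact: SV.
  + apply: (SX n).
    suff -> : mclass (RRoot n t) ^+ n.+1 = mclass t by [].
    rewrite -[LHS]mreprK; apply/mclassP => H dH nH v vP.
    by rewrite mclassX // (val_root vP).
- suff H : forall r, iterated_commutators (range (malcev_in N)) r `<=`
                       malcev_in N @` lower_central N r.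
    by move=> a /H[x /sN -> <-]; rewrite /= gmulf1.
  elim=> [|r IH] a /=; first by case=> x _ <-; exists x.
  case=> _ [b [[x _ <-] /IH[y ry <-] ->]].
  by exists [~ x, y]; [apply: gen_in; exists x, y | rewrite gmulfR].
Qed.

Fixpoint root_term_map (N N' : Type) (f : N -> N') (t : root_term N) :
    root_term N' :=
  match t with
  | RIn x => RIn (f x)
  | RMul t u => RMul (root_term_map f t) (root_term_map f u)
  | RInv t => RInv (root_term_map f t)
  | RRoot n t => RRoot n (root_term_map f t)
  end.

Section MalcevMap.
Variables (N N' : groupType) (f : ghom N N').

Definition malcev_map_fun (a : malcev N) : malcev N' :=
  mclass (root_term_map f (repr a)).

Lemma valuation_map (H : groupType) (v : root_term N' -> H) :
  valuation v -> valuation (v \o root_term_map f).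
Proof.
case=> vI vM vV vR; split=> //= x y /=.
by rewrite gmulfM; exact: vI.
Qed.

Lemma malcev_map_funE t :
  malcev_map_fun (mclass t) = mclass (root_term_map f t).
Proof.
apply/mclassP => H dH nH v vP.
have /mclassP tt' := mreprK (mclass t).
exact: (tt' H dH nH _ (valuation_map vP)).
Qed.

Lemma malcev_map1 : malcev_map_fun 1 = 1.
Proof. by rewrite malcev_map_funE /= gmulf1. Qed.

Lemma malcev_mapM : {morph malcev_map_fun : a b / a * b}.
Proof.
elim/mclass_ind=> t; elim/mclass_ind=> u.
by rewrite -[_ * _ in LHS]/(mmul _ _) mmulE !malcev_map_funE
  -[_ * _ in RHS]/(mmul _ _) mmulE.
Qed.

HB.instance Definition _ := isUMagmaMorphism.Build (malcev N) (malcev N')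
  malcev_map_fun (malcev_map1, malcev_mapM).

Definition malcev_map : ghom (malcev N) (malcev N') := malcev_map_fun.

Lemma malcev_mapE t : malcev_map (mclass t) = mclass (root_term_map f t).
Proof. exact: malcev_map_funE. Qed.

End MalcevMap.

Lemma malcev_map_comp (N N' N'' : groupType) (f : ghom N N') (g : ghom N' N'')
    (h : ghom N N'') : (forall x, h x = g (f x)) ->
  forall a, malcev_map h a = malcev_map g (malcev_map f a).
Proof.
move=> hE; elim/mclass_ind=> t.
rewrite (malcev_mapE f) (malcev_mapE g) (malcev_mapE h); congr mclass.
by elim: t => [x|t IHt u IHu|t IH|n t IH] /=; rewrite ?hE ?IHt ?IHu ?IH.
Qed.

Lemma malcev_map_square (N M M' K : groupType) (f : ghom N M) (g : ghom M K)
    (f' : ghom N M') (g' : ghom M' K) : (forall x, g (f x) = g' (f' x)) ->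
  forall a, malcev_map g (malcev_map f a) = malcev_map g' (malcev_map f' a).
Proof.
move=> hE; elim/mclass_ind=> t.
rewrite (malcev_mapE f) (malcev_mapE g) (malcev_mapE f') (malcev_mapE g').
congr mclass.
by elim: t => [x|t IHt u IHu|t IH|n t IH] /=; rewrite ?hE ?IHt ?IHu ?IH.
Qed.

Lemma malcev_map_id (N : groupType) (f : ghom N N) : (forall x, f x = x) ->
  forall a, malcev_map f a = a.
Proof.
move=> fE; elim/mclass_ind=> t; rewrite malcev_mapE; congr mclass.
by elim: t => [x|t IHt u IHu|t IH|n t IH] /=; rewrite ?fE ?IHt ?IHu ?IH.
Qed.

Definition pgroup (p : nat) (G : groupType) : Prop :=
  finite_set [set: G] /\ forall x : G, exists k : nat, x ^+ (p ^ k) = 1.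

Record popen (p : nat) (G : groupType) := POpen {
  popen_nsub :> normal_subgroup G;
  popen_pgroup : pgroup p (quotient popen_nsub)
}.

Definition pro_p_system (p : nat) (G : groupType) : gdiagram :=
  @GDiagram (popen p G) (fun N => quotient N)
    {NM : popen p G * popen p G | nsub NM.1 `<=` nsub NM.2}
    (fun a => (sval a).1) (fun a => (sval a).2)
    (fun a => @qmap G G (sval a).1 (sval a).2 idfun (svalP a)).

Definition pro_p_completion (p : nat) (G : groupType) : groupType :=
  limit (pro_p_system p G).

Definition malcev_system (G : groupType) : gdiagram :=
  @GDiagram nat (fun s => malcev (quotient (lcs G s)))
    nat (fun s => s.+1) (fun s => s)
    (fun s => malcev_map (@qmap G G (lcs G s.+1) (lcs G s) idfun (@lcs_le G s))).

(* lim_s (G / gamma_s G)_0: for G finitely generated, the group of rational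
   points of the rational prounipotent completion of G. *)
Definition malcev_tower_limit (G : groupType) : groupType :=
  limit (malcev_system G).

Section Preimage.
Variables (G H : groupType) (f : ghom G H).

Program Definition preim_nsub (N : normal_subgroup H) : normal_subgroup G :=
  @NormalSubgroup G (f @^-1` N) _ _ _ _.
Next Obligation. by move=> N /=; rewrite gmulf1; exact: nsub1. Qed.
Next Obligation. by move=> N x y /= Nx Ny; rewrite gmulfM; exact: nsubM. Qed.
Next Obligation. by move=> N x /= Nx; rewrite gmulfV; exact: nsubV. Qed.
Next Obligation. by move=> N x y /= Nx; rewrite gmulfJ; exact: nsubJ. Qed.

Definition preim_qmap (N : normal_subgroup H) :
  ghom (quotient (preim_nsub N)) (quotient N) := @qmap G H (preim_nsub N) N f (fun=> id).

Lemma preim_qmapE N x : preim_qmap N (qproj (preim_nsub N) x) = qproj N (f x).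
Proof. exact: qmapE. Qed.

Lemma preim_qmap_inj N : injective (preim_qmap N).
Proof.
elim/qproj_ind=> x; elim/qproj_ind=> y.
rewrite -[qproj_fun _ x]/(qproj _ x) -[qproj_fun _ y]/(qproj _ y).
rewrite !qmapE => /qprojP Nxy; apply/qprojP.
by rewrite /= gmulfM gmulfV.
Qed.

Lemma preim_pgroup p (N : popen p H) : pgroup p (quotient (preim_nsub N)).
Proof.
case: N => N [finN powN]; split.
  have := inj_card_eq (A := [set: quotient (preim_nsub N)])
    (in2W (@preim_qmap_inj N)).
  by move/eq_finite_set <-; exact: sub_finite_set finN.
move=> x; have [k xk] := powN (preim_qmap N x); exists k.
by apply: (@preim_qmap_inj N); rewrite gmulfXn xk gmulf1.
Qed.

Definition preim_popen p (N : popen p H) : popen p G := POpen (preim_pgroup N).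

End Preimage.

Section CompletionMap.
Variables (G H : groupType) (f : ghom G H).

Section ProP.
Variable p : nat.

Program Definition pro_p_map_fun (x : pro_p_completion p G) :
    pro_p_completion p H :=
  exist _ (fun N : popen p H => preim_qmap f N (lcomp x (preim_popen f N))) _.
Next Obligation.
move=> x [[N M] NM] /=.
have NM' : preim_popen f N `<=` preim_popen f M by move=> u /= /NM.
have := lcompP x (exist _ (preim_popen f N, preim_popen f M) NM').
by move=> /= <-; exact: qmap_square.
Qed.

Lemma pro_p_map1 : pro_p_map_fun 1 = 1.
Proof. by apply: limit_ext => N; exact: (gmulf1 (s := preim_qmap f N)). Qed.
Lemma pro_p_mapM : {morph pro_p_map_fun : x y / x * y}.
Proof.
by move=> x y; apply: limit_ext => N; exact: (gmulfM (s := preim_qmap f N)).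
Qed.

HB.instance Definition _ := isUMagmaMorphism.Build
  (pro_p_completion p G) (pro_p_completion p H)
  pro_p_map_fun (pro_p_map1, pro_p_mapM).
Definition pro_p_map : ghom (pro_p_completion p G) (pro_p_completion p H) :=
  pro_p_map_fun.
End ProP.

Definition malcev_tower_map_at s :
    ghom (malcev (quotient (lcs G s))) (malcev (quotient (lcs H s))) :=
  malcev_map
    (@qmap G H (lcs G s) (lcs H s) f (@lower_central_hom G H f s)).

Program Definition malcev_limit_map_fun (x : malcev_tower_limit G) :
    malcev_tower_limit H :=
  exist _ (fun s => malcev_tower_map_at s (lcomp x s)) _.
Next Obligation.
move=> x s; have /= <- := lcompP x (s : darr (malcev_system G)).
by apply: malcev_map_square => u; exact: qmap_square.
Qed.

Lemma malcev_limit_map1 : malcev_limit_map_fun 1 = 1.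
Proof. by apply: limit_ext => s; exact: (gmulf1 (s := malcev_tower_map_at s)). Qed.
Lemma malcev_limit_mapM : {morph malcev_limit_map_fun : x y / x * y}.
Proof.
by move=> x y; apply: limit_ext => s; exact: (gmulfM (s := malcev_tower_map_at s)).
Qed.

HB.instance Definition _ := isUMagmaMorphism.Build
  (malcev_tower_limit G) (malcev_tower_limit H)
  malcev_limit_map_fun (malcev_limit_map1, malcev_limit_mapM).
Definition malcev_limit_map : ghom (malcev_tower_limit G) (malcev_tower_limit H) :=
  malcev_limit_map_fun.

End CompletionMap.

Inductive coefficients : Type :=
| RationalField
| PrimeField (p : nat) of prime p.

Definition completion (R : coefficients) (G : groupType) : groupType :=
  match R with
  | RationalField => malcev_tower_limit G
  | PrimeField p _ => pro_p_completion p G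
  end.

Definition completion_map (R : coefficients) (G H : groupType) (f : ghom G H) :
    ghom (completion R G) (completion R H) :=
  match R with
  | RationalField => malcev_limit_map f
  | PrimeField p _ => pro_p_map f p
  end.

Lemma completion_map_comp R (G H K : groupType)
    (f : ghom G H) (g : ghom H K) (h : ghom G K) :
  (forall x, h x = g (f x)) ->
  forall a, completion_map R h a = completion_map R g (completion_map R f a).
Proof.
move=> hE; case: R => [|p pr] a; apply: limit_ext => i.
  by apply: malcev_map_comp => u; exact: qmap_comp.
have sub : preim_popen h i `<=` preim_popen f (preim_popen g i).
  by move=> u /=; rewrite hE.
pose b := (preim_popen h i, preim_popen f (preim_popen g i)).
have E := lcompP a (exist _ b sub : darr (pro_p_system p G)).
change (preim_qmap h i (lcomp a b.1) =
        preim_qmap g i (preim_qmap f (preim_popen g i) (lcomp a b.2))).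
rewrite -[lcomp a b.2]E; elim/qproj_ind: (lcomp a _) => u.
change (preim_qmap h i (qproj (preim_nsub h i) u) = preim_qmap g i
  (preim_qmap f (preim_nsub g i) (@qmap _ _ b.1 b.2 idfun sub (qproj _ u)))).
rewrite (@qmapE _ _ b.1 b.2 idfun sub) preim_qmapE hE; symmetry.
etransitivity; last exact: preim_qmapE.
exact: (congr1 (preim_qmap g i) (preim_qmapE f (preim_nsub g i) u)).
Qed.

Lemma completion_map_id R (G : groupType) (f : ghom G G) :
  (forall x, f x = x) -> forall a, completion_map R f a = a.
Proof.
move=> fE; case: R => [|p pr] a; apply: limit_ext => i.
  by apply: malcev_map_id => u; exact: qmap_id.
have sub : preim_popen f i `<=` i by move=> u /=; rewrite fE.
pose b := (preim_popen f i, i).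
have E := lcompP a (exist _ b sub : darr (pro_p_system p G)).
change (preim_qmap f i (lcomp a b.1) = lcomp a b.2).
rewrite -[lcomp a b.2]E; elim/qproj_ind: (lcomp a _) => u.
change (preim_qmap f i (qproj (preim_nsub f i) u) =
  @qmap _ _ b.1 b.2 idfun sub (qproj _ u)).
by rewrite (@qmapE _ _ b.1 b.2 idfun sub) preim_qmapE fE.
Qed.

(* In degree n, [face n i] and [degen n i] are the operators d_i : X_(n+1) ->
   X_n (i <= n+1) and s_i : X_n -> X_(n+1) (i <= n); their values for larger i
   carry no meaning and are never constrained. *)
Record sset := SSet {
  simp : nat -> Type;
  face : forall n, nat -> simp n.+1 -> simp n;
  degen : forall n, nat -> simp n -> simp n.+1;
  face_face : forall n i j (x : simp n.+2), (i < j <= n.+2)%N ->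
    face i (face j x) = face j.-1 (face i x);
  face_degen_lt : forall n i j (x : simp n.+1), (i < j <= n.+1)%N ->
    face i (degen j x) = degen j.-1 (face i x);
  face_degen_eq : forall n i (x : simp n), (i <= n)%N ->
    face i (degen i x) = x;
  face_degen_eqS : forall n i (x : simp n), (i <= n)%N ->
    face i.+1 (degen i x) = x;
  face_degen_gt : forall n i j (x : simp n.+1), (j.+1 < i <= n.+2)%N ->
    face i (degen j x) = degen j (face i.-1 x);
  degen_degen : forall n i j (x : simp n), (i <= j <= n)%N ->
    degen i (degen j x) = degen j.+1 (degen i x)
}.
Arguments simp : clear implicits.
Arguments face : clear implicits.
Arguments degen : clear implicits.

Record smap (X Y : sset) := SMap {
  smapf :> forall n, simp X n -> simp Y n;
  smap_face : forall n i (x : simp X n.+1), (i <= n.+1)%N ->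
    smapf (face X n i x) = face Y n i (smapf x);
  smap_degen : forall n i (x : simp X n), (i <= n)%N ->
    smapf (degen X n i x) = degen Y n i (smapf x)
}.
Arguments smapf {X Y} s n x.

Definition sid (X : sset) : smap X X :=
  @SMap X X (fun n => id) (fun _ _ _ _ => erefl) (fun _ _ _ _ => erefl).

Program Definition scomp (X Y Z : sset) (g : smap Y Z) (f : smap X Y) : smap X Z :=
  @SMap X Z (fun n x => g n (f n x)) _ _.
Next Obligation. by move=> X Y Z g f n i x ni /=; rewrite !smap_face. Qed.
Next Obligation. by move=> X Y Z g f n i x ni /=; rewrite !smap_degen. Qed.

Program Definition sprod (X Y : sset) : sset :=
  @SSet (fun n => (simp X n * simp Y n)%type)
    (fun n i x => (face X n i x.1, face Y n i x.2))
    (fun n i x => (degen X n i x.1, degen Y n i x.2)) _ _ _ _ _ _.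
Next Obligation. by move=> X Y n i j x ij /=; rewrite !(face_face _ ij). Qed.
Next Obligation. by move=> X Y n i j x ij /=; rewrite !(face_degen_lt _ ij). Qed.
Next Obligation. by move=> X Y n i [x y] ij /=; rewrite !(face_degen_eq _ ij). Qed.
Next Obligation. by move=> X Y n i [x y] ij /=; rewrite !(face_degen_eqS _ ij). Qed.
Next Obligation. by move=> X Y n i j x ij /=; rewrite !(face_degen_gt _ ij). Qed.
Next Obligation. by move=> X Y n i j x ij /=; rewrite !(degen_degen _ ij). Qed.

(* A monotone map [n] -> [1] is determined by the number c <= n+1 of vertices
   it sends to 0; precomposing it with the i-th coface, resp. the i-th
   codegeneracy, changes c into [cut_face i c], resp. [cut_degen i c]. *)
Definition cut_face (i c : nat) : nat := if (i < c)%N then c.-1 else c.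
Definition cut_degen (i c : nat) : nat := if (i < c)%N then c.+1 else c.

Section Cuts.
Local Open Scope nat_scope.
Ltac cuts := rewrite /cut_face /cut_degen;
  repeat match goal with |- context [if (?a < ?b)%N then _ else _] =>
    lazymatch b with context [if _ then _ else _] => fail | _ =>
    case: (ltnP a b) => ? end end; try lia.
Lemma cut_face_face i j c : i < j ->
  cut_face i (cut_face j c) = cut_face j.-1 (cut_face i c).
Proof. cuts. Qed.
Lemma cut_face_degen_lt i j c : i < j ->
  cut_face i (cut_degen j c) = cut_degen j.-1 (cut_face i c).
Proof. cuts. Qed.
Lemma cut_face_degen_eq i c : cut_face i (cut_degen i c) = c.
Proof. cuts. Qed.
Lemma cut_face_degen_eqS i c : cut_face i.+1 (cut_degen i c) = c.
Proof. cuts. Qed.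
Lemma cut_face_degen_gt i j c : j.+1 < i ->
  cut_face i (cut_degen j c) = cut_degen j (cut_face i.-1 c).
Proof. cuts. Qed.
Lemma cut_degen_degen i j c : i <= j ->
  cut_degen i (cut_degen j c) = cut_degen j.+1 (cut_degen i c).
Proof. cuts. Qed.
Lemma cut_face_le n i c : c <= n.+2 -> i <= n.+1 -> cut_face i c <= n.+1.
Proof. rewrite /cut_face; case: (ltnP i c); lia. Qed.
Lemma cut_degen_le n i c : c <= n.+1 -> cut_degen i c <= n.+2.
Proof. rewrite /cut_degen; case: (ltnP i c);lia. Qed.
End Cuts.

Program Definition delta1 : sset :=
  @SSet (fun n => 'I_n.+2)
    (fun n i c => inord (cut_face i c)) (fun n i c => inord (cut_degen i c))
    _ _ _ _ _ _.
Next Obligation.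
move=> n i j c ij /=; apply: val_inj; have := ltn_ord c; rewrite ltnS => cn.
have a1 : (cut_face j c <= n.+2)%N by apply: cut_face_le => //; lia.
have a2 : (cut_face i c <= n.+2)%N by apply: cut_face_le => //; lia.
have e : cut_face i (cut_face j c) = cut_face j.-1 (cut_face i c).
  by apply: cut_face_face; lia.
by rewrite /= (@inordK n.+2 (cut_face j c)) ?(@inordK n.+2 (cut_face i c)) ?e.
Qed.
Next Obligation.
move=> n i j c ij /=; apply: val_inj; have := ltn_ord c; rewrite ltnS => cn.
have a1 := cut_degen_le j cn.
have a2 : (cut_face i c <= n.+1)%N by apply: cut_face_le => //; lia.
have e : cut_face i (cut_degen j c) = cut_degen j.-1 (cut_face i c).
  by apply: cut_face_degen_lt; lia.
by rewrite /= (@inordK n.+3 (cut_degen j c)) ?(@inordK n.+1 (cut_face i c)) ?e.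
Qed.
Next Obligation.
move=> n i c ni /=; apply: val_inj; have := ltn_ord c; rewrite ltnS => cn.
have a1 := cut_degen_le i cn.
by rewrite /= (@inordK n.+2 (cut_degen i c)) // cut_face_degen_eq inordK.
Qed.
Next Obligation.
move=> n i c ni /=; apply: val_inj; have := ltn_ord c; rewrite ltnS => cn.
have a1 := cut_degen_le i cn.
by rewrite /= (@inordK n.+2 (cut_degen i c)) // cut_face_degen_eqS inordK.
Qed.
Next Obligation.
move=> n i j c ij /=; apply: val_inj; have := ltn_ord c; rewrite ltnS => cn.
have a1 := cut_degen_le j cn.
have a2 : (cut_face i.-1 c <= n.+1)%N by apply: cut_face_le => //; lia.
have e : cut_face i (cut_degen j c) = cut_degen j (cut_face i.-1 c).
  by apply: cut_face_degen_gt; lia.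
by rewrite /= (@inordK n.+3 (cut_degen j c)) ?(@inordK n.+1 (cut_face i.-1 c)) ?e.
Qed.
Next Obligation.
move=> n i j c ij /=; apply: val_inj; have := ltn_ord c; rewrite ltnS => cn.
have a1 := cut_degen_le j cn; have a2 := cut_degen_le i cn.
have e : cut_degen i (cut_degen j c) = cut_degen j.+1 (cut_degen i c).
  by apply: cut_degen_degen; lia.
by rewrite /= (@inordK n.+2 (cut_degen j c)) ?(@inordK n.+2 (cut_degen i c)) ?e.
Qed.

(* The restriction of h to X x {0} is f and its restriction to X x {1} is g. *)
Definition simplicial_homotopy (X Y : sset) (f g : smap X Y)
    (h : smap (sprod X delta1) Y) : Prop :=
  forall n (x : simp X n), h n (x, ord_max) = f n x /\ h n (x, ord0) = g n x.

(* The equivalence relation generated by simplicial homotopies; when Y is a Kan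
   complex it coincides with the existence of a simplicial homotopy. *)
Inductive homotopic (X Y : sset) : smap X Y -> smap X Y -> Prop :=
| homotopic_step f g h of simplicial_homotopy f g h : homotopic f g
| homotopic_refl f : homotopic f f
| homotopic_sym f g of homotopic f g : homotopic g f
| homotopic_trans f g k of homotopic f g & homotopic g k : homotopic f k.

Definition homotopy_equivalent (X Y : sset) : Prop :=
  exists (f : smap X Y) (g : smap Y X),
    homotopic (scomp g f) (sid X) /\ homotopic (scomp f g) (sid Y).

Fixpoint base (X : sset) (x0 : simp X 0) (n : nat) : simp X n :=
  if n is n'.+1 then degen X n' 0 (base x0 n') else x0.

Definition is_sphere (X : sset) (x0 : simp X 0) n (x : simp X n.+1) : Prop :=
  forall i, (i <= n.+1)%N -> face X n i x = base x0 n.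

Definition sphere_homotopic (X : sset) (x0 : simp X 0) n
    (x y : simp X n.+1) : Prop :=
  exists z : simp X n.+2,
    [/\ face X n.+1 n.+2 z = y, face X n.+1 n.+1 z = x &
        forall i, (i <= n)%N -> face X n.+1 i z = base x0 n.+1].

Definition pi_trivial (X : sset) (x0 : simp X 0) (n : nat) : Prop :=
  match n with
  | 0 => forall x : simp X 0,
      exists z : simp X 1, face X 0 0 z = x /\ face X 0 1 z = x0
  | n'.+1 => forall x : simp X n'.+1,
      is_sphere x0 x -> sphere_homotopic x0 x (base x0 n'.+1)
  end.

(* pi_1(X, x0) is isomorphic to F: the map phi from loops to F identifies
   exactly the homotopic loops, is onto, and turns the product of pi_1 (the
   class of d_1 z is the product of those of d_2 z and d_0 z, for every
   2-simplex z whose faces are loops) into the product of F. *)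
Definition pi1_isomorphic (X : sset) (x0 : simp X 0) (F : groupType) : Prop :=
  exists phi : simp X 1 -> F,
    [/\ forall x y, is_sphere x0 x -> is_sphere x0 y ->
          (phi x = phi y <-> sphere_homotopic x0 x y),
        forall a : F, exists x, is_sphere x0 x /\ phi x = a &
        forall z : simp X 2,
          (forall i, (i <= 2)%N -> is_sphere x0 (face X 1 i z)) ->
          phi (face X 1 1 z) = phi (face X 1 2 z) * phi (face X 1 0 z)].

Record sgroup := SGroup {
  sg : nat -> groupType;
  gface : forall n, nat -> ghom (sg n.+1) (sg n);
  gdegen : forall n, nat -> ghom (sg n) (sg n.+1);
  gface_face : forall n i j (x : sg n.+2), (i < j <= n.+2)%N ->
    gface n i (gface n.+1 j x) = gface n j.-1 (gface n.+1 i x);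
  gface_degen_lt : forall n i j (x : sg n.+1), (i < j <= n.+1)%N ->
    gface n.+1 i (gdegen n.+1 j x) = gdegen n j.-1 (gface n i x);
  gface_degen_eq : forall n i (x : sg n), (i <= n)%N ->
    gface n i (gdegen n i x) = x;
  gface_degen_eqS : forall n i (x : sg n), (i <= n)%N ->
    gface n i.+1 (gdegen n i x) = x;
  gface_degen_gt : forall n i j (x : sg n.+1), (j.+1 < i <= n.+2)%N ->
    gface n.+1 i (gdegen n.+1 j x) = gdegen n j (gface n i.-1 x);
  gdegen_degen : forall n i j (x : sg n), (i <= j <= n)%N ->
    gdegen n.+1 i (gdegen n j x) = gdegen n.+1 j.+1 (gdegen n i x)
}.
Arguments sg : clear implicits.
Arguments gface : clear implicits.
Arguments gdegen : clear implicits.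

Definition const_sgroup (F : groupType) : sgroup :=
  @SGroup (fun=> F) (fun _ _ => idfun) (fun _ _ => idfun)
    (fun _ _ _ _ _ => erefl) (fun _ _ _ _ _ => erefl) (fun _ _ _ _ => erefl)
    (fun _ _ _ _ => erefl) (fun _ _ _ _ _ => erefl) (fun _ _ _ _ _ => erefl).

Program Definition sgroup_completion (R : coefficients) (G : sgroup) : sgroup :=
  @SGroup (fun n => completion R (sg G n))
    (fun n i => completion_map R (gface G n i))
    (fun n i => completion_map R (gdegen G n i)) _ _ _ _ _ _.
Next Obligation.
move=> R G n i j x ij /=.
pose h : ghom _ _ := gface G n i \o gface G n.+1 j.
rewrite -(@completion_map_comp _ _ _ _ _ _ h) //.
by apply: completion_map_comp => y; exact: gface_face.
Qed.
Next Obligation.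
move=> R G n i j x ij /=.
pose h : ghom _ _ := gface G n.+1 i \o gdegen G n.+1 j.
rewrite -(@completion_map_comp _ _ _ _ _ _ h) //.
by apply: completion_map_comp => y; exact: gface_degen_lt.
Qed.
Next Obligation.
move=> R G n i x ij /=.
pose h : ghom _ _ := gface G n i \o gdegen G n i.
rewrite -(@completion_map_comp _ _ _ _ _ _ h) //.
by apply: completion_map_id => y; exact: gface_degen_eq.
Qed.
Next Obligation.
move=> R G n i x ij /=.
pose h : ghom _ _ := gface G n i.+1 \o gdegen G n i.
rewrite -(@completion_map_comp _ _ _ _ _ _ h) //.
by apply: completion_map_id => y; exact: gface_degen_eqS.
Qed.
Next Obligation.
move=> R G n i j x ij /=.
pose h : ghom _ _ := gface G n.+1 i \o gdegen G n.+1 j.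
rewrite -(@completion_map_comp _ _ _ _ _ _ h) //.
by apply: completion_map_comp => y; exact: gface_degen_gt.
Qed.
Next Obligation.
move=> R G n i j x ij /=.
pose h : ghom _ _ := gdegen G n.+1 i \o gdegen G n j.
rewrite -(@completion_map_comp _ _ _ _ _ _ h) //.
by apply: completion_map_comp => y; exact: gdegen_degen.
Qed.

Section Wbar.
Variable G : sgroup.

(* An n-simplex (g_(n-1), ..., g_0), with g_k in G_k, is encoded as nested
   pairs (g_(n-1), (..., (g_0, tt))); the operators are
   d_0 (g_(n-1), ...) = (g_(n-2), ...),
   d_1 (g_(n-1), ...) = (d_0 g_(n-1) * g_(n-2), g_(n-3), ...),
   d_(i+1) (g_(n-1), w) = (d_i g_(n-1), d_i w) for i > 0,
   s_0 w = (1, w),  s_(i+1) (g_(n-1), w) = (s_i g_(n-1), s_i w). *)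
Fixpoint wsimp (n : nat) : Type :=
  if n is n'.+1 then (sg G n' * wsimp n')%type else unit.

Fixpoint wface (n i : nat) : wsimp n.+1 -> wsimp n :=
  match n with
  | 0 => fun _ => tt
  | n'.+1 => fun x => match i with
    | 0 => x.2
    | 1 => (gface G n' 0 x.1 * x.2.1, x.2.2)
    | j.+1 => (gface G n' j x.1, wface j x.2)
    end
  end.

Fixpoint wdegen (n i : nat) : wsimp n -> wsimp n.+1 :=
  match i, n with
  | 0, _ => fun x => (1, x)
  | j.+1, 0 => fun x => (1, x)
  | j.+1, n'.+1 => fun x => (gdegen G n' j x.1, wdegen j x.2)
  end.

Arguments wface : simpl never.
Arguments wdegen : simpl never.

Lemma wface0 n (x : wsimp n.+2) : wface 0 x = x.2.
Proof. by []. Qed.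
Lemma wface1 n (x : wsimp n.+2) :
  wface 1 x = (gface G n 0 x.1 * x.2.1, x.2.2).
Proof. by []. Qed.
Lemma wfaceS n i (x : wsimp n.+2) :
  wface i.+2 x = (gface G n i.+1 x.1, wface i.+1 x.2).
Proof. by []. Qed.
Lemma wdegen0 n (x : wsimp n) : wdegen 0 x = (1, x).
Proof. by case: n x. Qed.
Lemma wdegenS n i (x : wsimp n.+1) :
  wdegen i.+1 x = (gdegen G n i x.1, wdegen i x.2).
Proof. by []. Qed.

Lemma wface_face n i j (x : wsimp n.+2) : (i < j <= n.+2)%N ->
  wface i (wface j x) = wface j.-1 (wface i x).
Proof.
elim: n i j x => [|n IH] [|[|i]] [|[|[|j]]] x //= ij.
- by rewrite (wfaceS 0) !wface1 /= gmulfM mulgA -(@gface_face G _ 0 1).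
- by rewrite !wfaceS !wface1 /= (@gface_face G _ 0 j.+2) // -gmulfM.
- rewrite !wfaceS /= (@gface_face G _ i.+1 j.+2) //.
  by congr (_, _); exact: (IH i.+1 j.+2).
Qed.

Lemma wface_degen_lt n i j (x : wsimp n.+1) : (i < j <= n.+1)%N ->
  wface i (wdegen j x) = wdegen j.-1 (wface i x).
Proof.
elim: n i j x => [|n IH] [|[|i]] [|[|j]] x //= ij.
- by case: x => g []; rewrite wdegenS !wdegen0.
- lia.
- by rewrite !wdegenS !wface1 /= (@gface_degen_lt G _ 0 j.+1) // -gmulfM.
- rewrite !wdegenS !wfaceS /= (@gface_degen_lt G _ i.+1 j.+1) //.
  by congr (_, _); exact: (IH i.+1 j.+1).
Qed.

Lemma wface_degen_eq n i (x : wsimp n) : (i <= n)%N -> wface i (wdegen i x) = x.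
Proof.
elim: n i x => [|n IH] [|[|i]] //= x ij.
- by case: x.
- case: x => g w.
  by rewrite wdegenS wdegen0 wface1 /= (@gface_degen_eq G _ 0) // mulg1.
- case: x => g w; rewrite wdegenS wfaceS /= (@gface_degen_eq G _ i.+1) //.
  by congr (_, _); exact: (IH i.+1).
Qed.

Lemma wface_degen_eqS n i (x : wsimp n) : (i <= n)%N ->
  wface i.+1 (wdegen i x) = x.
Proof.
elim: n i x => [|n IH] [|[|i]] //= x ij.
- by case: x.
- by case: x => g w; rewrite wdegen0 wface1 /= gmulf1 mul1g.
- case: x => g w; rewrite wdegenS wfaceS /= (@gface_degen_eqS G _ 0) //.
  by congr (_, _); exact: (IH 0).
- case: x => g w; rewrite wdegenS wfaceS /= (@gface_degen_eqS G _ i.+1) //.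
  by congr (_, _); exact: (IH i.+1).
Qed.

Lemma wface_degen_gt n i j (x : wsimp n.+1) : (j.+1 < i <= n.+2)%N ->
  wface i (wdegen j x) = wdegen j (wface i.-1 x).
Proof.
elim: n i j x => [|n IH] [|[|[|i]]] [|[|j]] //= x ij.
- by rewrite !wdegen0 wfaceS /= gmulf1.
- lia.
- by rewrite !wdegen0 wfaceS /= gmulf1.
- by rewrite !wdegen0 wfaceS /= gmulf1.
- rewrite !wdegenS !wfaceS /= (@gface_degen_gt G _ i.+2 0) //.
  by congr (_, _); exact: (IH i.+2 0).
- rewrite !wdegenS !wfaceS /= (@gface_degen_gt G _ i.+2 j.+1) //.
  by congr (_, _); exact: (IH i.+2 j.+1).
Qed.

Lemma wdegen_degen n i j (x : wsimp n) : (i <= j <= n)%N ->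
  wdegen i (wdegen j x) = wdegen j.+1 (wdegen i x).
Proof.
elim: n i j x => [|n IH] [|i] [|j] //= x ij.
- by rewrite wdegenS !wdegen0 /= gmulf1.
- lia.
- by rewrite wdegenS !wdegen0 /= gmulf1.
- by rewrite wdegenS !wdegen0 wdegenS /= gmulf1.
- by rewrite !wdegenS /= (@gdegen_degen G _ i j) // IH.
Qed.

Definition Wbar : sset :=
  SSet wface_face wface_degen_lt wface_degen_eq wface_degen_eqS
    wface_degen_gt wdegen_degen.

Definition wbase : simp Wbar 0 := tt.

End Wbar.

Arguments wbase {G}.

Section FreeSimplicialGroup.
Variables (X Y : choiceType) (r : Y -> freegroup X).

(* The free basis in degree n: the degeneracies of the x in X (one for each x)
   and those of the y in Y, the generator [inr (y, k)] being the degeneracy of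
   y along the surjection [n] -> [1] that sends exactly the vertices 0, ..., k
   to 0. *)
Definition pbasis (n : nat) : choiceType := (X + Y * 'I_n)%type.

Definition pX (n : nat) : ghom (freegroup X) (freegroup (pbasis n)) :=
  free_map (inl : X -> pbasis n).

(* The value of the simplex y along the map [n] -> [1] sending the first c
   vertices to 0: a generator if this map is onto, otherwise a degeneracy of
   d_0 y = 1 or of d_1 y = r y. *)
Definition pY (n : nat) (y : Y) (c : nat) : freegroup (pbasis n) :=
  if c is k.+1 then
    if insub k is Some k' then free_gen (inr (y, k') : pbasis n) else pX n (r y)
  else 1.

Definition pface (n i : nat) : ghom (freegroup (pbasis n.+1)) (freegroup (pbasis n)) :=
  free_lift (fun b : pbasis n.+1 => match b with
    | inl x => pX n (free_gen x)
    | inr (y, k) => pY n y (cut_face i k.+1)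
    end).

Definition pdegen (n i : nat) : ghom (freegroup (pbasis n)) (freegroup (pbasis n.+1)) :=
  free_lift (fun b : pbasis n => match b with
    | inl x => pX n.+1 (free_gen x)
    | inr (y, k) => pY n.+1 y (cut_degen i k.+1)
    end).

Lemma pface_X n i a : pface n i (pX n.+1 a) = pX n a.
Proof.
apply: (free_ext (f := pface n i \o pX n.+1)) => x /=.
by rewrite free_liftE free_liftE.
Qed.

Lemma pdegen_X n i a : pdegen n i (pX n a) = pX n.+1 a.
Proof.
apply: (free_ext (f := pdegen n i \o pX n)) => x /=.
by rewrite free_liftE free_liftE.
Qed.

Lemma pY_gen n y (k : 'I_n) : pY n y k.+1 = free_gen (inr (y, k) : pbasis n).
Proof. by rewrite /pY valK. Qed.

Lemma pY_top n y c : (n < c)%N -> pY n y c = pX n (r y).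
Proof. by case: c => // c; rewrite ltnS => nc; rewrite /pY insubN // -leqNgt. Qed.

Lemma pface_Y n i y c : (i <= n.+1)%N -> (c <= n.+2)%N ->
  pface n i (pY n.+1 y c) = pY n y (cut_face i c).
Proof.
case: c => [|c] ni nc; first by rewrite gmulf1.
have [cn|cn] := ltnP c n.+1.
  by rewrite -[c.+1]/(Ordinal cn).+1 pY_gen free_liftE.
rewrite pY_top // pface_X pY_top // /cut_face; case: ifP => /=; lia.
Qed.

Lemma pdegen_Y n i y c : (i <= n)%N -> (c <= n.+1)%N ->
  pdegen n i (pY n y c) = pY n.+1 y (cut_degen i c).
Proof.
case: c => [|c] ni nc; first by rewrite gmulf1.
have [cn|cn] := ltnP c n.
  by rewrite -[c.+1]/(Ordinal cn).+1 pY_gen free_liftE.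
rewrite pY_top // pdegen_X pY_top // /cut_degen; case: ifP => /=; lia.
Qed.

Lemma pbasis_ext n (G : groupType) (f g : ghom (freegroup (pbasis n)) G) :
  (forall x, f (pX n (free_gen x)) = g (pX n (free_gen x))) ->
  (forall y c, (c <= n)%N -> f (pY n y c) = g (pY n y c)) -> f =1 g.
Proof.
move=> fX fY; apply: free_ext => -[x|[y k]].
  by have := fX x; rewrite free_liftE.
by rewrite -pY_gen; apply: fY.
Qed.

Lemma pface_face n i j a : (i < j <= n.+2)%N ->
  pface n i (pface n.+1 j a) = pface n j.-1 (pface n.+1 i a).
Proof.
move=> ij; apply: (pbasis_ext (f := pface n i \o pface n.+1 j)
  (g := pface n j.-1 \o pface n.+1 i)) => [x|y c cn] /=.
  by rewrite !pface_X.
have h1 : (cut_face j c <= n.+2)%N by apply: cut_face_le; lia.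
have h2 : (cut_face i c <= n.+2)%N by apply: cut_face_le; lia.
rewrite (pface_Y y (c := c)) // ?(pface_Y y (c := c)) //; try lia.
rewrite !pface_Y //; try lia.
by rewrite (@cut_face_face i j) //; lia.
Qed.

Lemma pface_degen_lt n i j a : (i < j <= n.+1)%N ->
  pface n.+1 i (pdegen n.+1 j a) = pdegen n j.-1 (pface n i a).
Proof.
move=> ij; apply: (pbasis_ext (f := pface n.+1 i \o pdegen n.+1 j)
  (g := pdegen n j.-1 \o pface n i)) => [x|y c cn] /=.
  by rewrite !(pface_X, pdegen_X).
have h1 : (cut_degen j c <= n.+3)%N by apply: cut_degen_le; lia.
have h2 : (cut_face i c <= n.+1)%N by apply: cut_face_le; lia.
have e : cut_face i (cut_degen j c) = cut_degen j.-1 (cut_face i c).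
  by apply: cut_face_degen_lt; lia.
by rewrite (pdegen_Y y) ?(pface_Y y) ?(pdegen_Y y) ?e //; lia.
Qed.

Lemma pface_degen_eq n i a : (i <= n)%N -> pface n i (pdegen n i a) = a.
Proof.
move=> ni; apply: (pbasis_ext (f := pface n i \o pdegen n i)
  (g := idfun)) => [x|y c cn] /=.
  by rewrite !(pface_X, pdegen_X).
have h1 : (cut_degen i c <= n.+2)%N by apply: cut_degen_le; lia.
by rewrite pdegen_Y ?pface_Y // ?cut_face_degen_eq //; lia.
Qed.

Lemma pface_degen_eqS n i a : (i <= n)%N -> pface n i.+1 (pdegen n i a) = a.
Proof.
move=> ni; apply: (pbasis_ext (f := pface n i.+1 \o pdegen n i)
  (g := idfun)) => [x|y c cn] /=.
  by rewrite !(pface_X, pdegen_X).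
have h1 : (cut_degen i c <= n.+2)%N by apply: cut_degen_le; lia.
by rewrite pdegen_Y ?pface_Y // ?cut_face_degen_eqS //; lia.
Qed.

Lemma pface_degen_gt n i j a : (j.+1 < i <= n.+2)%N ->
  pface n.+1 i (pdegen n.+1 j a) = pdegen n j (pface n i.-1 a).
Proof.
move=> ij; apply: (pbasis_ext (f := pface n.+1 i \o pdegen n.+1 j)
  (g := pdegen n j \o pface n i.-1)) => [x|y c cn] /=.
  by rewrite !(pface_X, pdegen_X).
have h1 : (cut_degen j c <= n.+3)%N by apply: cut_degen_le; lia.
have h2 : (cut_face i.-1 c <= n.+1)%N by apply: cut_face_le; lia.
have e : cut_face i (cut_degen j c) = cut_degen j (cut_face i.-1 c).
  by apply: cut_face_degen_gt; lia.
by rewrite (pdegen_Y y) ?(pface_Y y) ?(pdegen_Y y) ?e //; lia.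
Qed.

Lemma pdegen_degen n i j a : (i <= j <= n)%N ->
  pdegen n.+1 i (pdegen n j a) = pdegen n.+1 j.+1 (pdegen n i a).
Proof.
move=> ij; apply: (pbasis_ext (f := pdegen n.+1 i \o pdegen n j)
  (g := pdegen n.+1 j.+1 \o pdegen n i)) => [x|y c cn] /=.
  by rewrite !pdegen_X.
have h1 : (cut_degen j c <= n.+2)%N by apply: cut_degen_le; lia.
have h2 : (cut_degen i c <= n.+2)%N by apply: cut_degen_le; lia.
have e : cut_degen i (cut_degen j c) = cut_degen j.+1 (cut_degen i c).
  by apply: cut_degen_degen; lia.
by rewrite !(pdegen_Y y) ?e //; lia.
Qed.

Definition free_sgroup : sgroup :=
  SGroup pface_face pface_degen_lt pface_degen_eq pface_degen_eqS
    pface_degen_gt pdegen_degen.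

Lemma free_sgroup_d0 (y : Y) :
  gface free_sgroup 0 0 (free_gen (inr (y, ord0) : pbasis 1)) = 1.
Proof. exact: free_liftE. Qed.

Lemma free_sgroup_d1 (y : Y) :
  gface free_sgroup 0 1 (free_gen (inr (y, ord0) : pbasis 1)) = pX 0 (r y).
Proof. by rewrite -(@pY_top 0 y 1) //; exact: free_liftE. Qed.

End FreeSimplicialGroup.

(* The Bousfield-Kan completion of the classifying space of a degreewise
   finitely generated free simplicial group, in its model by the classifying
   space of the degreewise R-completion. *)
Definition Rinfty_Wbar (R : coefficients) (G : sgroup) : sset :=
  Wbar (sgroup_completion R G).

(* K(F, 1), as the classifying space of the discrete group F. *)
Definition K1 (F : groupType) : sset := Wbar (const_sgroup F).

(* The rational points of the free prounipotent group on Z, resp. the free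
   pro-p group on Z, as an abstract group (for finite Z). *)
Definition F_ (R : coefficients) (Z : finType) : groupType :=
  completion R (freegroup Z).

Section PresentationComplex.
Variables (R : realType) (X Y : choiceType).
Local Open Scope ring_scope.

Definition open_unit := {t : R | 0 < t < 1}.

(* The points of K(X | Y), sorted according to the open cell they lie in; the
   2-cells are parametrized by the square [0, 1] x [0, 1]. *)
Inductive pres_point : Type :=
| Cell0
| Cell1 of X & open_unit
| Cell2 of Y & open_unit & open_unit.

(* The attaching maps r only enter the topology. *)
Definition pres_complex (r : Y -> freegroup X) : Type := pres_point.

Variable r : Y -> freegroup X.

HB.instance Definition _ := gen_eqMixin (pres_complex r).
HB.instance Definition _ := gen_choiceMixin (pres_complex r).

(* The characteristic map of the 1-cell x: it sends t in ]0, 1[ to the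
   corresponding point of the open cell, and 0 and 1 to the 0-cell.  It is
   extended to all of R through the retraction of R onto [0, 1]. *)
Definition edge (x : X) (t : R) : pres_point :=
  if insub t is Some t' then Cell1 x t' else Cell0.

(* The path travelling along the successive letters of a word, at the speed of
   one letter per unit of time. *)
Fixpoint walk (w : seq (X * bool)) (t : R) : pres_point :=
  match w with
  | [::] => Cell0
  | (x, b) :: w' =>
      if t <= 1 then edge x (if b then t else 1 - t) else walk w' (t - 1)
  end.

(* The characteristic map of the 2-cell y: the side v = 0 of the square follows
   the loop r y and the three other sides are sent to the 0-cell.  It is
   extended to all of R x R through the retraction onto [0, 1] x [0, 1]. *)
Definition disc (y : Y) (p : R * R) : pres_point :=
  if p.2 <= 0 then walk (val (r y)) ((size (val (r y)))%:R * p.1)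
  else match insub p.1, insub p.2 with
       | Some u, Some v => Cell2 y u v
       | _, _ => Cell0
       end.

(* The weak topology determined by the characteristic maps.  As the latter
   factor through the retractions, the preimage of U is open in R (resp. R x R)
   if and only if its trace on [0, 1] (resp. [0, 1] x [0, 1]) is open there. *)
Definition pres_open (U : set (pres_complex r)) : Prop :=
  (forall x, open (edge x @^-1` U)) /\ (forall y, open (disc y @^-1` U)).

Lemma pres_openT : pres_open setT.
Proof. by split=> ?; rewrite preimage_setT; exact: openT. Qed.

Lemma pres_openI : setI_closed pres_open.
Proof.
move=> U V [U1 U2] [V1 V2].
by split=> ?; rewrite preimage_setI; exact: openI.
Qed.

Lemma pres_open_bigU (I : Type) (f : I -> set (pres_complex r)) :
  (forall i, pres_open (f i)) -> pres_open (\bigcup_i f i).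
Proof.
move=> fO; split=> z; rewrite preimage_bigcup; apply: bigcup_open => i _;
  by have [] := fO i.
Qed.

HB.instance Definition _ := isOpenTopological.Build (pres_complex r)
  pres_openT pres_openI pres_open_bigU.

End PresentationComplex.

Section Contractible.
Local Open Scope ring_scope.

Definition contractible (R : realType) (T : topologicalType) : Prop :=
  exists (p : T) (h : T * R -> T),
    [/\ {within [set z : T * R | 0 <= z.2 <= 1], continuous h},
        forall x, h (x, 0) = x &
        forall x, h (x, 1) = p].

End Contractible.

Definition contractible_presentation (R : realType) (X Y : choiceType)
    (r : Y -> freegroup X) : Prop :=
  contractible R (pres_complex R r).

(* r1 is the family r y (y in Y1), each r y being required to lie in the
   subgroup Phi(X1) of Phi(X); since Phi(X1) -> Phi(X) is injective, r1 is
   unique. *)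
Definition subpresentation (X Y : choiceType) (r : Y -> freegroup X)
    (X1 : {fset X}) (Y1 : {fset Y}) (r1 : Y1 -> freegroup X1) : Prop :=
  forall y : Y1, free_map (val : X1 -> X) (r1 y) = r (val y).

(* Main.v *)
(* The contraction of K(X | Y) makes the second integral cohomology vanish: every
   integral cochain on the 2-cells in Y1 is the coboundary of a cochain on the
   1-cells.  This is proved by hand, counting, over a fine grid in (disc) x [0, 1],
   the degree over one 2-cell of the image of each small square; the degrees of
   the six faces of a cube add up to 0.

   Hence the matrix of exponent sums of the relators r1 y has an integral right
   inverse, and by the Smith normal form its rows extend to a basis of Z^X1.
   So some Phi(Z + Y1) -> Phi(X1) with y |-> r1 y is an isomorphism on
   abelianizations; lifting along central extensions, it induces bijections
   Hom(Phi(X1), K) = Hom(Phi(Z + Y1), K) for every nilpotent K, and therefore an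
   isomorphism of both completions.  The same holds in every simplicial degree,
   and replaces the presentation by (Z + Y1 | Y1) with relators the generators
   y themselves.  Its free simplicial group is the free product of the constant
   group Phi(Z) with the free group on the pointed simplicial set
   Y1_+ /\ Delta^1, and the contraction of Delta^1 (the minimum) retracts it onto
   Phi(Z) degreewise by homomorphisms, hence also after completion. *)
Require Import Defs.
From HB Require Import structures.
From mathcomp Require Import all_boot all_order all_algebra finmap zify ring lra.
From mathcomp Require Import all_classical all_reals all_analysis.

Set Implicit Arguments.
Unset Strict Implicit.
Unset Printing Implicit Defensive.
Import Order.TTheory GRing.Theory Num.Theory numFieldNormedType.Exports.
Local Open Scope classical_set_scope.
Local Open Scope group_scope.

(** * Simplicial groups with a deformation retraction onto a constant group *)

Arguments wface : simpl never.
Arguments wdegen : simpl never.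

Section WbarMap.
Variables (G H : sgroup) (f : forall n, ghom (sg G n) (sg H n)).
Hypothesis f_face : forall n i x, (i <= n.+1)%N ->
  f n (gface G n i x) = gface H n i (f n.+1 x).
Hypothesis f_degen : forall n i x, (i <= n)%N ->
  f n.+1 (gdegen G n i x) = gdegen H n i (f n x).

Fixpoint wmap_fun (n : nat) : wsimp G n -> wsimp H n :=
  match n return wsimp G n -> wsimp H n with
  | 0 => fun=> tt
  | n'.+1 => fun x => (f n' x.1, wmap_fun x.2)
  end.

Lemma wmap_face n i (x : wsimp G n.+1) : (i <= n.+1)%N ->
  wmap_fun (wface i x) = wface i (wmap_fun x).
Proof.
elim: n i x => [|n IH] [|[|i]] //= x ni.
  by rewrite !wface1 /= gmulfM f_face.
apply: (f_equal2 pair); [exact: f_face | exact: (IH i.+1)].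
Qed.

Lemma wmap_degen n i (x : wsimp G n) : (i <= n)%N ->
  wmap_fun (wdegen i x) = wdegen i (wmap_fun x).
Proof.
elim: n i x => [|n IH] [|i] x ni //.
- by rewrite !wdegen0 /= gmulf1.
- by rewrite !wdegen0 /= gmulf1.
- apply: (f_equal2 pair); [exact: f_degen | exact: IH].
Qed.

Definition wmap : smap (Wbar G) (Wbar H) :=
  @SMap (Wbar G) (Wbar H) wmap_fun wmap_face wmap_degen.

End WbarMap.

(* [contr n c] is the homotopy at the n-simplex of Delta^1 that sends the first
   c vertices to 0, as in [delta1]; it acts by homomorphisms, so that it passes
   to Wbar and to completions. *)
Record retraction (G : sgroup) (F : groupType) := Retraction {
  rproj : forall n, ghom (sg G n) F;
  rincl : forall n, ghom F (sg G n);
  contr : forall n, nat -> ghom (sg G n) (sg G n);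
  rproj_face : forall n i x, (i <= n.+1)%N -> rproj n (gface G n i x) = rproj n.+1 x;
  rproj_degen : forall n i x, (i <= n)%N -> rproj n.+1 (gdegen G n i x) = rproj n x;
  rincl_face : forall n i a, (i <= n.+1)%N -> gface G n i (rincl n.+1 a) = rincl n a;
  rincl_degen : forall n i a, (i <= n)%N -> gdegen G n i (rincl n a) = rincl n.+1 a;
  rinclK : forall n a, rproj n (rincl n a) = a;
  contr_face : forall n i c x, (i <= n.+1)%N -> (c <= n.+2)%N ->
    gface G n i (contr n.+1 c x) = contr n (cut_face i c) (gface G n i x);
  contr_degen : forall n i c x, (i <= n)%N -> (c <= n.+1)%N ->
    gdegen G n i (contr n c x) = contr n.+1 (cut_degen i c) (gdegen G n i x);
  contr_top : forall n x, contr n n.+1 x = x;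
  contr_bot : forall n x, contr n 0 x = rincl n (rproj n x)
}.

Section Retraction.
Variables (G : sgroup) (F : groupType) (r : retraction G F).

Fixpoint wcontr (n c : nat) : wsimp G n -> wsimp G n :=
  match n return wsimp G n -> wsimp G n with
  | 0 => id
  | n'.+1 => fun x => (contr r n' c.-1 x.1, wcontr c.-1 x.2)
  end.

(* The entry of degree n of an (n+1)-simplex of Wbar lives over its last n+1
   vertices, hence the shift from c to c.-1 in [wcontr]. *)
Lemma wcontr_face n i c (x : wsimp G n.+1) : (i <= n.+1)%N -> (c <= n.+2)%N ->
  wface i (wcontr c x) = wcontr (cut_face i c) (wface i x).
Proof.
elim: n i c x => [|n IH] [|[|i]] c x // ni cn.
- by have -> : cut_face 0 c = c.-1 by case: (c).
- have e : (cut_face 1 c).-1 = c.-1.-1 by rewrite /cut_face; case: c {cn} => [|[]].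
  rewrite !wface1 /= gmulfM contr_face //; last by lia.
  by rewrite e /cut_face; case: c {cn e} => [|[]].
- have e : (cut_face i.+2 c).-1 = cut_face i.+1 c.-1.
    by rewrite /cut_face; do 2!case: ltnP => ?; lia.
  rewrite !wfaceS [in RHS]/= e; congr (_, _); last by apply: (IH i.+1) => //; lia.
  by apply: contr_face => //; lia.
Qed.

Lemma wcontr_degen n i c (x : wsimp G n) : (i <= n)%N -> (c <= n.+1)%N ->
  wdegen i (wcontr c x) = wcontr (cut_degen i c) (wdegen i x).
Proof.
have e c' : (cut_degen 0 c').-1 = c' by case: c'.
elim: n i c x => [|n IH] [|i] c x // ni cn.
- by rewrite !wdegen0 /= gmulf1.
- by rewrite !wdegen0 /= gmulf1 e.
- have e' : (cut_degen i.+1 c).-1 = cut_degen i c.-1.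
    by rewrite /cut_degen; do 2!case: ltnP => ?; lia.
  rewrite !wdegenS [in RHS]/= e'; congr (_, _); last by apply: IH => //; lia.
  by apply: contr_degen => //; lia.
Qed.

Lemma wcontr_top n (x : wsimp G n) : wcontr n.+1 x = x.
Proof. by elim: n x => [|n IH] //= [g w] /=; rewrite contr_top IH. Qed.

Program Definition wcontr_map : smap (sprod (Wbar G) delta1) (Wbar G) :=
  @SMap (sprod (Wbar G) delta1) (Wbar G)
    (fun n x => wcontr (val x.2) x.1) _ _.
Next Obligation.
move=> n i [x c] ni /=; have cn := ltn_ord c; rewrite wcontr_face //=.
by rewrite inordK // ltnS cut_face_le.
Qed.
Next Obligation.
move=> n i [x c] ni /=; have cn := ltn_ord c; rewrite wcontr_degen //=.
by rewrite inordK // ltnS cut_degen_le.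
Qed.

(** [wcontr_map] joins the identity, where all vertices are sent to 0, to the composite through [F],
    where none is. *)
Lemma retraction_homotopy_equivalent : homotopy_equivalent (Wbar G) (K1 F).
Proof.
exists (wmap (G := G) (H := const_sgroup F) (f := rproj r)
  (rproj_face r) (rproj_degen r)).
have incl_face n i a : (i <= n.+1)%N -> rincl r n a = gface G n i (rincl r n.+1 a).
  by move=> ni; rewrite rincl_face.
have incl_degen n i a : (i <= n)%N -> rincl r n.+1 a = gdegen G n i (rincl r n a).
  by move=> ni; rewrite rincl_degen.
exists (wmap (G := const_sgroup F) (H := G) (f := rincl r) incl_face incl_degen).
split.
  apply: homotopic_sym; apply: (homotopic_step (h := wcontr_map)) => n x.
  split; first exact: wcontr_top.
  elim: n x => [|n IH] [] // g w.
  by apply: (f_equal2 pair); [exact: contr_bot | exact: IH].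
(* This composite agrees with the identity on simplices; the constant homotopy avoids comparing the
   proof fields of the two maps. *)
pose p1 : smap (sprod (K1 F) delta1) (K1 F) :=
  @SMap (sprod (K1 F) delta1) (K1 F) (fun n x => x.1)
    (fun _ _ _ _ => erefl) (fun _ _ _ _ => erefl).
apply: (homotopic_step (h := p1)) => n x; split=> //=.
elim: n x => [|n IH] [] // g w.
by apply: (f_equal2 pair); [exact/esym/rinclK | exact: IH].
Qed.

Lemma base_Wbar n : base (@wbase G) n.+1 = (1, base wbase n) :> wsimp G n.+1.
Proof. exact: wdegen0. Qed.

Lemma wface_base n i : (i <= n.+1)%N ->
  wface i (base (@wbase G) n.+1 : wsimp G n.+1) = base wbase n.
Proof.
elim: n i => [|n IH] i ni; first exact: erefl.
case: i ni => [|[|i]] ni; first by rewrite wface0 base_Wbar.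
- by rewrite wface1 !base_Wbar /= gmulf1 mulg1.
- rewrite wfaceS (base_Wbar n.+1) [fst _]/= gmulf1 [snd _]/= IH //.
  exact/esym/base_Wbar.
Qed.

(** Loops are elements of G_0, homotopic when a 1-simplex of [G] joins them. The contraction joins
    each [x] to [rincl r 0 (rproj r 0 x)], so the classes are the elements of [F]. *)
Lemma retraction_pi1 : pi1_isomorphic (X := Wbar G) wbase F.
Proof.
exists (fun x : wsimp G 1 => rproj r 0 x.1); split.
- move=> [x []] [y []] _ _; split=> [/= xy|].
    (* [hx] has face 1 equal to [x] and face 0 in the image of [F]; likewise [hy] for [y]. As [x]
       and [y] have the same projection, combining them with [gdegen G 0 0 x] gives a 1-simplex from
       [x] to [y]. *)
    pose hx := contr r 1 1 (gdegen G 0 0 x).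
    pose hy := contr r 1 1 (gdegen G 0 0 y).
    have hx0 : gface G 0 0 hx = rincl r 0 (rproj r 0 x).
      by rewrite contr_face // gface_degen_eq // contr_bot.
    have hy0 : gface G 0 0 hy = rincl r 0 (rproj r 0 y).
      by rewrite contr_face // gface_degen_eq // contr_bot.
    have hx1 : gface G 0 1 hx = x.
      by rewrite contr_face // gface_degen_eqS // contr_top.
    have hy1 : gface G 0 1 hy = y.
      by rewrite contr_face // gface_degen_eqS // contr_top.
    exists (gdegen G 0 0 x * hx^-1 * hy, (1, tt)); split.
    + rewrite [LHS]wfaceS /= !gmulfM gmulfV hx1 hy1 gface_degen_eqS //.
      by rewrite mulgV mul1g.
    + rewrite [LHS]wface1 /= !gmulfM gmulfV hx0 hy0 gface_degen_eq // xy.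
      by rewrite mulgVK mulg1.
    + by case=> // _; exact: esym (base_Wbar 0).
  case=> -[k w] [z2 z1 z0]; have /= kw := z0 0%N isT.
  have {kw} -> : rproj r 0 x = rproj r 1 k.
    have /(congr1 fst)/= <- : (gface G 0 0 k * w.1, w.2) = (x, tt) by exact: z1.
    have -> : w = (1, tt) by exact: kw.
    by rewrite mulg1 rproj_face.
  have /(congr1 fst)/= <- : (gface G 0 1 k, tt) = (y, tt) by exact: z2.
  by rewrite rproj_face.
- move=> a; exists (rincl r 0 a, tt); split; last by rewrite /= rinclK.
  by move=> i _; case: (face _ _ _ _).
- move=> [k [g []]] _.
  rewrite -[face _ _ _ _]/(gface G 0 0 k * g, tt : wsimp G 0).
  rewrite -[face _ _ 2 _]/(gface G 0 1 k, tt : wsimp G 0).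
  by rewrite /= gmulfM !rproj_face.
Qed.

(** * Moore cycles and the higher homotopy groups of the classifying space *)

Section Moore.
Variable m : nat.

Definition moore_cycle (a : sg G m.+1) :=
  forall i, (i <= m.+1)%N -> gface G m i a = 1.

Definition moore_boundary (i : nat) (a : sg G m.+1) :=
  exists k : sg G m.+2, gface G m.+1 i k = a /\
    forall j, (j <= m.+2)%N -> j <> i -> gface G m.+1 j k = 1.

Lemma moore_boundary1 i : moore_boundary i 1.
Proof. by exists 1; split=> *; rewrite gmulf1. Qed.

Lemma moore_boundaryM i a b : moore_boundary i a -> moore_boundary i b ->
  moore_boundary i (a * b).
Proof.
move=> [k [<- kj]] [l [<- lj]]; exists (k * l); rewrite gmulfM; split=> // j jm ji.
by rewrite gmulfM kj ?lj ?mulg1.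
Qed.

Lemma moore_boundaryV i a : moore_boundary i a -> moore_boundary i a^-1.
Proof.
move=> [k [<- kj]]; exists k^-1; rewrite gmulfV; split=> // j jm ji.
by rewrite gmulfV kj ?invg1.
Qed.

Lemma gface_degen_cycle i j a : moore_cycle a -> (i <= m.+1)%N ->
  (j <= m.+2)%N -> j <> i -> j <> i.+1 -> gface G m.+1 j (gdegen G m.+1 i a) = 1.
Proof.
move=> ca im jm ji jiS; have [lij|lij] := ltnP j i.
  by rewrite gface_degen_lt ?lij // ca ?gmulf1 //; lia.
by rewrite gface_degen_gt ?ca ?gmulf1 //; lia.
Qed.

(* Being the only nontrivial face of a simplex does not depend on the position
   of the face: multiply by a degeneracy of the cycle to move it by one. *)
Lemma moore_boundary_shift i a : moore_cycle a -> (i <= m.+1)%N ->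
  moore_boundary i a <-> moore_boundary i.+1 a.
Proof.
move=> ca im; split=> -[k [ka kj]]; exists (gdegen G m.+1 i a * k^-1).
- split; first by rewrite gmulfM gmulfV gface_degen_eqS // kj ?invg1 ?mulg1 //; lia.
  move=> j jm jiS; rewrite gmulfM gmulfV; have [->|/eqP ji] := eqVneq j i.
    by rewrite gface_degen_eq // ka mulgV.
  by rewrite gface_degen_cycle // kj // invg1 mulg1.
- split; first by rewrite gmulfM gmulfV gface_degen_eq // kj ?invg1 ?mulg1 //; lia.
  move=> j jm ji; rewrite gmulfM gmulfV; have [->|/eqP jiS] := eqVneq j i.+1.
    by rewrite gface_degen_eqS // ka mulgV.
  by rewrite gface_degen_cycle // kj // invg1 mulg1.
Qed.

Lemma moore_boundary0 i a : moore_cycle a -> (i <= m.+2)%N ->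
  moore_boundary i a <-> moore_boundary 0 a.
Proof.
move=> ca; elim: i => // i IH im; rewrite -IH; last exact: ltnW.
by split=> /(moore_boundary_shift ca im).
Qed.

(** Prism decomposition of the contraction: as i runs from 0 to m+2, [contr r m.+1 i a] passes from
    1 to [a], and consecutive stages differ by a boundary. *)
Lemma moore_cycle_boundary a : moore_cycle a -> moore_boundary m.+1 a.
Proof.
move=> ca; apply/(moore_boundary0 ca); first by [].
have cc i : (i <= m.+2)%N -> moore_cycle (contr r m.+1 i a).
  by move=> im j jm; rewrite contr_face // ca // gmulf1.
rewrite -[a](contr_top r).
have : (m.+2 <= m.+2)%N by [].
elim: {1 3}m.+2 => [_|i IH im].
  (* Stage 0 is the image of the projection of [a] to [F], which factors through face 0 and so is
     trivial. *)
  by rewrite contr_bot -(rproj_face r (i := 0%N)) // ca // !gmulf1; exact: moore_boundary1.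
set x := contr r m.+1 i a in IH; set y := contr r m.+1 i.+1 a.
have cx : moore_cycle x by apply: cc; exact: ltnW.
have cy : moore_cycle y by exact: cc.
have -> : y = (x * y^-1)^-1 * x by rewrite invgM invgK mulgVK.
apply: moore_boundaryM; last by apply: IH; exact: ltnW.
apply: moore_boundaryV; apply/(moore_boundary0 (i := i)); last 1 first.
(* The i-th prism, corrected by a degeneracy of [y] to make face i+1 trivial; face i becomes
   [x * y^-1]. *)
- exists (contr r m.+2 i.+1 (gdegen G m.+1 i a) * (gdegen G m.+1 i y)^-1).
  have ii : cut_face i i.+1 = i by rewrite /cut_face ltnSn.
  have iiS : cut_face i.+1 i.+1 = i.+1 by rewrite /cut_face ltnn.
  split; first by rewrite gmulfM gmulfV contr_face ?ii ?gface_degen_eq // ltnW.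
  move=> j jm ji; rewrite gmulfM gmulfV contr_face //; last by lia.
  have [->|/eqP jiS] := eqVneq j i.+1.
    by rewrite iiS !gface_degen_eqS // mulgV.
  by rewrite !gface_degen_cycle // gmulf1 invg1 mulg1.
- by move=> j jm; rewrite gmulfM gmulfV cx // cy // invg1 mulg1.
- exact: ltnW.
Qed.

End Moore.

(** A sphere is a Moore cycle followed by the base point. Indices shift by one: face [m.+2] of the
    null-homotopy has leading entry face [m.+1] of [k]. *)
Lemma retraction_pi_trivial n : (2 <= n)%N -> pi_trivial (X := Wbar G) wbase n.
Proof.
case: n => [|[|m]] // _ [g w] sx.
have {sx} sx i : (i <= m.+2)%N -> wface i ((g, w) : wsimp G m.+2) = base (@wbase G) m.+1.
  exact: sx.
have w1 : w = base (@wbase G) m.+1 by exact: sx 0%N isT.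
have cg : moore_cycle g.
  case=> [|i] im.
    have := sx 1%N isT; rewrite wface1 w1 !base_Wbar /= => -[].
    by rewrite mulg1.
  by have := sx i.+2 im; rewrite wfaceS base_Wbar => -[].
have [k [km kj]] := moore_cycle_boundary cg.
exists ((k, base (@wbase G) m.+2) : wsimp G m.+3); split.
- rewrite [LHS]wfaceS [fst _]/= [snd _]/= wface_base // kj //; lia.
- by rewrite [LHS]wfaceS /= wface_base // km w1.
- case=> [|[|i]] im //.
    by rewrite [LHS]wface1 kj // !base_Wbar /= mulg1.
  by rewrite [LHS]wfaceS [fst _]/= [snd _]/= wface_base ?kj //; lia.
Qed.

End Retraction.

(** * Extension of homomorphisms into nilpotent groups *)

Section LetterSum.
Variables (X : Type) (C : zmodType).
Definition letter_sum (phi : X -> C) (w : seq (X * bool)) : C :=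
  (\sum_(l <- w) (if l.2 then phi l.1 else - phi l.1))%R.
End LetterSum.

Section CenterZmodule.
Variable K : groupType.

(** Made into a [zmodType] so that linear systems with integer coefficients can be solved in the
    centre; the boolean predicate makes [val] injective. *)
Definition zcenter := {x : K | `[< nsub (Defs.center K) x >]}.
HB.instance Definition _ := Choice.on zcenter.

Lemma zcenterP (x : zcenter) y : commute (val x) y.
Proof. by case: x => x /= /asboolP; apply. Qed.

Definition zc_sub (x : K) (cx : nsub (Defs.center K) x) : zcenter :=
  exist _ x (introT (asboolP _) cx).

Definition zc_zero : zcenter := zc_sub (nsub1 (Defs.center K)).
Definition zc_add (x y : zcenter) : zcenter :=
  zc_sub (@nsubM K (Defs.center K) (val x) (val y) (zcenterP x) (zcenterP y)).
Definition zc_opp (x : zcenter) : zcenter :=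
  zc_sub (@nsubV K (Defs.center K) (val x) (zcenterP x)).

Lemma zc_addA : associative zc_add.
Proof. by move=> x y z; apply: val_inj; exact: mulgA. Qed.
Lemma zc_addC : commutative zc_add.
Proof. by move=> x y; apply: val_inj; exact: zcenterP. Qed.
Lemma zc_add0 : left_id zc_zero zc_add.
Proof. by move=> x; apply: val_inj; exact: mul1g. Qed.
Lemma zc_addN : left_inverse zc_zero zc_opp zc_add.
Proof. by move=> x; apply: val_inj; exact: mulVg. Qed.

HB.instance Definition _ := GRing.isZmodule.Build zcenter
  zc_addA zc_addC zc_add0 zc_addN.

(** Central factors can be collected at the end of the product, each letter contributing its [d]
    with a sign. *)
Lemma eval_word_central (T : choiceType) (f f' : T -> K) (d : T -> zcenter) w :
  (forall x, f' x = f x * val (d x)) ->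
  eval_word f' w = eval_word f w * val (letter_sum d w).
Proof.
move=> f'E; elim: w => [|[x b] w IH]; first by rewrite /letter_sum big_nil mulg1.
rewrite /letter_sum big_cons -/(letter_sum d w); set c := letter_sum d w.
change (eval_letter f' (x, b) * eval_word f' w = eval_letter f (x, b) *
  eval_word f w * (val (if b then d x else - d x)%R * val c)); rewrite IH.
have -> : eval_letter f' (x, b) =
    eval_letter f (x, b) * val (if b then d x else - d x)%R.
  case: b; rewrite /eval_letter //= f'E invgM.
  exact: (zcenterP (- d x)%R).
rewrite !mulgA; congr (_ * _); rewrite -!mulgA; congr (_ * _).
exact: zcenterP.
Qed.

End CenterZmodule.

Lemma lower_central_quotient (G : groupType) (N : normal_subgroup G) s a :
  lower_central (quotient N) s a -> exists2 c, lower_central G s c & a = qproj N c.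
Proof.
elim: s a => [|s IH] a /=; first by elim/qproj_ind: a => x; exists x.
elim=> {a} [_ [x [y [/IH[c sc ->] ->]]]| |x y _ [c sc ->] _ [d sd ->]|x _ [c sc ->]].
- elim/qproj_ind: x => x; exists [~ x, c]; first by apply: gen_in; exists x, c.
  by rewrite (gmulfR (qproj N)).
- by exists 1; [exact: gen_one | rewrite gmulf1].
- by exists (c * d); [exact: gen_mul | rewrite (gmulfM (s := qproj N))].
- by exists c^-1; [exact: gen_inv | rewrite (gmulfV (qproj N))].
Qed.

Lemma lower_central_quotient_center (K : groupType) s :
  (forall x, lower_central K s.+1 x -> x = 1) ->
  forall a, lower_central (quotient (Defs.center K)) s a -> a = 1.
Proof.
move=> Ks a /lower_central_quotient[c sc ->].
rewrite -(gmulf1 (s := qproj (Defs.center K))); apply/qprojP => y; rewrite mulg1.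
apply/commute_sym/commuteV/commute_sym/commute_sym/commgP/eqP.
by apply: Ks; apply: gen_in; exists y, c.
Qed.

Section IntegerMatrix.
Variables (A B : finType) (alpha : A -> freegroup B) (N : B -> A -> int).

Definition exponent_sum (w : freegroup B) (b : B) : int :=
  letter_sum (fun b' => (b' == b)%:Z%R) (val w).

Lemma letter_sum_exponent (C : zmodType) (d : B -> C) (w : freegroup B) :
  (letter_sum d (val w) = \sum_b d b *~ exponent_sum w b)%R.
Proof.
have dE x : (d x = \sum_b d b *~ (x == b)%:Z)%R.
  rewrite (bigD1 x) //= eqxx mulr1z big1 ?addr0 // => b.
  by rewrite eq_sym => /negPf->; rewrite mulr0z.
rewrite /exponent_sum /letter_sum; elim: (val w) => [|[x b] u IH].
  by rewrite big_nil big1 // => b _; rewrite big_nil mulr0z.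
rewrite big_cons IH [RHS](eq_bigr (fun b' => d b' *~ (if b then (x == b')%:Z else - (x == b')%:Z) +
    d b' *~ letter_sum (fun b0 => (b0 == b')%:Z) u)%R).
  rewrite big_split /=; congr (_ + _)%R; case: b => /=; first exact: dE.
  by rewrite [in LHS]dE -sumrN; apply: eq_bigr => b _; rewrite mulrNz.
by move=> b' _; rewrite big_cons mulrzDr.
Qed.

Hypothesis MN : forall a a',
  (\sum_b exponent_sum (alpha a) b * N b a' = (a == a')%:Z)%R.
Hypothesis NM : forall b b',
  (\sum_a N b a * exponent_sum (alpha a) b' = (b == b')%:Z)%R.

(* Induction on the class of K: over K / Z(K) the extension exists and is
   unique, and lifts to K differ by a linear system with values in Z(K), which
   the inverse matrix N solves. *)
Lemma nilpotent_extension s (K : groupType) :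
  (forall x, lower_central K s x -> x = 1) ->
  (forall chi : A -> K, exists f : B -> K, forall a, free_lift f (alpha a) = chi a) /\
  (forall f f' : B -> K,
    (forall a, free_lift f (alpha a) = free_lift f' (alpha a)) -> f =1 f').
Proof.
elim: s K => [|s IH] K Ks.
  have all1 x : x = 1 := Ks x I.
  by split=> [chi|f f' _ b]; [exists (fun=> 1) => a|]; rewrite [LHS]all1 [RHS]all1.
have [ex uniq_] := IH _ (lower_central_quotient_center Ks).
have proj f w : qproj (Defs.center K) (free_lift f w) =
    free_lift (fun b => qproj (Defs.center K) (f b)) w.
  apply: (free_ext (f := qproj (Defs.center K) \o free_lift f)) => b /=.
  by rewrite free_liftE free_liftE.
have lift f f' (d : B -> zcenter K) w : (forall b, f' b = f b * val (d b)) ->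
    free_lift f' w = free_lift f w * val (\sum_b d b *~ exponent_sum w b)%R.
  by move=> f'E; rewrite -letter_sum_exponent; exact: eval_word_central.
have quot (x y : K) : qproj (Defs.center K) x = qproj (Defs.center K) y ->
    {z : zcenter K | y = x * val z}.
  move=> /qprojP c; exists (zc_sub c); by rewrite /= mulgA mulgV mul1g.
split=> [chi|f f' ff'].
- have [f0 f0E] := ex (fun a => qproj (Defs.center K) (chi a)).
  pose f b := repr (f0 b).
  have fE b : qproj (Defs.center K) (f b) = f0 b by exact: qreprK.
  have e a : {z : zcenter K | chi a = free_lift f (alpha a) * val z}.
    apply: quot; rewrite proj -f0E; congr (free_lift _ _).
    by apply/funext => b; rewrite fE.
  pose d b : zcenter K := (\sum_a sval (e a) *~ N b a)%R.
  exists (fun b => f b * val (d b)) => a.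
  rewrite (lift f _ d) // [RHS](svalP (e a)); congr (_ * val _).
  rewrite /d; under eq_bigr => b _ do rewrite mulrz_suml.
  rewrite exchange_big /= (bigD1 a) //= [X in (_ + X)%R]big1 ?addr0 => [|a' aa'].
    under eq_bigr => b _ do rewrite -mulrzA mulrC.
    by rewrite -mulrz_sumr MN eqxx mulr1z.
  under eq_bigr => b _ do rewrite -mulrzA mulrC.
  by rewrite -mulrz_sumr MN eq_sym (negPf aa') mulr0z.
- have fq : (fun b => qproj (Defs.center K) (f b)) =1 (fun b => qproj (Defs.center K) (f' b)).
    by apply: uniq_ => a; rewrite -!proj ff'.
  pose d b := sval (quot _ _ (fq b)).
  have f'E b : f' b = f b * val (d b) by exact: svalP (quot _ _ (fq b)).
  have z a : (\sum_b d b *~ exponent_sum (alpha a) b = 0)%R.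
    apply: val_inj; apply: (mulgI (free_lift f (alpha a))).
    by rewrite -(lift f f') // -ff' mulg1.
  move=> b; rewrite f'E (_ : d b = 0%R) ?mulg1 //.
  have -> : (d b = \sum_a (\sum_b' d b' *~ exponent_sum (alpha a) b') *~ N b a)%R.
    under eq_bigr => a _ do rewrite mulrz_suml.
    rewrite exchange_big /= (bigD1 b) //= [X in (_ + X)%R]big1 ?addr0 => [|b' bb'].
      under eq_bigr => a _ do rewrite -mulrzA mulrC.
      by rewrite -mulrz_sumr NM eqxx mulr1z.
    under eq_bigr => a _ do rewrite -mulrzA mulrC.
    by rewrite -mulrz_sumr NM eq_sym (negPf bb') mulr0z.
  by rewrite big1 // => a _; rewrite z mul0rz.
Qed.

End IntegerMatrix.

(** * Completions of homomorphisms that nilpotent groups cannot distinguish *)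

Definition nilpotent_equiv (G H : groupType) (alpha : ghom G H) : Prop :=
  forall K : groupType, nilpotent K -> forall chi : ghom G K,
  exists phi : ghom H K, (forall x, phi (alpha x) = chi x) /\
    forall phi' : ghom H K, (forall x, phi' (alpha x) = chi x) -> phi' =1 phi.

Lemma nilpotent_equiv_ext (G H K : groupType) (alpha : ghom G H) (f g : ghom H K) :
  nilpotent_equiv alpha -> nilpotent K ->
  (forall x, f (alpha x) = g (alpha x)) -> f =1 g.
Proof.
move=> ea nK fg; pose chi : ghom G K := g \o alpha.
have [phi [_ phiU]] := ea K nK chi.
by move=> x; rewrite (phiU f) // (phiU g).
Qed.

Lemma nilpotent_equiv_matrix (A B : finType) (alpha : A -> freegroup B)
    (N : B -> A -> int) :
  (forall a a', (\sum_b exponent_sum (alpha a) b * N b a' = (a == a')%:Z)%R) ->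
  (forall b b', (\sum_a N b a * exponent_sum (alpha a) b' = (b == b')%:Z)%R) ->
  nilpotent_equiv (free_lift alpha).
Proof.
move=> MN NM K [s Ks] chi.
have [ex uniq_] := nilpotent_extension MN NM Ks.
have [f fE] := ex (fun a => chi (free_gen a)).
have fchi x : free_lift f (free_lift alpha x) = chi x.
  move: x; apply: (free_ext (f := free_lift f \o free_lift alpha)) => a /=.
  by rewrite free_liftE fE.
exists (free_lift f); split=> // phi' phi'E; apply: free_ext => b.
rewrite free_liftE; move: b; apply: uniq_ => a.
rewrite -[RHS]/(free_lift f (alpha a)) fE -phi'E free_liftE; symmetry.
by move: (alpha a); apply: free_ext => b; rewrite free_liftE.
Qed.

Definition free_extend (A B W : choiceType) (alpha : ghom (freegroup A) (freegroup B)) :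
    ghom (freegroup (A + W)%type) (freegroup (B + W)%type) :=
  free_lift (fun s => match s with
    | inl a => free_map (inl : B -> (B + W)%type) (alpha (free_gen a))
    | inr w => free_gen (inr w : (B + W)%type)
    end).

Lemma free_extend_inl (A B W : choiceType) (alpha : ghom (freegroup A) (freegroup B)) x :
  free_extend W alpha (free_map (inl : A -> (A + W)%type) x) =
  free_map (inl : B -> (B + W)%type) (alpha x).
Proof.
move: x; apply: (free_ext (f := free_extend W alpha \o free_map (inl : A -> (A + W)%type))
  (g := free_map (inl : B -> (B + W)%type) \o alpha)) => a /=.
by rewrite /free_map free_liftE free_liftE.
Qed.

Lemma free_extend_inr (A B W : choiceType) (alpha : ghom (freegroup A) (freegroup B)) w :
  free_extend W alpha (free_gen (inr w : (A + W)%type)) = free_gen (inr w : (B + W)%type).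
Proof. exact: free_liftE. Qed.

Lemma nilpotent_equiv_extend (A B W : choiceType)
    (alpha : ghom (freegroup A) (freegroup B)) :
  nilpotent_equiv alpha -> nilpotent_equiv (free_extend W alpha).
Proof.
move=> ea K nK chi.
pose chi0 : ghom (freegroup A) K := chi \o free_map (inl : A -> (A + W)%type).
have [phi0 [phi0E phi0U]] := ea K nK chi0.
pose phi : ghom (freegroup (B + W)%type) K := free_lift (fun s => match s with
  | inl b => phi0 (free_gen b) | inr w => chi (free_gen (inr w : (A + W)%type)) end).
have phi_inl x : phi (free_map (inl : B -> (B + W)%type) x) = phi0 x.
  move: x; apply: (free_ext (f := phi \o free_map (inl : B -> (B + W)%type))) => b /=.
  by rewrite /free_map free_liftE free_liftE.
exists phi; split.
  apply: (free_ext (f := phi \o free_extend W alpha)) => -[a|w] /=.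
    have -> : free_gen (inl a : (A + W)%type) = free_map (inl : A -> (A + W)%type) (free_gen a).
      by rewrite /free_map free_liftE.
    by rewrite free_extend_inl phi_inl phi0E.
  by rewrite free_extend_inr free_liftE.
move=> phi' phi'E; apply: free_ext => -[b|w].
  have := phi0U (phi' \o free_map (inl : B -> (B + W)%type)).
  have H x : (phi' \o free_map (inl : B -> (B + W)%type)) (alpha x) = chi0 x.
    by rewrite /= -free_extend_inl phi'E.
  by move=> /(_ H (free_gen b)) /=; rewrite /free_map free_liftE => ->; rewrite free_liftE.
by rewrite free_liftE -phi'E free_extend_inr.
Qed.

Lemma ghom_inverse (G H : groupType) (f : ghom G H) : bijective f ->
  exists g : ghom H G, cancel f g /\ cancel g f.
Proof.
move=> [g fK gK].
have g1 : g 1 = 1 by rewrite -(gmulf1 (s := f)) fK.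
have gM : {morph g : x y / x * y}.
  by move=> x y; apply: (can_inj fK); rewrite gmulfM !gK.
pose gm := isUMagmaMorphism.Build H G g (g1, gM).
by exists (HB.pack g gm : ghom H G).
Qed.

Lemma injsurj_bij (T T' : Type) (f : T -> T') :
  injective f -> (forall y, exists x, f x = y) -> bijective f.
Proof.
move=> fI fS; pose g y := sval (cid (fS y)).
have gK : cancel g f by move=> y; exact: svalP (cid (fS y)).
by exists g => // x; apply: fI; rewrite gK.
Qed.

Lemma nilpotent_quotient_lcs (G : groupType) s : nilpotent (quotient (lcs G s)).
Proof.
exists s => a /lower_central_quotient[c sc ->].
rewrite -(gmulf1 (s := qproj (lcs G s))); apply/qprojP; rewrite mulg1.
exact: lower_centralV.
Qed.

Lemma malcev_map_bij (N N' : groupType) (f : ghom N N') :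
  bijective f -> bijective (malcev_map f).
Proof.
move=> /ghom_inverse[g [fK gK]]; exists (malcev_map g) => a.
  have h1 : forall x, (idfun : ghom N N) x = g (f x) by move=> x; rewrite fK.
  by rewrite -(malcev_map_comp h1) malcev_map_id.
have h1 : forall x, (idfun : ghom N' N') x = f (g x) by move=> x; rewrite gK.
by rewrite -(malcev_map_comp h1) malcev_map_id.
Qed.

Section CompletionEquiv.
Variables (G H : groupType) (alpha : ghom G H).
Hypothesis ea : nilpotent_equiv alpha.

(** The target of the projection of [G] is nilpotent, so the projection extends along [alpha] to
    [phi] on [H], which induces the inverse. *)
Lemma nilpotent_equiv_lcs s :
  bijective (@qmap G H (lcs G s) (lcs H s) alpha (@lower_central_hom G H alpha s)).
Proof.
set q := qmap _ _.
have [phi [phiE _]] := ea (@nilpotent_quotient_lcs G s) (qproj (lcs G s)).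
have qphi h : q (phi h) = qproj (lcs H s) h.
  apply: (nilpotent_equiv_ext (f := q \o phi) ea (@nilpotent_quotient_lcs H s)).
  move=> x; rewrite -[LHS]/(q (phi (alpha x))) phiE.
  exact: qmapE.
apply: injsurj_bij.
  elim/qproj_ind=> x; elim/qproj_ind=> y.
  rewrite -[qproj_fun _ x]/(qproj _ x) -[qproj_fun _ y]/(qproj _ y).
  rewrite !qmapE -!phiE => /qprojP /=; rewrite -gmulfV -gmulfM => xy.
  have /lower_central_quotient[c sc cE] := @lower_central_hom _ _ phi s _ xy.
  have : phi (alpha (x^-1 * y)) = 1.
    rewrite cE -(gmulf1 (s := qproj (lcs G s))); apply/qprojP; rewrite mulg1.
    exact: lower_centralV.
  rewrite !gmulfM !gmulfV => /(congr1 (fun z => phi (alpha x) * z)).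
  by rewrite mulgA mulgV mul1g mulg1 => ->.
elim/qproj_ind=> h; exists (phi h); exact: qphi.
Qed.

Lemma malcev_limit_map_bij : bijective (malcev_limit_map alpha).
Proof.
have bij s : bijective (malcev_tower_map_at alpha s).
  by apply: malcev_map_bij; exact: nilpotent_equiv_lcs.
apply: injsurj_bij.
  move=> x y xy; apply: limit_ext => s; apply: (bij_inj (bij s)).
  by have := congr1 (fun z : malcev_tower_limit H => lcomp z s) xy.
move=> y.
have surj s b : exists a, malcev_tower_map_at alpha s a = b.
  by have [g _ gK] := bij s; exists (g b); rewrite gK.
pose x s := sval (cid (surj s (lcomp y s))).
have xE s : malcev_tower_map_at alpha s (x s) = lcomp y s.
  exact: (svalP (cid (surj s (lcomp y s)))).
(* The chosen preimages are compatible because each level of the map is injective. *)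
have xP : forall a : darr (malcev_system G), dmap a (x (dsrc a)) = x (dtgt a).
  move=> s; apply: (bij_inj (bij s)); rewrite [RHS]xE.
  have /= <- := lcompP y (s : darr (malcev_system H)).
  rewrite -(xE s.+1) /=.
  by apply: malcev_map_square => u; exact: qmap_square.
by exists (exist _ x xP : malcev_tower_limit G); apply: limit_ext => s; exact: xE.
Qed.

End CompletionEquiv.

(* The theory of finite p-groups is imported in a module of its own because its
   notations and names ([nilpotent], [pgroup], [quotient]) clash with those above. *)
Module FiniteGroup.
From mathcomp Require Import all_fingroup all_solvable.

Section Enumerated.
Variables (K : groupType) (s : seq K) (sP : forall x, x \in s).

Definition enumerated : Type := K.
HB.instance Definition _ := monoid.Group.on enumerated.

Lemma enumerated_pickleK : pcancel (fun x : enumerated => index (x : K) s) (onth s).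
Proof. by move=> x; rewrite onthE (nth_map x) ?index_mem ?nth_index ?sP. Qed.
HB.instance Definition _ := PCanIsCountable enumerated_pickleK.

Lemma enumeratedP : Finite.axiom (undup s : seq enumerated).
Proof. by move=> x; rewrite count_uniq_mem ?undup_uniq // mem_undup sP. Qed.
HB.instance Definition _ := fintype.isFinite.Build enumerated enumeratedP.


Lemma enumerated_nilpotent p : prime p -> (forall x : K, exists k, x ^+ (p ^ k) = 1) ->
  Defs.nilpotent K.
Proof.
move=> pp Kp; pose T : finGroupType := enumerated.
have pG : p.-group [set: T]%G.
  apply/pgroupP => q qp /Cauchy[] // x _ xq.
  have [k xk] := Kp (x : K).
  have : #[x : T] %| p ^ k by rewrite order_dvdn; apply/eqP; exact: xk.
  by rewrite xq Euclid_dvdX // => /andP[]; rewrite dvdn_prime2 // => /eqP->; rewrite inE.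
have /lcnP[n Ln] := pgroup_nil pG.
exists n => x; have H t (y : K) : lower_central K t y -> (y : T) \in 'L_t.+1([set: T]%G).
  elim: t y => [|t IH] y /=; first by rewrite lcn1 inE.
  elim=> {y} [_ [u [v [/IH tv ->]]]| |u v _ uL _ vL|u _ uL].
  (* The generating commutators have the previous term in second place, those of [lcnSn] in first
     place; hence the inversion. *)
  - rewrite lcnSn -[[~ u, v] : T]/([~ (u : T), (v : T)]) -invg_comm groupV.
    by rewrite mem_commg ?inE.
  - exact: group1.
  - exact: groupM.
  - by rewrite groupV.
by move=> /H; rewrite Ln => /set1gP.
Qed.

End Enumerated.

End FiniteGroup.

Lemma pgroup_nilpotent p (K : groupType) : prime p -> pgroup p K -> nilpotent K.
Proof.
move=> pp [/finite_seqP[s sP] Kp].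
apply: (@FiniteGroup.enumerated_nilpotent K s _ p) => // x.
by have : [set` s] x by rewrite -sP.
Qed.

Program Definition trivial_nsub (K : groupType) : normal_subgroup K :=
  @NormalSubgroup K [set 1] _ _ _ _.
Next Obligation. by []. Qed.
Next Obligation. by move=> K x y -> ->; rewrite mulg1. Qed.
Next Obligation. by move=> K x ->; rewrite invg1. Qed.
Next Obligation. by move=> K x y ->; rewrite conj1g. Qed.

Lemma pgroup_quotient p (K : groupType) (N : normal_subgroup K) :
  pgroup p K -> pgroup p (quotient N).
Proof.
move=> [finK Kp]; split.
  have -> : [set: quotient N] = qproj N @` [set: K].
    by apply/seteqP; split=> // a _; exists (repr a) => //; exact: qreprK.
  exact: finite_image.
elim/qproj_ind=> x; have [k xk] := Kp x; exists k.
by rewrite -[qproj_fun _ x]/(qproj N x) -gmulfXn xk gmulf1.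
Qed.

Section Kernel.
Variables (p : nat) (H K : groupType) (phi : ghom H K) (Kp : pgroup p K).

Definition kernel_popen : popen p H :=
  preim_popen phi (POpen (pgroup_quotient (trivial_nsub K) Kp)).

Lemma kernel_popenP h : nsub kernel_popen h <-> phi h = 1.
Proof. by []. Qed.

Lemma qproj_kernel h h' :
  qproj kernel_popen h = qproj kernel_popen h' <-> phi h = phi h'.
Proof.
split=> [/qprojP /=|hh']; last by apply/qprojP; rewrite /= gmulfM gmulfV hh' mulVg.
rewrite gmulfM gmulfV => /(congr1 (fun z => phi h * z)).
by rewrite mulgA mulgV mul1g mulg1.
Qed.

End Kernel.

Lemma lcomp_pro_p p (G : groupType) (x : pro_p_completion p G) (N M : popen p G) g :
  nsub N `<=` nsub M -> lcomp x N = qproj N g -> lcomp x M = qproj M g.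
Proof.
move=> NM xN; have := lcompP x (exist _ (N, M) NM : darr (pro_p_system p G)).
by move=> /= <-; rewrite [lcomp x _]xN; exact: qmapE.
Qed.

Section ProPEquiv.
Variables (G H : groupType) (alpha : ghom G H) (p : nat).
Hypothesis ea : nilpotent_equiv alpha.
Hypothesis pp : prime p.

Let nil_popen (G' : groupType) (N : popen p G') : nilpotent (quotient N).
Proof. by apply: (pgroup_nilpotent pp); exact: popen_pgroup. Qed.

Let ext_sig (N : popen p G) :
  {phi : ghom H (quotient N) | forall x, phi (alpha x) = qproj N x}.
Proof.
by apply: cid; have [phi [phiE _]] := ea (nil_popen N) (qproj N); exists phi.
Qed.

Let ext (N : popen p G) : ghom H (quotient N) := sval (ext_sig N).
Let extE (N : popen p G) x : ext N (alpha x) = qproj N x. Proof. exact: (svalP (ext_sig N)). Qed.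
Let ker (N : popen p G) : popen p H := kernel_popen (ext N) (popen_pgroup N).

(** Since [ext N] restricts to the projection along [alpha], the preimage of [ker N] lies in [N]. So
    the component at [N] is determined by the component of the image at [ker N]. *)
Lemma pro_p_map_inj : injective (pro_p_map alpha p).
Proof.
move=> x x' xx'; apply: limit_ext => N.
have sub : nsub (preim_popen alpha (ker N)) `<=` nsub N.
  move=> g /= gk; have : qproj N 1 = qproj N g by rewrite gmulf1 -extE gk.
  by move=> /qprojP; rewrite invg1 mul1g.
have E : lcomp x (preim_popen alpha (ker N)) = lcomp x' (preim_popen alpha (ker N)).
  apply: (@preim_qmap_inj _ _ alpha (ker N)).
  exact: (congr1 (fun z : pro_p_completion p H => lcomp z (ker N)) xx').
have x'E := esym (qreprK (lcomp x' (preim_popen alpha (ker N)))).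
by rewrite (lcomp_pro_p sub x'E) (lcomp_pro_p sub (etrans E x'E)).
Qed.

(** The component at [N] of a preimage is the value of [ext N] at a representative of the component
    of [y] at [ker N]. *)
Lemma pro_p_map_surj y : exists x, pro_p_map alpha p x = y.
Proof.
pose h N := repr (lcomp y (ker N)).
have yE N : lcomp y (ker N) = qproj (ker N) (h N) by exact: esym (qreprK _).
pose x (N : dob (pro_p_system p G)) : dgrp (pro_p_system p G) N := ext N (h N).
have xP : forall a : darr (pro_p_system p G), dmap a (x (dsrc a)) = x (dtgt a).
  move=> [[N N'] NN'] /=; rewrite /x.
  pose q := @qmap G G N N' idfun NN'.
  have qext u : q (ext N u) = ext N' u.
    apply: (nilpotent_equiv_ext (f := q \o ext N) ea (nil_popen N')) => v.
    rewrite -[LHS]/(q (ext N (alpha v))) !extE; exact: qmapE.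
  have sub : nsub (ker N) `<=` nsub (ker N').
    by move=> u /kernel_popenP uN; apply/kernel_popenP; rewrite -qext uN gmulf1.
  rewrite -[LHS]/(q (ext N (h N))) qext.
  apply/(qproj_kernel _ (popen_pgroup N')); rewrite -/(ker N') -yE.
  by rewrite (lcomp_pro_p sub (yE N)).
exists (exist _ x xP : pro_p_completion p G); apply: limit_ext => M.
rewrite -[LHS]/(preim_qmap alpha M (ext (preim_popen alpha M) (h (preim_popen alpha M)))).
set N := preim_popen alpha M.
(* Both sides are extensions along [alpha] of the same homomorphism to a p-group; their equality
   puts [ker N] inside [M]. *)
have E u : preim_qmap alpha M (ext N u) = qproj M u.
  apply: (nilpotent_equiv_ext (f := preim_qmap alpha M \o ext N) ea (nil_popen M)) => v.
  by rewrite -[LHS]/(preim_qmap alpha M (ext N (alpha v))) extE; exact: preim_qmapE.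
rewrite E; symmetry; apply: lcomp_pro_p (yE N) => u /kernel_popenP uN.
have : qproj M 1 = qproj M u by rewrite gmulf1 -E uN gmulf1.
by move=> /qprojP; rewrite invg1 mul1g.
Qed.

End ProPEquiv.

Lemma completion_map_bij R (G H : groupType) (alpha : ghom G H) :
  nilpotent_equiv alpha -> bijective (completion_map R alpha).
Proof.
move=> ea; case: R => [|p pp] /=; first exact: malcev_limit_map_bij.
by apply: injsurj_bij; [exact: pro_p_map_inj | exact: pro_p_map_surj].
Qed.

(** * Retraction of the completed simplicial presentation *)

Lemma completion_map_square R (G H H' K : groupType) (f : ghom G H) (g : ghom H K)
    (f' : ghom G H') (g' : ghom H' K) : (forall x, g (f x) = g' (f' x)) ->
  forall a, completion_map R g (completion_map R f a) =
            completion_map R g' (completion_map R f' a).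
Proof.
move=> fg a; pose h : ghom G K := g \o f.
rewrite -(completion_map_comp (h := h)) //.
by apply: completion_map_comp => x; rewrite -fg.
Qed.

Lemma completion_retraction R (G : sgroup) (F : groupType) :
  retraction G F -> retraction (sgroup_completion R G) (completion R F).
Proof.
move=> r.
apply: (@Retraction (sgroup_completion R G) (completion R F)
  (fun n => completion_map R (rproj r n)) (fun n => completion_map R (rincl r n))
  (fun n c => completion_map R (contr r n c))) => /=.
- move=> n i x ni; symmetry; apply: completion_map_comp => y.
  by rewrite rproj_face.
- move=> n i x ni; symmetry; apply: completion_map_comp => y.
  by rewrite rproj_degen.
- move=> n i x ni; symmetry; apply: completion_map_comp => y.
  by rewrite rincl_face.
- move=> n i x ni; symmetry; apply: completion_map_comp => y.
  by rewrite rincl_degen.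
- move=> n x; pose h : ghom F F := rproj r n \o rincl r n.
  rewrite -(completion_map_comp (h := h)) //.
  by apply: completion_map_id => y; exact: rinclK.
- by move=> n i c x ni cn; apply: completion_map_square => y; exact: contr_face.
- by move=> n i c x ni cn; apply: completion_map_square => y; exact: contr_degen.
- by move=> n x; apply: completion_map_id => y; exact: contr_top.
- by move=> n x; apply: completion_map_comp => y; exact: contr_bot.
Qed.

Lemma retraction_transport (G G' : sgroup) (F : groupType)
    (e : forall n, ghom (sg G n) (sg G' n)) :
  (forall n, bijective (e n)) ->
  (forall n i x, (i <= n.+1)%N -> e n (gface G n i x) = gface G' n i (e n.+1 x)) ->
  (forall n i x, (i <= n)%N -> e n.+1 (gdegen G n i x) = gdegen G' n i (e n x)) ->
  retraction G F -> retraction G' F.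
Proof.
move=> eb e_face e_degen r.
pose e' n := sval (cid (ghom_inverse (eb n))).
have eK n : cancel (e n) (e' n) by exact: (svalP (cid (ghom_inverse (eb n)))).1.
have e'K n : cancel (e' n) (e n) by exact: (svalP (cid (ghom_inverse (eb n)))).2.
have e'_face n i x : (i <= n.+1)%N -> e' n (gface G' n i x) = gface G n i (e' n.+1 x).
  by move=> ni; apply: (can_inj (eK n)); rewrite e'K e_face // e'K.
have e'_degen n i x : (i <= n)%N -> e' n.+1 (gdegen G' n i x) = gdegen G n i (e' n x).
  by move=> ni; apply: (can_inj (eK n.+1)); rewrite e'K e_degen // e'K.
apply: (@Retraction G' F (fun n => rproj r n \o e' n) (fun n => e n \o rincl r n)
  (fun n c => e n \o (contr r n c \o e' n))) => /=.
- by move=> n i x ni; rewrite e'_face // rproj_face.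
- by move=> n i x ni; rewrite e'_degen // rproj_degen.
- by move=> n i x ni; rewrite -e_face // rincl_face.
- by move=> n i x ni; rewrite -e_degen // rincl_degen.
- by move=> n a; rewrite eK rinclK.
- by move=> n i c x ni cn; rewrite -e_face // e'_face // contr_face.
- by move=> n i c x ni cn; rewrite -e_degen // e'_degen // contr_degen.
- by move=> n x; rewrite contr_top e'K.
- by move=> n x; rewrite contr_bot.
Qed.

Lemma pX_gen (X Y : choiceType) n x :
  pX X Y n (free_gen x) = free_gen (inl x : pbasis X Y n).
Proof. exact: free_liftE. Qed.

(** * The presentation whose relators are generators *)

Section CancellingPairs.
Variables Z Y : choiceType.

Definition cancelling_relator (y : Y) : freegroup (Z + Y)%type := free_gen (inr y).

Notation r := cancelling_relator.
Notation B n := (pbasis (Z + Y)%type Y n).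
Notation iota := (pX (Z + Y)%type Y).

Lemma pY_last n y : pY r n y n.+1 = iota n (free_gen (inr y : (Z + Y)%type)).
Proof. exact: pY_top. Qed.

(** By [pY_last] the generator y is the case c = n+1 of [pY]. Hence each y contributes all the
    simplices of Delta^1, the one with c = 0 being trivial, and the basis needs no further case. *)
Lemma cancelling_ext n (G : groupType) (f g : ghom (freegroup (B n)) G) :
  (forall z, f (iota n (free_gen (inl z : (Z + Y)%type))) =
             g (iota n (free_gen (inl z : (Z + Y)%type)))) ->
  (forall y c, (c <= n.+1)%N -> f (pY r n y c) = g (pY r n y c)) -> f =1 g.
Proof.
move=> fgZ fgY; apply: (pbasis_ext (r := r)) => [[z|y]|y c cn].
- exact: fgZ.
- by rewrite -pY_last; exact: fgY.
- by apply: fgY; exact: leqW.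
Qed.

Definition cancelling_proj n : ghom (freegroup (B n)) (freegroup Z) :=
  free_lift (fun b : B n => if b is inl (inl z) then free_gen z else 1).

Definition cancelling_incl n : ghom (freegroup Z) (freegroup (B n)) :=
  free_lift (fun z => iota n (free_gen (inl z : (Z + Y)%type))).

(** On numbers of vertices sent to 0, contracting Delta^1 is taking the minimum: c = 0 gives the
    trivial simplex and c = n+1 the identity. *)
Definition cancelling_contr n (c : nat) : ghom (freegroup (B n)) (freegroup (B n)) :=
  free_lift (fun b : B n => match b with
    | inl (inl z) => iota n (free_gen (inl z : (Z + Y)%type))
    | inl (inr y) => pY r n y (minn c n.+1)
    | inr (y, k) => pY r n y (minn c k.+1)
    end).

Lemma cancelling_projZ n z :
  cancelling_proj n (iota n (free_gen (inl z : (Z + Y)%type))) = free_gen z.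
Proof. by rewrite pX_gen free_liftE. Qed.

Lemma cancelling_inclE n z :
  cancelling_incl n (free_gen z) = iota n (free_gen (inl z : (Z + Y)%type)).
Proof. exact: free_liftE. Qed.

Lemma cancelling_contrZ n c z :
  cancelling_contr n c (iota n (free_gen (inl z : (Z + Y)%type))) =
  iota n (free_gen (inl z : (Z + Y)%type)).
Proof. by rewrite pX_gen free_liftE pX_gen. Qed.

Lemma pY_case n (P : nat -> Prop) : P 0%N -> (forall k : 'I_n, P k.+1) -> P n.+1 ->
  forall c, (c <= n.+1)%N -> P c.
Proof.
move=> P0 Pk Pn [|c] // cn; have [lcn|ncn] := ltnP c n.
  exact: (Pk (Ordinal lcn)).
by have -> : c = n by lia.
Qed.

Lemma cancelling_projY n y c : (c <= n.+1)%N -> cancelling_proj n (pY r n y c) = 1.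
Proof.
move: c; apply: pY_case => [|k|].
- by rewrite gmulf1.
- by rewrite pY_gen free_liftE.
- by rewrite pY_last pX_gen free_liftE.
Qed.

Lemma cancelling_contrY n c y c' : (c' <= n.+1)%N ->
  cancelling_contr n c (pY r n y c') = pY r n y (minn c c').
Proof.
move: c'; apply: pY_case => [|k|].
- by rewrite gmulf1 minn0.
- by rewrite pY_gen free_liftE.
- by rewrite pY_last pX_gen free_liftE.
Qed.

Lemma cut_face_min i c c' : cut_face i (minn c c') = minn (cut_face i c) (cut_face i c').
Proof.
rewrite /cut_face; have [cc|cc] := leqP c c';
  by case: (ltnP i c) => ?; case: (ltnP i c') => ?; lia.
Qed.

Lemma cut_degen_min i c c' : cut_degen i (minn c c') = minn (cut_degen i c) (cut_degen i c').
Proof.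
rewrite /cut_degen; have [cc|cc] := leqP c c';
  by case: (ltnP i c) => ?; case: (ltnP i c') => ?; lia.
Qed.

Lemma cancelling_retraction : retraction (free_sgroup r) (freegroup Z).
Proof.
apply: (@Retraction (free_sgroup r) (freegroup Z)
  cancelling_proj cancelling_incl cancelling_contr) => /=.
- move=> n i x ni; move: x; apply: (cancelling_ext
    (f := cancelling_proj n \o pface r n i)) => [z|y c cn] /=.
    by rewrite pface_X !cancelling_projZ.
  by rewrite pface_Y // !cancelling_projY // cut_face_le.
- move=> n i x ni; move: x; apply: (cancelling_ext
    (f := cancelling_proj n.+1 \o pdegen r n i)) => [z|y c cn] /=.
    by rewrite pdegen_X !cancelling_projZ.
  by rewrite pdegen_Y // !cancelling_projY // cut_degen_le.
- move=> n i a ni; move: a; apply: (free_ext (f := pface r n i \o cancelling_incl n.+1)).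
  by move=> z /=; rewrite !cancelling_inclE pface_X.
- move=> n i a ni; move: a; apply: (free_ext (f := pdegen r n i \o cancelling_incl n)).
  by move=> z /=; rewrite !cancelling_inclE pdegen_X.
- move=> n; apply: (free_ext (f := cancelling_proj n \o cancelling_incl n) (g := idfun)).
  by move=> z /=; rewrite cancelling_inclE cancelling_projZ.
- move=> n i c x ni cn; move: x; apply: (cancelling_ext
    (f := pface r n i \o cancelling_contr n.+1 c)
    (g := cancelling_contr n (cut_face i c) \o pface r n i)) => [z|y c' cn'] /=.
    by rewrite !(cancelling_contrZ, pface_X).
  rewrite cancelling_contrY // !pface_Y // ?cancelling_contrY ?cut_face_le ?cut_face_min //.
  by rewrite geq_min cn.
- move=> n i c x ni cn; move: x; apply: (cancelling_ext
    (f := pdegen r n i \o cancelling_contr n c)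
    (g := cancelling_contr n.+1 (cut_degen i c) \o pdegen r n i)) => [z|y c' cn'] /=.
    by rewrite !(cancelling_contrZ, pdegen_X).
  rewrite cancelling_contrY // !pdegen_Y // ?cancelling_contrY ?cut_degen_le ?cut_degen_min //.
  by rewrite geq_min cn.
- move=> n; apply: (cancelling_ext (f := cancelling_contr n n.+1) (g := idfun)).
    by move=> z; exact: cancelling_contrZ.
  by move=> y c cn /=; rewrite cancelling_contrY // (minn_idPr cn).
- move=> n; apply: (cancelling_ext (f := cancelling_contr n 0)
    (g := cancelling_incl n \o cancelling_proj n)) => [z|y c cn];
    rewrite -[RHS]/(cancelling_incl n (cancelling_proj n _)).
    by rewrite cancelling_contrZ cancelling_projZ cancelling_inclE.
  by rewrite cancelling_contrY // min0n cancelling_projY // gmulf1.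
Qed.

Variables (X : choiceType) (r1 : Y -> freegroup X).
Variable alpha : ghom (freegroup (Z + Y)%type) (freegroup X).
Hypothesis alphaY : forall y, alpha (free_gen (inr y)) = r1 y.

Lemma free_extend_pX n a :
  free_extend (Y * 'I_n)%type alpha (iota n a) = pX X Y n (alpha a).
Proof. exact: free_extend_inl. Qed.

Lemma free_extend_pY n y c : (c <= n.+1)%N ->
  free_extend (Y * 'I_n)%type alpha (pY r n y c) = pY r1 n y c.
Proof.
move: c; apply: pY_case => [|k|].
- by rewrite gmulf1.
- by rewrite !pY_gen; exact: free_extend_inr.
- by rewrite pY_last free_extend_pX alphaY -(@pY_top X Y r1 n y n.+1).
Qed.

(** The extensions of [alpha] commute with faces and degeneracies. They need not be invertible, but
    their completions are, so the retraction can be transported. *)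
Lemma nilpotent_equiv_retraction R : nilpotent_equiv alpha ->
  retraction (sgroup_completion R (free_sgroup r1)) (completion R (freegroup Z)).
Proof.
move=> ea.
pose e n : ghom (sg (sgroup_completion R (free_sgroup r)) n)
    (sg (sgroup_completion R (free_sgroup r1)) n) :=
  completion_map R (free_extend (Y * 'I_n)%type alpha).
apply: (retraction_transport (e := e)).
- by move=> n; apply: completion_map_bij; exact: nilpotent_equiv_extend.
- move=> n i x ni; apply: completion_map_square => {}x /=; move: x.
  apply: (cancelling_ext (f := free_extend (Y * 'I_n)%type alpha \o pface r n i)
    (g := pface r1 n i \o free_extend (Y * 'I_n.+1)%type alpha)) => [z|y c cn] /=.
    by rewrite pface_X !free_extend_pX pface_X.
  by rewrite pface_Y // !free_extend_pY ?cut_face_le // pface_Y.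
- move=> n i x ni; apply: completion_map_square => {}x /=; move: x.
  apply: (cancelling_ext (f := free_extend (Y * 'I_n.+1)%type alpha \o pdegen r n i)
    (g := pdegen r1 n i \o free_extend (Y * 'I_n)%type alpha)) => [z|y c cn] /=.
    by rewrite pdegen_X !free_extend_pX pdegen_X.
  by rewrite pdegen_Y // !free_extend_pY ?cut_degen_le // pdegen_Y.
- by apply: completion_retraction; exact: cancelling_retraction.
Qed.

End CancellingPairs.

(** * Unimodular completion of the relation matrix *)

Section LetterSumMorphism.
Variables (T : choiceType) (C : zmodType) (phi : T -> C).
Local Open Scope ring_scope.

Lemma letter_sum_fcons l w :
  letter_sum phi (fcons l w) = (if l.2 then phi l.1 else - phi l.1) + letter_sum phi w.
Proof.
case: w => [|l' w] /=; first by rewrite /letter_sum big_seq1 big_nil addr0.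
case: eqP => [->|_]; last by rewrite /letter_sum big_cons.
by rewrite [in RHS]/letter_sum big_cons /=; case: l.2; rewrite /= ?addrA ?subrr ?addNr add0r.
Qed.

Lemma letter_sumM (a b : freegroup T) :
  letter_sum phi (val (a * b)%g) = letter_sum phi (val a) + letter_sum phi (val b).
Proof.
rewrite /= /fmul; elim: (val a) => [|l u IH] /=.
  by rewrite [X in X + _]/letter_sum big_nil add0r.
by rewrite letter_sum_fcons IH addrA; congr (_ + _); rewrite [RHS]/letter_sum big_cons.
Qed.

Lemma letter_sum1 : letter_sum phi (val (1%g : freegroup T)) = 0.
Proof. by rewrite /letter_sum big_nil. Qed.

Lemma letter_sumV (a : freegroup T) : letter_sum phi (val a^-1%g) = - letter_sum phi (val a).
Proof. by apply/eqP; rewrite -addr_eq0 -letter_sumM mulVg letter_sum1. Qed.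

Lemma letter_sumX (a : freegroup T) n :
  letter_sum phi (val (a ^+ n)%g) = letter_sum phi (val a) *+ n.
Proof.
elim: n => [|n IH]; first by rewrite expg0 letter_sum1.
by rewrite expgS letter_sumM IH mulrS.
Qed.

Lemma letter_sum_gen x : letter_sum phi (val (free_gen x)) = phi x.
Proof. by rewrite /letter_sum big_seq1. Qed.

Lemma letter_sum_lift (S : choiceType) (g : S -> freegroup T) (w : freegroup S) :
  letter_sum phi (val (free_lift g w)) =
  letter_sum (fun x => letter_sum phi (val (g x))) (val w).
Proof.
rewrite -[free_lift g w]/(eval_word g (val w)); elim: (val w) => [|[x b] u IH].
  by rewrite [RHS]/letter_sum big_nil letter_sum1.
rewrite -[eval_word g _]/((eval_letter g (x, b) * eval_word g u)%g) letter_sumM IH.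
rewrite [RHS]/letter_sum big_cons; congr (_ + _).
by case: b => //=; rewrite /eval_letter /= letter_sumV.
Qed.

End LetterSumMorphism.

Lemma word_of_exponents (X : finType) (m : X -> int) :
  exists w : freegroup X, forall x, exponent_sum w x = m x.
Proof.
suff [w wE] : exists w : freegroup X, forall x,
    exponent_sum w x = if x \in enum X then m x else 0%R.
  by exists w => x; rewrite wE mem_enum.
elim: (enum X) (enum_uniq X) => [_|y s IH /= /andP[ys /IH[w wE]]].
  by exists 1 => x; rewrite /exponent_sum letter_sum1.
have [v vE] : exists v : freegroup X, forall x,
    exponent_sum v x = ((y == x)%:Z * m y)%R.
  case: (m y) => n.
    exists (free_gen y ^+ n) => x.
    by rewrite /exponent_sum letter_sumX letter_sum_gen -mulr_natr natz.
  exists (free_gen y ^+ n.+1)^-1 => x.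
  by rewrite /exponent_sum letter_sumV letter_sumX letter_sum_gen NegzE mulrN -mulr_natr natz.
exists (v * w) => x; rewrite /exponent_sum letter_sumM -!/(exponent_sum _ _) vE wE.
rewrite inE; have [<-|yx] := eqVneq y x; first by rewrite /= (negPf ys) mul1r addr0.
by rewrite mul0r add0r.
Qed.

Section UnimodularCompletion.
Local Open Scope ring_scope.

(** By the Smith form [A] is [row_mx P 0] times an invertible [R], and the right inverse [B] forces
    the square block [P] to be invertible. The last rows of [R] complete [A]. *)
Lemma unimodular_completion_mx k z (A : 'M[int]_(k, k + z)) (B : 'M[int]_(k + z, k)) :
  A *m B = 1%:M -> exists M : 'M[int]_(z, k + z), col_mx A M \in unitmx.
Proof.
move=> AB.
have [L uL [R uR [d _ AE]]] := int_Smith_normal_form A.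
set D := \matrix_(i, j) _ in AE.
have DE : D = row_mx (lsubmx D) 0.
  rewrite -[LHS]hsubmxK; congr row_mx; apply/matrixP => i j; rewrite !mxE /=.
  by case: eqP => // e; have := ltn_ord i; rewrite e -ltn_subRL subnn.
pose P := L *m lsubmx D.
have {}AE : A = row_mx P 0 *m R by rewrite AE DE mul_mx_row mulmx0.
have uP : P \in unitmx.
  have : P *m usubmx (R *m B) = 1%:M.
    by rewrite -AB AE -mulmxA -[R *m B in RHS]vsubmxK mul_row_col mul0mx addr0.
  by case/mulmx1_unit.
exists (row_mx 0 1%:M *m R).
have -> : col_mx A (row_mx 0 1%:M *m R) = block_mx P 0 0 1%:M *m R.
  by rewrite AE -mul_col_mx.
by rewrite unitmx_mul uR andbT unitmxE det_ublock det1 mulr1 -unitmxE.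
Qed.

Variables (X Y Z : finType) (rel : Y -> X -> int) (phi : X -> Y -> int).

Definition stack_rows (M : Z -> X -> int) (s : Z + Y) (x : X) : int :=
  match s with inl z => M z x | inr y => rel y x end.

Lemma unimodular_completion :
  #|Z| = (#|X| - #|Y|)%N ->
  (forall y y', \sum_x rel y x * phi x y' = (y == y')%:Z) ->
  exists (M : Z -> X -> int) (N : X -> Z + Y -> int),
    (forall s s', \sum_x stack_rows M s x * N x s' = (s == s')%:Z) /\
    (forall x x', \sum_s N x s * stack_rows M s x' = (x == x')%:Z).
Proof.
move=> cZ rphi.
(* This first pair of matrices yields |Y| <= |X|, so that the truncated subtraction in [cZ] is
   exact. *)
pose A0 : 'M[int]_(#|Y|, #|X|) := \matrix_(i, j) rel (enum_val i) (enum_val j).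
pose B0 : 'M[int]_(#|X|, #|Y|) := \matrix_(j, i) phi (enum_val j) (enum_val i).
have AB0 : A0 *m B0 = 1%:M.
  apply/matrixP => i i'; rewrite !mxE.
  transitivity (\sum_x rel (enum_val i) x * phi x (enum_val i')).
    rewrite (reindex (@enum_val _ X)); last first.
      by exists enum_rank => ? _; rewrite ?enum_valK ?enum_rankK.
    by apply: eq_bigr => j _; rewrite !mxE.
  by rewrite rphi (inj_eq enum_val_inj); case: eqP.
have cX : #|X| = (#|Y| + #|Z|)%N by rewrite cZ subnKC // (mulmx1_min AB0).
pose fX (x : X) : 'I_(#|Y| + #|Z|) := cast_ord cX (enum_rank x).
pose gX (j : 'I_(#|Y| + #|Z|)) : X := enum_val (cast_ord (esym cX) j).
have fXK : cancel fX gX by move=> x; rewrite /gX /fX cast_ordK enum_rankK.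
have gXK : cancel gX fX by move=> j; rewrite /gX /fX enum_valK cast_ordKV.
(* The relators form the upper block, so [Z], although the left summand, receives the last
   indices. *)
pose fS (s : Z + Y) : 'I_(#|Y| + #|Z|) := match s with
  | inl z => rshift #|Y| (enum_rank z) | inr y => lshift #|Z| (enum_rank y) end.
pose gS (i : 'I_(#|Y| + #|Z|)) : Z + Y := match fintype.split i with
  | inl i => inr (enum_val i) | inr i => inl (enum_val i) end.
have fSK : cancel fS gS.
  case=> [z|y]; rewrite /gS /fS.
    by rewrite -[rshift _ _]/(unsplit (inr (enum_rank z))) unsplitK enum_rankK.
  by rewrite -[lshift _ _]/(unsplit (inl (enum_rank y))) unsplitK enum_rankK.
have gSK : cancel gS fS.
  by move=> i; rewrite /gS -[RHS]splitK; case: (fintype.split i) => j /=; rewrite enum_valK.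
pose A : 'M[int]_(#|Y|, #|Y| + #|Z|) := \matrix_(i, j) rel (enum_val i) (gX j).
pose B : 'M[int]_(#|Y| + #|Z|, #|Y|) := \matrix_(j, i) phi (gX j) (enum_val i).
have AB : A *m B = 1%:M.
  apply/matrixP => i i'; rewrite !mxE.
  transitivity (\sum_x rel (enum_val i) x * phi x (enum_val i')).
    rewrite (reindex gX); last by exists fX => ? _; rewrite ?fXK ?gXK.
    by apply: eq_bigr => j _; rewrite !mxE.
  by rewrite rphi (inj_eq enum_val_inj); case: eqP.
have [M uM] := unimodular_completion_mx AB.
set Q := col_mx A M in uM.
pose M' z x := M (enum_rank z) (fX x).
have QE s x : stack_rows M' s x = Q (fS s) (fX x).
  case: s => [z|y] /=; first by rewrite /Q col_mxEd.
  by rewrite /Q col_mxEu mxE enum_rankK fXK.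
exists M', (fun x s => invmx Q (fX x) (fS s)); split=> [s s'|x x'].
- have := congr1 (fun V : 'M[int]_(#|Y| + #|Z|) => V (fS s) (fS s')) (mulmxV uM).
  rewrite !mxE (inj_eq (can_inj fSK)) (reindex fX); last first.
    by exists gX => ? _; rewrite ?fXK ?gXK.
  under eq_bigr => x _ do rewrite -QE.
  by move=> ->; case: eqP.
- have := congr1 (fun V : 'M[int]_(#|Y| + #|Z|) => V (fX x) (fX x')) (mulVmx uM).
  rewrite !mxE (inj_eq (can_inj fXK)) (reindex fS); last first.
    by exists gS => ? _; rewrite ?fSK ?gSK.
  under eq_bigr => s _ do rewrite -QE.
  by move=> ->; case: eqP.
Qed.

End UnimodularCompletion.

(** * Cochains on a contractible presentation complex *)

Local Open Scope ring_scope.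

(** Only [x] is confined to [K]. Stated for all small d, so that finitely many functions can share
    one d. *)
Lemma compact_unif_continuous (R : realType) (T : pseudoMetricType R)
    (K : set T) (f : T -> R) (e : R) : compact K -> continuous f -> 0 < e ->
  \forall d \near 0^'+, forall x y, K x -> ball x d y -> `|f x - f y| < e.
Proof.
move=> /compact_near_coveringP cK cf e0.
suff : \forall d \near 0^'+, K `<=` (fun x => forall y, ball x d y -> `|f x - f y| < e).
  by apply: filterS => d dP x y Kx; exact: dP.
apply: cK => x Kx.
have e20 : 0 < e / 2 by rewrite divr_gt0.
have /nbhs_ballP[d /= d0 dP] : nbhs x [set y | `|f x - f y| < e / 2].
  have /cvgrPdist_lt/(_ _ e20) := cf x.
  by apply: filterS.
have d20 : 0 < d / 2 by rewrite divr_gt0.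
near=> x' d'.
have d'd : d' <= d / 2 by near: d'; exact: nbhs_right_le.
move=> y x'y; have fx' : `|f x - f x'| < e / 2.
  apply: dP; apply: (@le_ball _ _ _ (d / 2)); first by lra.
  by near: x'; exact: nbhsx_ballx.
have fy : `|f x - f y| < e / 2.
  apply: dP; rewrite [d]splitr; apply: (@ball_triangle _ _ x').
    by near: x'; exact: nbhsx_ballx.
  exact: le_ball x'y.
rewrite -(subrK (f x) (f x')) -addrA (le_lt_trans (ler_normD _ _)) //.
by rewrite (distrC (f x')); lra.
Unshelve. all: by end_near. Qed.

(** * Continuous functions supported on one open 2-cell *)

Section CellFunction.
Variables (U : realType) (X Y : choiceType) (r : Y -> freegroup X) (y0 : Y).
Notation K := (pres_complex U r).

Definition cell_fun (F : U * U -> U) (p : K) : U :=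
  if p is Cell2 y u v then if y == y0 then F (val u, val v) else 0 else 0.

Lemma cell_fun_edge F x t : cell_fun F (edge Y x t) = 0.
Proof. by rewrite /edge; case: insubP. Qed.

Lemma cell_fun_walk F w t : cell_fun F (walk Y w t) = 0.
Proof.
elim: w t => //= -[x b] w IH t; case: ifP => _ //; exact: cell_fun_edge.
Qed.

Definition zero_off_square (F : U * U -> U) :=
  forall p, ~~ ((0 < p.1 < 1) && (0 < p.2 < 1)) -> F p = 0.

Lemma cell_fun_disc F y p : zero_off_square F ->
  cell_fun F (disc r y p) = if y == y0 then F p else 0.
Proof.
move=> F0; rewrite /disc; case: p => u v /=.
case: (leP v 0) => v0.
  by rewrite cell_fun_walk; case: ifP => // _; rewrite F0 //= [0 < v]ltNge v0 andbF.
case: insubP => [u' u'01 u'E|u'01]; last first.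
  by case: ifP => // _; rewrite F0 //= (negPf u'01).
case: insubP => [v' v'01 v'E|v'01]; last first.
  by case: ifP => // _; rewrite F0 //= (negPf v'01) andbF.
by rewrite /= u'E v'E.
Qed.

(** In the weak topology continuity is tested on characteristic maps: the composite with an edge is
    0, and with a disc it is [F] or 0. *)
Lemma cell_fun_continuous F : zero_off_square F -> continuous F ->
  continuous (cell_fun F : K -> U).
Proof.
move=> F0 cF; apply/(@continuousP K U (cell_fun F)) => A oA; split=> [x|y].
- have -> : edge Y x @^-1` (cell_fun F @^-1` A) = (fun=> 0) @^-1` A.
    by apply/seteqP; split=> t /=; rewrite cell_fun_edge.
  have /continuousP c0 : continuous (fun _ : U => 0 : U) by exact: cst_continuous.
  exact: c0.
- have -> : disc r y @^-1` (cell_fun F @^-1` A) =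
      (fun p => if y == y0 then F p else 0) @^-1` A.
    by apply/seteqP; split=> t /=; rewrite cell_fun_disc.
  have /continuousP cFy : continuous (fun p => if y == y0 then F p else 0).
    by case: (y == y0) => //; exact: cst_continuous.
  exact: cFy.
Qed.

Lemma disc_continuous y : continuous (disc r y : U * U -> K).
Proof. by apply/(@continuousP _ K (disc r y)) => A [_]; exact. Qed.

Lemma walk0 w : walk Y w 0 = Cell0 U X Y.
Proof.
case: w => //= -[x b] w; rewrite ler01 /edge.
by case: b; case: insubP => // u; rewrite ?subr0 ltxx ?andbF.
Qed.

Lemma walk_size w : walk Y w (size w)%:R = Cell0 U X Y.
Proof.
elim: w => //= -[x b] w IH; case: ifP => [w1|_]; last first.
  by rewrite -natr1 addrK.
have -> : (size w).+1%:R = 1 :> U.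
  by apply/eqP; rewrite eq_le w1 ler1n.
rewrite /edge.
by case: b; case: insubP => // u; rewrite ?subrr ltxx ?andbF.
Qed.

End CellFunction.

Section Bump.
Variable U : realType.

(** The distance to the complement of the open unit square in the maximum norm. *)
Definition depth (p : U * U) : U :=
  Num.max 0 (Num.min (Num.min p.1 (1 - p.1)) (Num.min p.2 (1 - p.2))).

Lemma depth_continuous : continuous depth.
Proof.
have c1 : continuous (fun p : U * U => p.1) by move=> x; exact: cvg_fst.
have c2 : continuous (fun p : U * U => p.2) by move=> x; exact: cvg_snd.
have cN (f : U * U -> U) : continuous f -> continuous (fun p : U * U => 1 - f p).
  by move=> cf p; apply: cvgB; [exact: cvg_cst | exact: cf].
move=> p; apply: (@continuous_max U _ (fun=> 0) (fun p : U * U =>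
  Num.min (Num.min p.1 (1 - p.1)) (Num.min p.2 (1 - p.2)))); first exact: cst_continuous.
apply: (@continuous_min U _ (fun p : U * U => Num.min p.1 (1 - p.1))
                            (fun p : U * U => Num.min p.2 (1 - p.2))).
  by apply: (@continuous_min U _ fst (fun p : U * U => 1 - p.1)); [exact: c1 | exact: cN].
by apply: (@continuous_min U _ snd (fun p : U * U => 1 - p.2)); [exact: c2 | exact: cN].
Qed.

Definition shift1 (p : U * U) : U := depth p * (p.1 - 2^-1).
Definition shift2 (p : U * U) : U := depth p * (p.2 - 2^-1).

Lemma shift1_continuous : continuous shift1.
Proof.
move=> p; apply: (@continuousM U _ depth (fun p => p.1 - 2^-1)); first exact: depth_continuous.
by apply: cvgB; [exact: cvg_fst | exact: cvg_cst].
Qed.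

Lemma shift2_continuous : continuous shift2.
Proof.
move=> p; apply: (@continuousM U _ depth (fun p => p.2 - 2^-1)); first exact: depth_continuous.
by apply: cvgB; [exact: cvg_snd | exact: cvg_cst].
Qed.

Lemma depth_off : zero_off_square depth.
Proof.
move=> [u v] /= H; apply/max_idPl; rewrite leNgt !lt_min.
by apply: contra H => /andP[/andP[-> a] /andP[-> b]]; rewrite -subr_gt0 a -subr_gt0.
Qed.

Lemma shift1_off : zero_off_square shift1.
Proof. by move=> p /depth_off; rewrite /shift1 => ->; rewrite mul0r. Qed.
Lemma shift2_off : zero_off_square shift2.
Proof. by move=> p /depth_off; rewrite /shift2 => ->; rewrite mul0r. Qed.

End Bump.

(** * Combinatorial degree of small squares *)

Section DegreeCocycle.
Variable U : realType.
Implicit Types p q s t : U * U * U.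

(* A point of the complex is recorded by (m, g1, g2), where m is its depth inside
   the 2-cell y0 and (g1, g2) its position relative to the center, scaled by m.
   [crossing] counts the crossings of the half-line g1 > 0, g2 = 0.  Its sum
   around a small square is the degree of the square over the center, except
   for the squares near the boundary of the cell, where [crossing] itself jumps
   without any degree; those are the shallow ones. *)
Definition crossing p q : int :=
  if (0 < p.1.2) && (0 < q.1.2) then (0 <= q.2)%R%:Z - (0 <= p.2)%R%:Z else 0.

Definition shallow p := p.1.1 < 3 / 8.

Definition square_degree p q s t : int :=
  if [&& shallow p, shallow q, shallow s & shallow t] then 0
  else crossing p q + crossing q s + crossing s t + crossing t p.

(** Keeps (g1, g2) away from the origin just below the threshold of [shallow]; 1/32 is twice the
    tolerance of [coords_close]. *)
Definition off_axis p := 1 / 4 < p.1.1 < 3 / 8 ->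
  1 / 32 <= `|p.1.2| \/ 1 / 32 <= `|p.2|.

Definition coords_close p q := [/\ `|p.1.1 - q.1.1| < 1 / 64,
  `|p.1.2 - q.1.2| < 1 / 64 & `|p.2 - q.2| < 1 / 64].

Lemma crossingC p q : crossing q p = - crossing p q.
Proof. by rewrite /crossing andbC; case: ifP; rewrite ?oppr0 ?opprB. Qed.

Lemma crossing_id p : crossing p p = 0.
Proof. by rewrite /crossing subrr if_same. Qed.

Lemma square_degree_flip p q s t :
  square_degree q p t s = - square_degree p q s t.
Proof.
rewrite /square_degree (crossingC p q) (crossingC t p) (crossingC s t) (crossingC q s).
have -> : [&& shallow q, shallow p, shallow t & shallow s] =
          [&& shallow p, shallow q, shallow s & shallow t].
  by case: (shallow p); case: (shallow q); case: (shallow s); case: (shallow t).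
by case: ifP => _; lia.
Qed.

Lemma square_degree_collapse p q : square_degree p p q q = 0.
Proof.
rewrite /square_degree !crossing_id (crossingC p q).
by case: ifP => // _; lia.
Qed.

(** If g1 is large at [p] it is positive at the neighbour [s], which is excluded; if g2 is large at
    [p] it has the same sign at [q]. *)
Lemma crossing_off_axis p q s : coords_close p q -> coords_close s p -> off_axis p ->
  1 / 4 < p.1.1 -> shallow p -> s.1.2 <= 0 -> crossing p q = 0.
Proof.
move=> [_ _ pq] [_ sp _] op p1 p2 s0; rewrite /crossing.
case: ifP => // /andP[p0 q0].
have [|g1|g2] := op; first by rewrite p1.
- exfalso; move: sp; rewrite ltr_norml => /andP[]; move: g1; rewrite gtr0_norm //; lra.
suff -> : (0 <= q.2) = (0 <= p.2) by rewrite subrr.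
move: pq; rewrite ltr_norml => /andP[a b].
case: (lerP 0 p.2) g2 => [p20|p20]; [rewrite ger0_norm // | rewrite ltr0_norm //] => g2.
  by apply/idP; lra.
by apply/negbTE; rewrite -ltNge; lra.
Qed.

(** Above depth 1/4 the cut-off for shallow squares changes nothing: if some vertex has g1 <= 0 all
    crossings vanish, otherwise they are differences of one function and telescope around the
    square. *)
Lemma square_degree_deep p q s t :
  (forall a b, a \in [:: p; q; s; t] -> b \in [:: p; q; s; t] -> coords_close a b) ->
  (forall a, a \in [:: p; q; s; t] -> off_axis a /\ 1 / 4 < a.1.1) ->
  square_degree p q s t = crossing p q + crossing q s + crossing s t + crossing t p.
Proof.
move=> C O; rewrite /square_degree; case: ifP => // /and4P[lp lq ls lt].
have [ip iq is_ it] : [/\ p \in [:: p; q; s; t], q \in [:: p; q; s; t],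
    s \in [:: p; q; s; t] & t \in [:: p; q; s; t]].
  by rewrite !inE !eqxx !orbT.
have [[Op p1] [Oq q1] [Os s1] [Ot t1]] := And4 (O _ ip) (O _ iq) (O _ is_) (O _ it).
have K a : a \in [:: p; q; s; t] -> a.1.2 <= 0 ->
    0 = crossing p q + crossing q s + crossing s t + crossing t p.
  move=> ia a0.
  by rewrite !(@crossing_off_axis _ _ a) ?addr0 //; apply: C.
have [p0|p0] := lerP p.1.2 0; first exact: K p0.
have [q0|q0] := lerP q.1.2 0; first exact: K q0.
have [s0|s0] := lerP s.1.2 0; first exact: K s0.
have [t0|t0] := lerP t.1.2 0; first exact: K t0.
by rewrite /crossing p0 q0 s0 t0 /=; ring.
Qed.

(** Either all vertices are shallow and all degrees are 0, or one has depth at least 3/8, hence all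
    have depth above 1/4. Then each of the twelve edges occurs in two faces with opposite signs. *)
Lemma cube_degree (c : bool -> bool -> bool -> U * U * U) :
  (forall i j k i' j' k', coords_close (c i j k) (c i' j' k')) ->
  (forall i j k, off_axis (c i j k)) ->
  let xy k := square_degree (c false false k) (c true false k) (c true true k) (c false true k) in
  let xz j := square_degree (c false j false) (c true j false) (c true j true) (c false j true) in
  let yz i := square_degree (c i false false) (c i true false) (c i true true) (c i false true) in
  (xy true - xy false) - (xz true - xz false) + (yz true - yz false) = 0.
Proof.
move=> C O /=.
have [A|] := boolP [forall i, forall j, forall k, shallow (c i j k)].
  have {}A i j k : shallow (c i j k) by move: A => /forallP/(_ i)/forallP/(_ j)/forallP/(_ k).
  by rewrite /square_degree !A.
case/forallPn => i0 /forallPn[j0] /forallPn[k0]; rewrite /shallow -leNgt => D.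
have E i j k : 1 / 4 < (c i j k).1.1.
  by have [+ _ _] := C i j k i0 j0 k0; rewrite ltr_norml; lra.
pose P p := exists i j k, p = c i j k.
have Pc i j k : P (c i j k) by exists i, j, k.
have S p q s t : P p -> P q -> P s -> P t ->
    square_degree p q s t = crossing p q + crossing q s + crossing s t + crossing t p.
  move=> Pp Pq Ps Pt.
  have H a : a \in [:: p; q; s; t] -> P a by rewrite !inE => /or4P[] /eqP ->.
  apply: square_degree_deep => [a b /H[i [j [k ->]]] /H[i' [j' [k' ->]]]|a /H[i [j [k ->]]]].
    exact: C.
  by split; [exact: O | exact: E].
rewrite !S //.
do 12!match goal with |- context [crossing (c ?i ?j ?k) (c ?i' ?j' ?k')] =>
  let x := fresh "x" in
  rewrite ?(crossingC (c i j k) (c i' j' k'));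
  generalize (crossing (c i j k) (c i' j' k')) => x end.
ring.
Qed.

(* Stokes' formula: the terms are the three pairs of opposite faces of the box. *)
Lemma grid_degree (V : nat -> nat -> nat -> U * U * U) (I J M : nat) :
  (forall i j k (a b c a' b' c' : bool), (i < I)%N -> (j < J)%N -> (k < M)%N ->
    coords_close (V (i + a) (j + b) (k + c))%N (V (i + a') (j + b') (k + c'))%N) ->
  (forall i j k, off_axis (V i j k)) ->
  let xy i j k := square_degree (V i j k) (V i.+1 j k) (V i.+1 j.+1 k) (V i j.+1 k) in
  let xz i j k := square_degree (V i j k) (V i.+1 j k) (V i.+1 j k.+1) (V i j k.+1) in
  let yz i j k := square_degree (V i j k) (V i j.+1 k) (V i j.+1 k.+1) (V i j k.+1) in
  \sum_(0 <= i < I) \sum_(0 <= j < J) (xy i j M - xy i j 0) -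
  \sum_(0 <= i < I) \sum_(0 <= k < M) (xz i J k - xz i 0 k) +
  \sum_(0 <= j < J) \sum_(0 <= k < M) (yz I j k - yz 0 j k) = 0.
Proof.
move=> C O xy xz yz.
have E i j k : (i < I)%N -> (j < J)%N -> (k < M)%N ->
    (xy i j k.+1 - xy i j k) - (xz i j.+1 k - xz i j k) + (yz i.+1 j k - yz i j k) = 0.
  move=> iI jJ kM.
  have := @cube_degree (fun a b c => V (i + a) (j + b) (k + c))%N.
  rewrite /= !addn1 !addn0; apply=> [*|*]; [exact: C | exact: O].
have T (f : nat -> int) n : f n - f 0 = \sum_(0 <= i < n) (f i.+1 - f i).
  by rewrite telescope_sumr.
transitivity (\sum_(0 <= i < I) \sum_(0 <= j < J) \sum_(0 <= k < M)
   ((xy i j k.+1 - xy i j k) - (xz i j.+1 k - xz i j k) + (yz i.+1 j k - yz i j k))).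
  have -> : \sum_(0 <= i < I) \sum_(0 <= j < J) (xy i j M - xy i j 0) =
      \sum_(0 <= i < I) \sum_(0 <= j < J) \sum_(0 <= k < M) (xy i j k.+1 - xy i j k).
    by apply: eq_bigr => i _; apply: eq_bigr => j _; exact: T.
  have -> : \sum_(0 <= i < I) \sum_(0 <= k < M) (xz i J k - xz i 0 k) =
      \sum_(0 <= i < I) \sum_(0 <= j < J) \sum_(0 <= k < M) (xz i j.+1 k - xz i j k).
    apply: eq_bigr => i _; rewrite [RHS]exchange_big /=.
    by apply: eq_bigr => k _; exact: (T (fun j => xz i j k)).
  have -> : \sum_(0 <= j < J) \sum_(0 <= k < M) (yz I j k - yz 0 j k) =
      \sum_(0 <= i < I) \sum_(0 <= j < J) \sum_(0 <= k < M) (yz i.+1 j k - yz i j k).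
    rewrite [RHS]exchange_big /=; apply: eq_bigr => j _; rewrite [RHS]exchange_big /=.
    by apply: eq_bigr => k _; exact: (T (fun i => yz i j k)).
  rewrite -sumrB -big_split /=; apply: eq_bigr => i _.
  rewrite -sumrB -big_split /=; apply: eq_bigr => j _.
  by rewrite -sumrB -big_split.
rewrite big_nat big1 // => i /= iI.
rewrite big_nat big1 // => j /= jJ.
by rewrite big_nat big1 // => k /= kM; exact: E.
Qed.

Lemma middle_near (a b : U) : 3 / 8 <= a -> a <= 5 / 8 -> `|a - b| < 1 / 64 ->
  (1 / 4 < a < 3 / 4) /\ (1 / 4 < b < 3 / 4).
Proof. by rewrite ltr_norml; split; apply/andP; split; lra. Qed.

Lemma half_near (a b : U) : ~~ ((3 / 8 <= a) && (a <= 5 / 8)) ->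
  `|a - b| < 1 / 64 -> (1 / 2 <= b) = (1 / 2 <= a).
Proof.
rewrite negb_and -!ltNge ltr_norml => /orP[] ? ?; apply/idP/idP; lra.
Qed.

Lemma straddle_near (a b : U) : `|a - b| < 1 / 64 ->
  (1 / 2 < a) != (1 / 2 < b) -> (3 / 8 <= a) && (a <= 5 / 8).
Proof.
rewrite ltr_norml; case: (ltP (1 / 2) a) => ?; case: (ltP (1 / 2) b) => // ? ? _;
  apply/andP; split; lra.
Qed.

Definition bump_coords (p : U * U) : U * U * U := (depth p, shift1 p, shift2 p).

Lemma shallow_bump a b : 0 <= a <= 1 -> 0 <= b <= 1 ->
  shallow (bump_coords (a, b)) =
  ~~ [&& 3 / 8 <= a, a <= 5 / 8, 3 / 8 <= b & b <= 5 / 8].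
Proof.
move=> a01 b01; rewrite /shallow /depth /= ltNge le_max !le_min.
have -> : (3 / 8 <= 0 :> U) = false by apply/negbTE; rewrite -ltNge; lra.
have -> : (3 / 8 <= 1 - a) = (a <= 5 / 8) by apply/idP/idP; lra.
have -> : (3 / 8 <= 1 - b) = (b <= 5 / 8) by apply/idP/idP; lra.
by rewrite /= -!andbA.
Qed.

Lemma depth_gt0 (a b : U) : 0 < a < 1 -> 0 < b < 1 -> 0 < depth (a, b).
Proof.
move=> /andP[a0 a1] /andP[b0 b1].
by rewrite /depth /= lt_max !lt_min a0 b0 !subr_gt0 a1 b1 orbT.
Qed.

Lemma sign_bump a b : 1 / 4 < a < 3 / 4 -> 1 / 4 < b < 3 / 4 ->
  (0 < (bump_coords (a, b)).1.2) = (1 / 2 < a) /\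
  (0 <= (bump_coords (a, b)).2) = (1 / 2 <= b).
Proof.
move=> ha hb; have d0 : 0 < depth (a, b).
  by apply: depth_gt0; apply/andP; split; lra.
rewrite /shift1 /shift2 /=; split; first by rewrite pmulr_rgt0 // subr_gt0 div1r.
by rewrite pmulr_rge0 // subr_ge0 div1r.
Qed.

(* Summed over a grid of the square, the right-hand side telescopes to 1. *)
Lemma square_degree_bump (u v u' v' : U) :
  0 <= u <= 1 -> 0 <= u' <= 1 -> 0 <= v <= 1 -> 0 <= v' <= 1 ->
  `|u - u'| < 1 / 64 -> `|v - v'| < 1 / 64 ->
  square_degree (bump_coords (u, v)) (bump_coords (u', v))
    (bump_coords (u', v')) (bump_coords (u, v')) =
  ((1 / 2 < u')%R%:Z - (1 / 2 < u)%R%:Z) * ((1 / 2 <= v')%R%:Z - (1 / 2 <= v)%R%:Z).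
Proof.
move=> u01 u'01 v01 v'01 uu vv.
have [u'u v'v] : `|u' - u| < 1 / 64 /\ `|v' - v| < 1 / 64.
  by rewrite (distrC u') (distrC v').
rewrite /square_degree; case: ifP => [/and4P[+ _ _ _]|/negbT].
  rewrite shallow_bump // => d1.
  (* If 1/2 separates u from u', then u lies in the middle interval; (u, v) being shallow, v does
     not, so 1/2 does not separate v from v'. *)
  have [->|st] := eqVneq (1 / 2 < u) (1 / 2 < u'); first by rewrite subrr mul0r.
  have um := straddle_near uu st.
  rewrite (half_near (a := v) (b := v')) ?subrr ?mulr0 //.
  by move: um d1 => /andP[-> ->].
rewrite !negb_and !shallow_bump // !negbK => H.
(* One vertex in the middle square keeps all four where [depth] is positive, so signs of shifts
   compare coordinates with 1/2. *)
have [hu hu' hv hv'] : [/\ 1 / 4 < u < 3 / 4, 1 / 4 < u' < 3 / 4,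
    1 / 4 < v < 3 / 4 & 1 / 4 < v' < 3 / 4].
  by case/or4P: H => /and4P[a1 a2 b1 b2];
    [have [] := middle_near a1 a2 uu; have [] := middle_near b1 b2 vv
    |have [] := middle_near a1 a2 u'u; have [] := middle_near b1 b2 vv
    |have [] := middle_near a1 a2 u'u; have [] := middle_near b1 b2 v'v
    |have [] := middle_near a1 a2 uu; have [] := middle_near b1 b2 v'v].
have [a1 b1] := sign_bump hu hv; have [a2 b2] := sign_bump hu' hv.
have [a3 b3] := sign_bump hu' hv'; have [a4 b4] := sign_bump hu hv'.
rewrite /crossing a1 a2 a3 a4 b1 b2 b3 b4.
by case: (1 / 2 < u); case: (1 / 2 < u'); rewrite /= ?subrr ?mul1r ?mul0r; ring.
Qed.

End DegreeCocycle.

(** Depth below 3/8 puts one coordinate at least 1/8 away from 1/2; scaling by a depth above 1/4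
    leaves 1/32. *)
Lemma off_axis_bump (U : realType) (p : U * U) : off_axis (bump_coords p).
Proof.
case: p => u v; rewrite /off_axis /shift1 /shift2 /= => /andP[d1 d2].
have d0 : 0 < depth (u, v) by lra.
rewrite !normrM !(gtr0_norm d0).
have far (a : U) : a < 3 / 8 \/ 1 - a < 3 / 8 -> 1 / 32 <= depth (u, v) * `|a - 2^-1|.
  move=> H; have : 1 / 8 <= `|a - 2^-1|.
    by rewrite ler_normr; apply/orP; case: H => ?; [right|left]; lra.
  by move=> H'; have := ler_pM _ _ (ltW d1) H'; lra.
move: d2; rewrite {1}/depth /= gt_max !gt_min => /andP[_ /orP[]/orP[] H];
  [left|left|right|right]; apply: far; by [left|right].
Qed.

(** Serves to extend the contraction, continuous over [0, 1] only, to all times. *)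
Lemma within_continuous_comp (S T V : topologicalType) (A : set T) (g : S -> T)
    (h : T -> V) : {within A, continuous h} -> continuous g ->
  (forall x, A (g x)) -> continuous (h \o g).
Proof.
move=> ch cg gA x W /= Wx.
have hW : within A (nbhs (g x)) (h @^-1` W).
  by rewrite nbhs_subspace_in //; exact: (ch (g x) W Wx).
have : nbhs x (g @^-1` (fun z => A z -> (h @^-1` W) z)) by exact: cg x _ hW.
by apply: filterS => z /= Hz; exact: Hz (gA z).
Qed.

(** * Degrees of the tracks of a homotopy, and Stokes' formula on a 2-cell *)

Section ContractibleCochain.
Variables (U : realType) (X Y : choiceType) (r : Y -> freegroup X).
Notation K := (pres_complex U r).

Section Grid.
Variables (y0 : Y) (H : K * U -> K) (n : nat).
Notation N := n.+1.
Hypothesis H0 : forall p, H (p, 0) = p.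
Hypothesis H1 : exists p0, forall p, H (p, 1) = p0.

Definition cell_coords (p : K) : U * U * U :=
  (cell_fun y0 (@depth U) p, cell_fun y0 (@shift1 U) p, cell_fun y0 (@shift2 U) p).

Lemma off_axis_coords p : off_axis (cell_coords p).
Proof.
have z : off_axis (0 : U, 0 : U, 0 : U) by rewrite /off_axis /= => /andP[]; lra.
rewrite /cell_coords; case: p => // y u v /=; case: ifP => // _.
exact: off_axis_bump.
Qed.

Definition slice (p : K) (k : nat) : U * U * U :=
  cell_coords (H (p, k%:R / N%:R)).

Definition strip_degree (p q : K) : int :=
  \sum_(0 <= k < N) square_degree (slice p k) (slice q k) (slice q k.+1) (slice p k.+1).

Lemma strip_degreeC p q : strip_degree q p = - strip_degree p q.
Proof. by rewrite -sumrN; apply: eq_bigr => k _; exact: square_degree_flip. Qed.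

(** The cochain sought: the degree over the cell [y0] of the surface swept by the edge [x] during
    the homotopy. *)
Definition edge_degree (x : X) : int :=
  \sum_(0 <= i < N) strip_degree (edge Y x (i%:R / N%:R)) (edge Y x (i.+1%:R / N%:R)).

(** Each letter takes exactly N steps of the grid. An inverse letter runs along its edge backwards,
    which reverses the sign of every strip. *)
Lemma walk_degree w :
  \sum_(0 <= i < N * size w)
    strip_degree (walk Y w (i%:R / N%:R)) (walk Y w (i.+1%:R / N%:R)) =
  letter_sum edge_degree w.
Proof.
have Nn0 : N%:R != 0 :> U by rewrite pnatr_eq0.
rewrite /letter_sum; elim: w => [|[x b] w IH].
  by rewrite [RHS]big_nil [size _]/= muln0 big_geq.
rewrite [RHS]big_cons [size _]/= mulnS (@big_cat_nat _ _ _ N) ?leq_addr //; congr (_ + _).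
  have step (i : nat) : (i <= N)%N -> walk Y ((x, b) :: w) (i%:R / N%:R : U) =
      edge Y x (if b then i%:R / N%:R else 1 - i%:R / N%:R).
    by move=> iN; rewrite /= ler_pdivrMr ?ltr0n // mul1r ler_nat iN.
  rewrite big_nat (eq_bigr (fun i => strip_degree
      (edge Y x (if b then i%:R / N%:R else 1 - i%:R / N%:R))
      (edge Y x (if b then i.+1%:R / N%:R else 1 - i.+1%:R / N%:R)))); last first.
    move=> i /andP[_ iN]; have iN' := ltnW iN.
    by rewrite -(step _ iN) -(step _ iN').
  rewrite -big_nat; case: b {step} => //.
  rewrite big_nat_rev /= add0n /edge_degree -sumrN big_nat [RHS]big_nat.
  apply: eq_bigr => i iN; rewrite -strip_degreeC.
  have e (j : nat) : (j <= N)%N -> 1 - (N - j)%:R / N%:R = j%:R / N%:R :> U.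
    by move=> jN; rewrite natrB // mulrBl divff // subKr.
  by rewrite subnSK // !e // ltnW.
have step (i : nat) : walk Y ((x, b) :: w) ((i + N)%:R / N%:R : U) = walk Y w (i%:R / N%:R).
  (* At i = 0 [walk] still reads the first letter; its end and the start of the next letter are both
     the 0-cell. *)
  rewrite natrD mulrDl divff // [LHS]/=; case: ifP => [|_]; last by rewrite addrK.
  rewrite gerDr => i0.
  have {i0} -> : i%:R / N%:R = 0 :> U.
    by apply/eqP; rewrite eq_le i0 divr_ge0.
  rewrite [RHS]walk0 add0r /edge.
  by case: b; case: insubP => // u; rewrite ?subrr ltxx ?andbF.
rewrite -IH -{1}[N]add0n [(N + _)%N]addnC big_addn addnK.
by apply: eq_bigr => i _; rewrite -addSn !step.
Qed.

Section Disc.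
Variable y : Y.
Let w := val (r y).
(* The maximum only matters for the empty word, whose walk is constant. *)
Let I := (N * maxn (size w) 1)%N.

Let vertex (i j k : nat) : U * U * U :=
  cell_coords (H (disc r y (i%:R / I%:R, j%:R / N%:R), k%:R / N%:R)).

Hypothesis closeV : forall i j k (a b c a' b' c' : bool),
  (i < I)%N -> (j < N)%N -> (k < N)%N ->
  coords_close (vertex (i + a) (j + b) (k + c)) (vertex (i + a') (j + b') (k + c')).
Hypothesis n_large : 1 / N%:R < 1 / 64 :> U.

(** [grid_degree] on the disc times [0, 1]: the bottom counts the cell itself, the top is constant,
    the side v = 0 sweeps the relator, and the other sides follow the track of the 0-cell and
    contribute nothing. *)
Lemma disc_degree : letter_sum edge_degree w = (y == y0)%:Z.
Proof.
have I0 : (0 < I)%N by rewrite muln_gt0 leq_maxr.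
have In0 : I%:R != 0 :> U by rewrite pnatr_eq0 -lt0n.
have Nn0 : N%:R != 0 :> U by rewrite pnatr_eq0.
have E (u v : U) : [|| u == 0, u == 1 | v == 1] -> 0 <= v ->
    disc r y (u, v) = Cell0 U X Y.
  move=> uv v0; rewrite /disc /=; case: ifP => vle.
    have {}v0 : v = 0 by apply/eqP; rewrite eq_le vle.
    move: uv; rewrite v0 [0 == 1]eq_sym oner_eq0 orbF => /orP[] /eqP ->.
      by rewrite mulr0 walk0.
    by rewrite mulr1 walk_size.
  case: insubP => // u' /andP[u0 u1] _; case: insubP => // v' /andP[_ v1] _.
  by case/or3P: uv => /eqP e; move: u0 u1 v1; rewrite e ltxx.
have := grid_degree closeV (fun i j k => @off_axis_coords _); cbv zeta.
rewrite [X in X - _ + _](_ : _ = - (y == y0)%:Z); last first.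
  have [p0 H1'] := H1.
  have bot i j : vertex i j 0 = cell_coords (disc r y (i%:R / I%:R, j%:R / N%:R)).
    by rewrite /vertex mul0r H0.
  have top i j : vertex i j N = cell_coords p0.
    by rewrite /vertex divff // H1'.
  under eq_bigr => i _ do under eq_bigr => j _ do
    rewrite !top square_degree_collapse sub0r !bot.
  have [->|yy0] := eqVneq y y0; last first.
    rewrite big1 // => i _; rewrite big1 // => j _.
    have z p : cell_coords (disc r y p) = (0, 0, 0).
      rewrite /cell_coords !cell_fun_disc ?(negPf yy0) //;
      by [exact: depth_off | exact: shift1_off | exact: shift2_off].
    by rewrite !z square_degree_collapse.
  have z p : cell_coords (disc r y0 p) = bump_coords p.
    rewrite /cell_coords !cell_fun_disc ?eqxx //;
    by [exact: depth_off | exact: shift1_off | exact: shift2_off].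
  pose A (i : nat) : int := (1 / 2 < i%:R / I%:R :> U)%R%:Z.
  pose B (j : nat) : int := (1 / 2 <= j%:R / N%:R :> U)%R%:Z.
  have unit01 (m l : nat) : (0 < l)%N -> (m <= l)%N -> 0 <= (m%:R / l%:R : U) <= 1.
    by move=> l0 ml; rewrite divr_ge0 //= ler_pdivrMr ?ltr0n // mul1r ler_nat.
  have IN : 1 / I%:R <= 1 / N%:R :> U.
    by rewrite !div1r lef_pV2 ?posrE ?ltr0n // ler_nat leq_pmulr // leq_maxr.
  have step (m l : nat) : (0 < l)%N -> 1 / l%:R < 1 / 64 :> U ->
      `|m%:R / l%:R - m.+1%:R / l%:R| < 1 / 64 :> U.
    move=> l0 l64; rewrite -mulrBl -natr1 opprD addrA subrr add0r mulNr normrN.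
    by rewrite ger0_norm // divr_ge0.
  rewrite (eq_big_nat _ _ (F2 := fun i => - (A i.+1 - A i) * (B N - B 0%N))); last first.
    move=> i /= iI.
    rewrite -(@telescope_sumr _ 0 N B) // mulr_sumr big_nat [RHS]big_nat.
    apply: eq_bigr => j jN; rewrite !z square_degree_bump ?mulNr //;
      do ?[by apply: unit01 => //; exact: ltnW | exact: unit01];
      apply: step => //; exact: le_lt_trans IN n_large.
  (* Each indicator of the half-line beyond 1/2 passes from 0 to 1, so the product of the telescoped
     differences is 1. *)
  rewrite -mulr_suml sumrN telescope_sumr // /A /B !divff // !mul0r.
  have -> : (1 / 2 < 1 :> U) by lra.
  have -> : (1 / 2 <= 1 :> U) by lra.
  have -> : (1 / 2 < 0 :> U) = false by apply/negbTE; rewrite -leNgt; lra.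
  have -> : (1 / 2 <= 0 :> U) = false by apply/negbTE; rewrite -ltNge; lra.
  by rewrite mulN1r.
rewrite [X in _ - X + _](_ : _ = - letter_sum edge_degree w); last first.
  have far i k : vertex i N k = slice (Cell0 U X Y) k.
    by rewrite /vertex divff // E ?eqxx ?orbT.
  have near i k : vertex i 0 k = slice (walk Y w (i%:R / N%:R)) k.
    rewrite /vertex /slice mul0r /disc /= lexx -/w; congr (cell_coords (H (_, _))).
    have [->|w0] := eqVneq w [::]; first by [].
    rewrite /I (maxn_idPl _) ?lt0n ?size_eq0 //.
    by rewrite natrM invfM mulrC mulrA divfK // pnatr_eq0 size_eq0.
  under eq_bigr => i _ do under eq_bigr => k _ do
    rewrite !far square_degree_collapse sub0r !near.
  under eq_bigr => i _ do rewrite sumrN.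
  rewrite sumrN; congr (- _).
  have [w0|w0] := eqVneq w [::].
    rewrite w0 /letter_sum big_nil big1 // => i _; rewrite big1 // => k _.
    by rewrite /= square_degree_collapse.
  rewrite -walk_degree /I (maxn_idPl _) ?lt0n ?size_eq0 //.
rewrite [X in _ + X](_ : _ = 0); last first.
  have left_ j k : vertex 0 j k = slice (Cell0 U X Y) k.
    by rewrite /vertex mul0r E ?eqxx ?orbT // divr_ge0.
  have right_ j k : vertex I j k = slice (Cell0 U X Y) k.
    by rewrite /vertex divff // E ?eqxx ?orbT // divr_ge0.
  rewrite big1 // => j _; rewrite big1 // => k _.
  by rewrite !left_ !right_ subrr.
by rewrite addr0 opprK addrC => /eqP; rewrite subr_eq0 => /eqP.
Qed.

End Disc.
End Grid.
End ContractibleCochain.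

(** Finiteness of [S] gives one mesh for all its discs; the cochain depends on the mesh but not on
    [y]. *)
Theorem contractible_cochain (U : realType) (X Y : choiceType)
    (r : Y -> freegroup X) : contractible_presentation U r ->
  forall (S : {fset Y}) (y0 : Y), exists phi : X -> int,
  forall y, y \in S -> letter_sum phi (val (r y)) = (y == y0)%:Z.
Proof.
move=> [p0 [h [ch h0 h1]]] S y0.

(* Retracting time onto [0, 1] makes the homotopy continuous everywhere. *)
pose clamp (t : U) := Num.max 0 (Num.min 1 t).
have clamp_id t : 0 <= t <= 1 -> clamp t = t.
  by move=> /andP[t0 t1]; rewrite /clamp min_r // max_r.
have c_clamp : continuous clamp.
  move=> t; apply: (@continuous_max U _ (fun=> 0) (fun t : U => Num.min 1 t)).
    exact: cst_continuous.
  apply: (@continuous_min U _ (fun=> 1) (fun t : U => t)); last by move=> A.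
  exact: cst_continuous.
pose H (z : pres_complex U r * U) : pres_complex U r := h (z.1, clamp z.2).
have cH : continuous H.
  apply: (within_continuous_comp (A := [set z : pres_complex U r * U | 0 <= z.2 <= 1])
    (g := fun z : pres_complex U r * U => (z.1, clamp z.2)) ch).
    move=> z; apply: (@cvg_pair _ _ _ (nbhs z) (nbhs z.1) (nbhs (clamp z.2))); first exact: cvg_fst.
    by apply: (@cvg_comp _ _ _ _ clamp); [exact: cvg_snd | exact: c_clamp].
  by move=> z /=; rewrite /clamp le_max lexx /= ge_max ler01 /= ge_min lexx.
pose F D (y : Y) (q : U * U * U) : U := cell_fun y0 D (H (disc r y q.1, q.2)).
have cF D y : zero_off_square D -> continuous D -> continuous (F D y).
  move=> D0 cD q.
  apply: (@cvg_comp _ _ _ _ (cell_fun y0 D)); last exact: (cell_fun_continuous D0 cD).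
  apply: (@cvg_comp _ _ _ _ H); last exact: cH.
  apply: (@cvg_pair _ _ _ (nbhs q) (nbhs (disc r y q.1 : pres_complex U r))
    (nbhs q.2)); last exact: cvg_snd.
  apply: (@cvg_comp _ _ _ _ (disc r y)); last exact: disc_continuous.
  exact: cvg_fst.
pose I01 := `[(0 : U), 1].
pose cube : set (U * U * U) := ([set` I01] `*` [set` I01]) `*` [set` I01].
have cpt : compact cube by apply: compact_setX; [apply: compact_setX|]; exact: segment_compact.
have e0 : 0 < 1 / 64 :> U by lra.
have unif D y : zero_off_square D -> continuous D -> \forall d \near (0 : U)^'+,
    forall p q, cube p -> ball p d q -> `|F D y p - F D y q| < 1 / 64.
  by move=> D0 cD; apply: compact_unif_continuous => //; exact: cF.
have unifS : \forall d \near (0 : U)^'+, forall (y : S) p q, cube p -> ball p d q ->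
    [/\ `|F (@depth U) (val y) p - F (@depth U) (val y) q| < 1 / 64,
        `|F (@shift1 U) (val y) p - F (@shift1 U) (val y) q| < 1 / 64 &
        `|F (@shift2 U) (val y) p - F (@shift2 U) (val y) q| < 1 / 64].
  apply: filter_forall => y.
  have a0 := unif _ (val y) (@depth_off U) (@depth_continuous U).
  have a1 := unif _ (val y) (@shift1_off U) (@shift1_continuous U).
  have a2 := unif _ (val y) (@shift2_off U) (@shift2_continuous U).
  by apply: filterS3 a0 a1 a2 => d b0 b1 b2 p q cp pq; split; auto.
have [d [[d0 d64] dP]] :=
  filter_ex (filterI (filterI (nbhs_right_gt (0 : U)) (nbhs_right_lt e0)) unifS).
(* The mesh 1/(n+1) is below [d] for uniform continuity, hence below 1/64 for the degree of the
   bottom face. *)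
have [n] := ltr_add_invr d0; rewrite add0r -div1r => nd.
exists (edge_degree y0 H n) => y yS.
apply: disc_degree.
- by move=> p; rewrite /H /= clamp_id ?lexx ?ler01.
- by exists p0 => p; rewrite /H /= clamp_id ?lexx ?ler01.
- move=> i j k a b c a' b' c' iI jN kN.
  set I := (n.+1 * _)%N in iI *.
  apply: (dP [` yS]%fset ((_, _), _) ((_, _), _)).
    have unit01 (m l : nat) (e : bool) : (m < l)%N -> 0 <= ((m + e)%:R / l%:R : U) <= 1.
      move=> ml; have l0 : (0 < l)%N by exact: leq_trans ml.
      rewrite divr_ge0 //= ler_pdivrMr ?ltr0n // mul1r ler_nat.
      by case: e; rewrite ?addn1 // addn0 ltnW.
    by split; first split; rewrite /= in_itv /=; exact: unit01.
  have step (m l : nat) (e e' : bool) : (n.+1 <= l)%N ->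
      `|(m + e)%:R / l%:R - (m + e')%:R / l%:R| < d :> U.
    move=> nl; rewrite -mulrBl normrM normfV normr_nat.
    apply: le_lt_trans nd; rewrite div1r.
    apply: (@le_trans _ _ l%:R^-1).
      rewrite ler_piMl ?invr_ge0 //.
      rewrite !natrD opprD addrACA subrr add0r.
      by case: e; case: e'; rewrite ?subrr ?subr0 ?sub0r ?normrN ?normr1 ?normr0 ?ler01.
    by rewrite lef_pV2 ?posrE ?ltr0n ?ler_nat // (leq_trans _ nl).
  split; first split; apply: step => //.
  by rewrite leq_pmulr // leq_maxr.
- exact: lt_trans nd d64.
Qed.

Theorem theorem3p6 (U : realType) (X Y : choiceType) (r : Y -> freegroup X)
  (X1 : {fset X}) (Y1 : {fset Y}) (r1 : Y1 -> freegroup X1)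
  (Z : finType) (R : coefficients) :
  contractible_presentation U r ->
  subpresentation r r1 ->
  #|Z| = (#|` X1| - #|` Y1|)%N ->
  [/\ homotopy_equivalent (Rinfty_Wbar R (free_sgroup r1)) (K1 (F_ R Z)),
      pi1_isomorphic (X := Rinfty_Wbar R (free_sgroup r1)) wbase (F_ R Z) &
      forall n, (2 <= n)%N ->
        pi_trivial (X := Rinfty_Wbar R (free_sgroup r1)) wbase n].
Proof.
move=> cK sub cZ.
have phiP (y1 : Y1) : exists phi : X -> int, forall y : Y1,
    letter_sum phi (val (r (val y))) = (y == y1)%:Z.
  have [phi phiE] := contractible_cochain cK Y1 (val y1).
  by exists phi => y; rewrite phiE ?fsvalP // (inj_eq val_inj).
(* Restricted to [X1], these cochains form a right inverse of the relation matrix. *)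
pose phi (x : X1) (y1 : Y1) := sval (cid (phiP y1)) (val x).
have rel_phi (y y1 : Y1) :
    \sum_x exponent_sum (r1 y) x * phi x y1 = (y == y1)%:Z.
  rewrite -(svalP (cid (phiP y1))) -sub letter_sum_lift letter_sum_exponent.
  by apply: eq_bigr => x _; rewrite letter_sum_gen mulrzz mulrC.
rewrite !cardfE in cZ.
have [M [N [MN NM]]] := unimodular_completion cZ rel_phi.
(* The generators in [Z] go to words whose exponent sums are the new rows, which makes the matrix of
   [alpha] invertible. *)
pose word z := sval (cid (word_of_exponents (M z))).
pose alpha (s : Z + Y1) : freegroup X1 :=
  match s with inl z => word z | inr y => r1 y end.
have alphaE s x : exponent_sum (alpha s) x =
    stack_rows (fun y => exponent_sum (r1 y)) M s x.
  by case: s => [z|y] //=; exact: (svalP (cid (word_of_exponents (M z)))).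
have ne : nilpotent_equiv (free_lift alpha).
  apply: (nilpotent_equiv_matrix (N := N)) => [s s'|x x'].
    by rewrite -MN; apply: eq_bigr => x _; rewrite alphaE.
  by rewrite -NM; apply: eq_bigr => s _; rewrite alphaE.
have alphaY (y : Y1) : free_lift alpha (free_gen (inr y)) = r1 y.
  exact: free_liftE.
have ret := nilpotent_equiv_retraction alphaY R ne.
split; first exact: retraction_homotopy_equivalent ret.
- exact: retraction_pi1 ret.
- exact: retraction_pi_trivial ret.
Qed.
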